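(* Let $n\ge 1$, let $\lambda\vdash n$, let $\rho=[1^{n-2}2^1]$ and let $r\ge 0$ be an integer. Define $$a^r_\lambda(\alpha)=\sum_{\beta\vdash n}\frac{1}{h_\beta(\alpha)h'_\beta(\alpha)}\,\theta^\beta_\lambda(\alpha)\left(\theta^\beta_{\rho}(\alpha)\right)^r .$$ Then $a^r_\lambda(\alpha)=0$ whenever $r<r_\lambda:=|\lambda|-\ell(\lambda)$.
   Context: Partitions: $\lambda=(\lambda_1\ge\lambda_2\ge\dots)\vdash n$ has $\ell(\lambda)$ parts and size $|\lambda|=n$; $[1^{m_1}2^{m_2}\dots]$ denotes the partition with $m_i$ parts equal to $i$. For a box $s$ of the Young diagram of $\lambda$, $a(s)$ (armlength) and $l(s)$ (leglength) are the numbers of boxes strictly to the east and strictly to the south of $s$. Set $h_\lambda(\alpha)=\prod_{s\in\lambda}(\alpha a(s)+l(s)+1)$ and $h'_\lambda(\alpha)=\prod_{s\in\lambda}(\alpha(1+a(s))+l(s))$. $p_\mu$ denotes power sum symmetric functions, $m_\mu$ monomial symmetric functions, $z_\lambda=\prod_i i^{m_i(\lambda)}m_i(\lambda)!$. The Jack symmetric functions $J^\alpha_\lambda$ are the symmetric functions that are orthogonal for the scalar product $\langle p_\lambda,p_\mu\rangle_\alpha=\alpha^{\ell(\lambda)}z_\lambda\delta_{\lambda\mu}$ and satisfy $J^\alpha_\lambda=h_\lambda(\alpha)m_\lambda+\sum_{\mu<\lambda}u^\alpha_{\lambda\mu}m_\mu$ (dominance order). The Jack characters $\theta^\lambda_\mu(\alpha)$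 are defined by $J^\alpha_\lambda=\sum_{\mu\vdash n}\theta^\lambda_\mu(\alpha)p_\mu$. *)

(* Defs.v *)
From HB Require Import structures.
From mathcomp Require Import all_boot all_order all_algebra.
From mathcomp Require Import mpoly.

Set Implicit Arguments.
Unset Strict Implicit.
Unset Printing Implicit Defensive.

Import GRing.Theory.
Local Open Scope ring_scope.

Definition is_partition (n : nat) (s : seq nat) : bool :=
  [&& sorted geq s, all (leq 1) s & sumn s == n].

Record intpart (n : nat) := IntPart {
  parts :> seq nat;
  _ : is_partition n parts
}.

HB.instance Definition _ n := [isSub of intpart n for @parts n].
HB.instance Definition _ n := [Countable of intpart n by <:].

Section IntPartFinite.
Variable n : nat.

Definition intpart_to_bseq (la : intpart n) : n.-bseq 'I_n.+1 :=
  insub_bseq n [seq inord i | i <- parts la].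

Definition intpart_of_bseq (b : n.-bseq 'I_n.+1) : option (intpart n) :=
  insub [seq nat_of_ord i | i <- b].

Fact size_le_sumn (s : seq nat) : all (leq 1) s -> (size s <= sumn s)%N.
Proof.
by elim: s => //= x s IHs /andP[x_gt0 /IHs]; rewrite -add1n; apply: leq_add.
Qed.

Fact mem_le_sumn (s : seq nat) i : i \in s -> (i <= sumn s)%N.
Proof.
elim: s => //= x s IHs; rewrite inE => /predU1P[-> | /IHs le_i].
  exact: leq_addr.
exact: leq_trans le_i (leq_addl _ _).
Qed.

Fact intpart_to_bseqK : pcancel intpart_to_bseq intpart_of_bseq.
Proof.
case=> s s_part; have /and3P[_ s_gt0 /eqP s_sum] := s_part.
rewrite /intpart_to_bseq /intpart_of_bseq /=.
have le_s: (size [seq @inord n i | i <- s] <= n)%N.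
  by rewrite size_map -s_sum size_le_sumn.
rewrite /insub_bseq insubdK // -map_comp map_id_in => [|i s_i /=].
  by rewrite insubT.
by rewrite inordK // ltnS -s_sum mem_le_sumn.
Qed.

End IntPartFinite.

HB.instance Definition _ n : isFinite (intpart n) :=
  PCanIsFinite (@intpart_to_bseqK n).

(* The partition [1^n]. *)
Fact column_subproof n : is_partition n (nseq n 1%N).
Proof.
by rewrite /is_partition sumn_nseq mul1n eqxx andbT; elim: n => //= -[].
Qed.
Definition column n : intpart n := IntPart (column_subproof n).

(* The partition [1^(n-2) 2^1]; it exists only for n >= 2, and the value for
   n <= 1 is a dummy. *)
Definition rho n : intpart n := insubd (column n) (2 :: nseq (n - 2) 1)%N.

(* Dominance order; both partitions have at most n parts, so the inequalities
   between partial sums beyond the n-th are automatic. *)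
Definition dominated n (mu la : intpart n) : bool :=
  [forall k : 'I_n.+1, (sumn (take k mu) <= sumn (take k la))%N].

(* Boxes (i, j) are in row i < size la and column j < nth 0 la i, both counted
   from 0, rows going south. *)
Definition arm (s : seq nat) (i j : nat) : nat := (nth 0 s i - j.+1)%N.
Definition leg (s : seq nat) (i j : nat) : nat :=
  count (fun x => j < x)%N (drop i.+1 s).

Definition zpart (s : seq nat) : nat :=
  (\prod_(i <- undup s) (i ^ count_mem i s * (count_mem i s)`!))%N.

Section Jack.
Variable K : fieldType.

(* The Jack parameter: this holds for an indeterminate over a field of
   characteristic 0 and for every positive element of an ordered field. It says
   exactly that no factor of any h_la(alpha) or h'_la(alpha) vanishes; with
   i = 0 it forces K to have characteristic 0. *)
Definition jack_parameter (alpha : K) : Prop :=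
  forall i j : nat, (0 < i + j)%N -> i%:R * alpha + j%:R != 0.

Definition hook (alpha : K) (s : seq nat) : K :=
  \prod_(i < size s) \prod_(j < nth 0%N s i)
    (alpha * (arm s i j)%:R + (leg s i j)%:R + 1).

Definition hook' (alpha : K) (s : seq nat) : K :=
  \prod_(i < size s) \prod_(j < nth 0%N s i)
    (alpha * (1 + (arm s i j)%:R) + (leg s i j)%:R).

(* A symmetric function is given by its restrictions f(x_1, ..., x_N) to
   finitely many variables, for all N, as in the usual inverse limit. Symmetry,
   bounded degree and compatibility of the restrictions are not imposed here:
   every symfun below is required to be a linear combination of the families
   power_sym or monomial_sym, for which they hold. *)
Definition symfun : Type := forall N : nat, {mpoly K[N]}.

Definition power_sym (s : seq nat) : symfun :=
  fun N => \prod_(i <- s) \sum_(k < N) 'X_k ^+ i.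

(* The sum of the distinct monomials whose nonzero exponents are, in some
   order, the parts of s. *)
Definition monomial_sym (s : seq nat) : symfun :=
  fun N => \sum_(m : 'X_{1..N < (sumn s).+1} |
                  perm_eq [seq e <- [seq m i | i : 'I_N] | e != 0%N] s) 'X_[m].

Definition p_expansion n (f : symfun) (c : intpart n -> K) : Prop :=
  forall N, f N = \sum_(mu : intpart n) c mu *: power_sym mu N.

(* Orthogonality for the bilinear form on symmetric functions of degree n such
   that <p_la, p_mu> = delta_(la, mu) alpha^(l(la)) z_la. *)
Definition jack_orthogonal n (alpha : K) (f g : symfun) : Prop :=
  forall c d : intpart n -> K, p_expansion f c -> p_expansion g d ->
    \sum_(mu : intpart n) c mu * d mu * (alpha ^+ size mu * (zpart mu)%:R) = 0.

Definition jack_triangular n (alpha : K) (la : intpart n) (f : symfun) : Prop :=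
  exists u : intpart n -> K, forall N,
    f N = hook alpha la *: monomial_sym la N
          + \sum_(mu : intpart n | dominated mu la && (mu != la))
              u mu *: monomial_sym mu N.

(* These conditions determine the family J uniquely. *)
Definition is_jack (alpha : K) (J : forall n, intpart n -> symfun) : Prop :=
  (forall n (la mu : intpart n), la != mu ->
     jack_orthogonal n alpha (J n la) (J n mu))
  /\ (forall n (la : intpart n), jack_triangular alpha la (J n la)).

Definition is_jack_character (J : forall n, intpart n -> symfun)
    (theta : forall n, intpart n -> intpart n -> K) : Prop :=
  forall n (la : intpart n), p_expansion (J n la) (theta n la).

Definition jack_sum (alpha : K) (theta : forall n, intpart n -> intpart n -> K)
    (n r : nat) (la : intpart n) : K :=
  \sum_(be : intpart n)
    (hook alpha be * hook' alpha be)^-1 * theta n be la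
      * theta n be (rho n) ^+ r.

End Jack.

(* Main.v *)
Require Import Defs.
From mathcomp Require Import all_boot all_order all_algebra.
From mathcomp Require Import mpoly.
From mathcomp Require Import perm ssrcomplements zify ring.

(* Let D be the Laplace-Beltrami operator, self-adjoint for <,>_alpha and
   triangular in the monomial basis; the J_beta are its eigenvectors, the
   eigenvalue being the sum of the contents of beta.  Reading off the coefficient
   of p_1^n in D J_beta identifies theta^beta_rho with this eigenvalue as soon as
   theta^beta_(1^n) = 1.  If moreover <J_beta, J_beta> = h_beta h'_beta, then
   sum_beta J_beta / (h_beta h'_beta) is p_1^n / (alpha^n n!), and a^r_lambda is
   the coefficient of p_lambda in D^r p_1^n / (alpha^n n!).  Since D lowers the
   number of parts by at most one, it vanishes for r < n - l(lambda).

   Both normalisations come from column removal: in l(lambda) variables,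
   P_lambda = x_1 x_2 ... P_mu, where P_lambda = J_lambda / h_lambda and mu is
   lambda without its first column, as both sides are eigenvectors of D with the
   same leading term.  Column removal shows by induction that d/dp_1 P_beta only
   involves the partitions obtained from beta by deleting a box.  Setting all
   power sums equal to X, the relation [d/dp_1, D] = sum_k k p_(k-1) d/dp_k turns
   this into P_beta(X) = [p_1^n]P_beta * prod (X + content), and comparing
   P_lambda and P_mu at X = l(lambda) gives [p_1^n]P_lambda = 1 / h_lambda.

   For the norms, expand prod_i (1 - x_i)^A in the P_lambda: the evaluation
   formula gives the coefficients in terms of the norms.  The symmetry m -> A - m
   of exponents maps P_lambda to P of the complement of lambda in an N x A
   rectangle and preserves prod_i (1 - x_i)^A up to sign.  As lambda in N x A and
   mu in N x (A - 1) have the same complement, this yields a recursion for the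
   norms along column removal. *)

Set Implicit Arguments.
Unset Strict Implicit.
Unset Printing Implicit Defensive.

Import GRing.Theory.
Local Open Scope ring_scope.

(** * Coefficients of multivariate polynomials *)

(** Functions are polynomials in independent symbols p_1, ..., p_M, and [ev N] substitutes N
    variables. No injectivity of this substitution is invoked: linear independence in N variables is
    read off leading monomials ([P_free_ev]), which controls exactly the partitions with at most N
    parts. The number of variables thus becomes a tool: N = l(lambda) allows column removal, one
    variable less exposes d/dp_1, and longer partitions drop out.

    The parameter is not generic, so eigenvalues of different partitions of n may coincide (for
    alpha = 1, those of (4,1,1) and (3,3)). Eigenvectors are therefore compared only within the
    monomials dominated by a given partition. There a difference of eigenvalues is a alpha + b with
    natural numbers a and b > 0, which [jack_parameter] keeps from vanishing.

    Setting all power sums to X serves twice: X = N is the evaluation at x_i = 1, and X = - alpha A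
    yields the coefficients of prod_i (1 - x_i)^A. The code uses twice the operator D, which keeps
    halves out of the formulas. *)

Section MpolyCoef.
Variables (K : fieldType) (N : nat).
Implicit Types (p g T : {mpoly K[N]}) (m : 'X_{1..N}) (i j : 'I_N).

Lemma mcoeffXM i p m :
  ('X_i * p)@_m = if m i == 0%N then 0 else p@_(m - U_(i)).
Proof.
have [mi0|mi0] := eqVneq (m i) 0%N; last first.
  have {1}-> : m = (U_(i) + (m - U_(i)))%MM by rewrite addmC submK ?lep1mP.
  by rewrite mulrC mcoeffMX.
apply: memN_msupp_eq0; rewrite mulrC; apply/negP.
rewrite (perm_mem (msuppMX _ _)) => /mapP[m' _ m_eq].
by move: mi0; rewrite m_eq mnmDE mnm1E eqxx.
Qed.

Lemma mcoeff_euler i p m : ('X_i * p^`M(i))@_m = (m i)%:R * p@_m.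
Proof.
rewrite mcoeffXM; case: eqP => [->|/eqP mi0]; first by rewrite mul0r.
rewrite mcoeff_deriv submK ?lep1mP // mnmBE mnm1E eqxx.
by rewrite mulr_natl; congr (_ *+ _); lia.
Qed.

Lemma mcoeff_X2deriv i p m : ('X_i * ('X_i * p^`M(i)))@_m =
  if m i == 0%N then 0 else ((m i)%:R - 1) * p@_(m - U_(i)).
Proof.
rewrite mcoeffXM; case: eqP => // /eqP mi0; rewrite mcoeff_euler mnmBE mnm1E eqxx.
by rewrite natrB // lt0n.
Qed.

Lemma mcoeff_euler2 i p m :
  ('X_i * ('X_i * p^`M(i)^`M(i)))@_m = (m i)%:R * ((m i)%:R - 1) * p@_m.
Proof.
rewrite mcoeffXM; case: eqP => [->|/eqP mi0]; first by rewrite !mul0r.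
rewrite mcoeff_euler mnmBE mnm1E eqxx mcoeff_deriv submK ?lep1mP //.
rewrite mnmBE mnm1E eqxx natrB ?lt0n // -[_ *+ (_).+1]mulr_natl.
have -> : (m i - true).+1 = m i by rewrite /=; lia.
by rewrite /= mulr1n; ring.
Qed.

(** A raising operator: k units of exponent go from x_j to x_i. Subtraction truncates, so this is
    meaningful only under the guard [k <= m j] of the lemmas below. *)
Definition transfer m i j k : 'X_{1..N} := (m + U_(i) *+ k - U_(j) *+ k)%MM.

Lemma transferE m i j k l : i != j -> (k <= m j)%N ->
  transfer m i j k l = if l == i then (m i + k)%N else
                       if l == j then (m j - k)%N else m l.
Proof.
move=> nij le_k; rewrite /transfer mnmBE mnmDE !mulmnE !mnm1E !(eq_sym _ l).
have [->|ni] := eqVneq l i; first by rewrite (negbTE nij); lia.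
by have [->|nj] := eqVneq l j; lia.
Qed.

Lemma transferD m i j k l : i != j -> (k + l <= m j)%N ->
  transfer (transfer m i j k) i j l = transfer m i j (k + l).
Proof.
move=> nij le_kl; apply/mnmP => a; rewrite /transfer !(mnmBE, mnmDE, mulmnE, mnm1E).
have [eia|nia] := eqVneq i a; last by have [<-|_] := eqVneq j a; lia.
by rewrite -eia [j == i]eq_sym (negbTE nij); lia.
Qed.

(** [T] is a divided difference known only through (x_i - x_j) T. The coefficient at [m + U_(i)]
    relates [T@_m] to the coefficient of [T] one transfer further; the recursion stops when the
    exponent of x_j is used up. *)
Lemma mcoeff_divided_difference g T i j m : i != j ->
  ('X_i - 'X_j) * T = 'X_i * ('X_i * g^`M(i)) - 'X_j * ('X_j * g^`M(j)) ->
  T@_m = (m i)%:R * g@_m +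
    \sum_(1 <= k < (m j).+1) ((m i)%:R - (m j)%:R + (k.*2)%:R) * g@_(transfer m i j k).
Proof.
move=> nij eqT; have [b mj] : {b | m j = b} by exists (m j).
have nji : j != i by rewrite eq_sym.
elim: b m mj => [|b IHb] m mj.
  rewrite mj big_geq // addr0; have /(congr1 (mcoeff (m + U_(i))%MM)) := eqT.
  rewrite mulrBl !mcoeffB !mcoeff_X2deriv !mcoeffXM.
  rewrite !mnmDE !mnm1E eqxx (negbTE nij) mj /= !addn1 /= !subr0 addmK.
  by rewrite -addn1 natrD addrK.
have /(congr1 (mcoeff (m + U_(i))%MM)) := eqT.
rewrite mulrBl !mcoeffB !mcoeff_X2deriv !mcoeffXM.
rewrite !mnmDE !mnm1E eqxx (negbTE nij) mj /= addn0 !addn1 /= addmK.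
have tr1 : (m + U_(i) - U_(j))%MM = transfer m i j 1 by rewrite /transfer !mulm1n.
rewrite tr1 [X in _ - X = _](_ : _ = ((m i).+1)%:R * g@_(transfer m i j 1) +
    \sum_(2 <= k < b.+2) ((m i)%:R - b.+1%:R + (k.*2)%:R) * g@_(transfer m i j k)).
  move/eqP; rewrite subr_eq => /eqP ->.
  rewrite [in RHS](big_ltn (m := 1)) // doubleS double0 -!natr1; ring.
have Ei : transfer m i j 1 i = (m i).+1 by rewrite transferE ?mj // eqxx addn1.
have Ej : transfer m i j 1 j = b by rewrite transferE ?mj // (negbTE nji) eqxx subn1.
rewrite (IHb _ Ej) Ei Ej; apply: (congr1 (+%R _)).
rewrite [RHS](big_addn 1 b.+2 1) subSS subn0; apply: eq_big_nat => k /andP[k1 kb].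
have -> : transfer (transfer m i j 1) i j k = transfer m i j (k + 1).
  by rewrite transferD ?mj // 1?addnC //; lia.
by rewrite addn1 doubleS -!natr1; ring.
Qed.

End MpolyCoef.

Lemma mpoly_alg_ind (K : fieldType) n (P : {mpoly K[n]} -> Prop) :
  (forall c, P c%:MP) -> (forall i, P 'X_i) ->
  (forall p q, P p -> P q -> P (p + q)) ->
  (forall p q, P p -> P q -> P (p * q)) -> forall p, P p.
Proof.
move=> PC PX PD PM p; rewrite [p]mpolyE; elim/big_rec: _ => [|m q _ Pq].
  exact: PC.
apply: (PD) => //; rewrite -mul_mpolyC; apply: (PM) => //.
rewrite mpolyXE_id; elim/big_rec: _ => [|i r _ Pr]; first exact: (PC 1).
apply: (PM) => //; elim: (m i) => [|e IHe]; first exact: (PC 1).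
by rewrite exprS; apply: PM.
Qed.

Lemma mderivXn (K : fieldType) n (p : {mpoly K[n]}) i e :
  (p ^+ e)^`M(i) = e%:R * p ^+ e.-1 * p^`M(i).
Proof.
elim: e => [|e IHe]; first by rewrite expr0 -mpolyC1 mderivC !mul0r.
rewrite exprS mderivM IHe /= -natr1; case: e {IHe} => [|e] /=; first by ring.
by rewrite exprS; ring.
Qed.

Lemma mderivXU (K : fieldType) n (i j : 'I_n) : ('X_i : {mpoly K[n]})^`M(j) = (i == j)%:R.
Proof.
rewrite mderivX mnm1E; have [->|_] := eqVneq i j; last by rewrite scale0r.
have -> : (U_(j) - U_(j))%MM = 0%MM :> 'X_{1..n} by apply/mnmP => k; rewrite mnmBE subnn mnm0E.
by rewrite mpolyX0 scale1r.
Qed.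

(** * The Laplace-Beltrami operator *)

Section PowerSums.
Variables (K : fieldType) (alpha : K) (M : nat).
Implicit Types (F G : {mpoly K[M]}).

(* ['X_i] stands for the power sum [p_(i+1)]. *)
Definition psum N a : {mpoly K[N]} := \sum_(k < N) 'X_k ^+ a.

Definition ev N : {mpoly K[M]} -> {mpoly K[N]} :=
  locked (comp_mpoly [tuple psum N (i : 'I_M).+1 | i < M]).

Lemma evE N F : ev N F = F \mPo [tuple psum N (i : 'I_M).+1 | i < M].
Proof. by rewrite /ev -lock. Qed.

Lemma evXU N i : ev N 'X_i = psum N i.+1.
Proof. by rewrite evE comp_mpolyXU (nth_map i) ?nth_ord_enum // size_enum_ord. Qed.

Lemma evD N F G : ev N (F + G) = ev N F + ev N G. Proof. rewrite !evE; exact: comp_mpolyD. Qed.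
Lemma evM N F G : ev N (F * G) = ev N F * ev N G. Proof. rewrite !evE; exact: rmorphM. Qed.
Lemma evC N c : ev N c%:MP = c%:MP. Proof. rewrite !evE; exact: comp_mpolyC. Qed.
Lemma evZ N c F : ev N (c *: F) = c *: ev N F. Proof. rewrite !evE; exact: comp_mpolyZ. Qed.
Lemma ev_sum N (I : Type) (r : seq I) (P : pred I) (f : I -> {mpoly K[M]}) :
  ev N (\sum_(i <- r | P i) f i) = \sum_(i <- r | P i) ev N (f i).
Proof. by rewrite evE raddf_sum; apply: eq_bigr => i _; rewrite evE. Qed.

Lemma psum0 N : psum N 0 = N%:R.
Proof.
by rewrite /psum (eq_bigr (fun=> 1)) // sumr_const card_ord.
Qed.

Lemma mderiv_psum N a (j : 'I_N) : (psum N a)^`M(j) = a%:R * 'X_j ^+ a.-1.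
Proof.
rewrite /psum raddf_sum (bigD1 j) //= big1 ?addr0 => [|k nkj].
  by rewrite mderivXn mderivXU eqxx mulr1.
by rewrite mderivXn mderivXU (negbTE nkj) mulr0.
Qed.

(** Chain rule: p_(k+1) has derivative (k+1) x_j^k. *)
Lemma mderiv_ev N F (j : 'I_N) :
  (ev N F)^`M(j) = \sum_(k < M) k.+1%:R * ev N F^`M(k) * 'X_j ^+ k.
Proof.
elim/mpoly_alg_ind: F => [c|i|F G IHF IHG|F G IHF IHG].
- rewrite evC mderivC big1 // => k _; rewrite mderivC -mpolyC0 evC mpolyC0; ring.
- rewrite evXU mderiv_psum (bigD1 i) //= big1 ?addr0 => [|k nki].
    by rewrite mderivXU eqxx -mpolyC1 evC mulr1.
  by rewrite mderivXU eq_sym (negbTE nki) -mpolyC0 evC mpolyC0; ring.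
- rewrite evD mderivD IHF IHG -big_split; apply: eq_bigr => k _ /=.
  by rewrite mderivD evD; ring.
- rewrite evM mderivM IHF IHG mulr_suml mulr_sumr -big_split.
  by apply: eq_bigr => k _ /=; rewrite mderivM evD !evM; ring.
Qed.

(* Twice the Laplace-Beltrami operator in power sum coordinates. *)
Definition D2 F : {mpoly K[M]} :=
  \sum_(i < M) \sum_(j < M) \sum_(l < M | l == (i + j).+1 :> nat)
     ((alpha * (i.+1 * j.+1)%:R)%:MP * ('X_l * F^`M(i)^`M(j))
      + l.+1%:R * ('X_i * 'X_j * F^`M(l)))
  + (alpha - 1)%:MP * \sum_(i < M) (i.+1 * i)%:R * ('X_i * F^`M(i)).

(* The operator [(x_i^2 d_i - x_j^2 d_j) / (x_i - x_j)] on symmetric functions,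
   written without division by means of the chain rule. *)
Definition exchange N (i j : 'I_N) F : {mpoly K[N]} := locked
  (\sum_(k < M) k.+1%:R * ev N F^`M(k) * \sum_(a < k.+2) 'X_i ^+ (k.+1 - a) * 'X_j ^+ a).

Lemma exchangeE N (i j : 'I_N) F : exchange i j F =
  \sum_(k < M) k.+1%:R * ev N F^`M(k) * \sum_(a < k.+2) 'X_i ^+ (k.+1 - a) * 'X_j ^+ a.
Proof. by rewrite /exchange -lock. Qed.

Lemma exchangeC N (i j : 'I_N) F : exchange i j F = exchange j i F.
Proof.
rewrite !exchangeE; apply: eq_bigr => k _.
rewrite [X in _ = _ * X](reindex_inj rev_ord_inj); congr (_ * _).
apply: eq_bigr => a _ /=; rewrite mulrC.
by congr ('X_j ^+ _ * 'X_i ^+ _); move: (ltn_ord a); lia.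
Qed.

Lemma exchangeP N (i j : 'I_N) F :
  ('X_i - 'X_j) * exchange i j F =
  'X_i * ('X_i * (ev N F)^`M(i)) - 'X_j * ('X_j * (ev N F)^`M(j)).
Proof.
rewrite exchangeE !mderiv_ev !mulr_sumr -sumrB; apply: eq_bigr => k _.
rewrite [LHS]mulrCA -subrXX -[k.+2]addn2 !exprD; ring.
Qed.

(* [D2] has no room for [p_k] with [k > M], so it agrees with the operator in
   the variables [x_i] only on polynomials without such second order terms. *)
Definition quadratic_free F := forall i j : 'I_M, (M <= (i + j).+1)%N -> F^`M(i)^`M(j) = 0.

(** The double sum over all i, j factors into products of power sums. The diagonal i = j, where k+2
    equal monomials occur, is subtracted; the two extreme values of a give N p_(k+1) each. *)
Lemma sum_exchange N F :
  \sum_(i < N) \sum_(j < N | j != i) exchange i j F =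
  \sum_(k < M) k.+1%:R * ev N F^`M(k) *
    ((N.*2%:R - k.+2%:R) * psum N k.+1 + \sum_(a < k) psum N (k - a) * psum N a.+1).
Proof.
have -> : \sum_(i < N) \sum_(j < N | j != i) exchange i j F =
    \sum_(i < N) \sum_(j < N) exchange i j F - \sum_(i < N) exchange i i F.
  by rewrite -sumrB; apply: eq_bigr => i _; rewrite [in RHS](bigD1 i) //= addrC addrK.
under eq_bigr do under eq_bigr do rewrite exchangeE.
under [in X in _ - X]eq_bigr do rewrite exchangeE.
under eq_bigr do rewrite exchange_big.
rewrite exchange_big [X in _ - X]exchange_big -sumrB.
apply: eq_bigr => k _ /=.
under eq_bigr do rewrite -mulr_sumr.
rewrite -mulr_sumr -[X in _ - X]mulr_sumr -mulrBr; congr (_ * _).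
transitivity (\sum_(a < k.+2) psum N (k.+1 - a) * psum N a - k.+2%:R * psum N k.+1).
  congr (_ - _).
    under eq_bigr do rewrite exchange_big.
    rewrite exchange_big; apply: eq_bigr => a _ /=.
    by rewrite /psum mulr_suml; apply: eq_bigr => i _; rewrite mulr_sumr.
  rewrite /psum mulr_sumr; apply: eq_bigr => i _.
  rewrite (eq_bigr (fun=> 'X_i ^+ k.+1)) => [|a _].
    by rewrite sumr_const card_ord mulr_natl.
  by rewrite -exprD subnK // -ltnS.
rewrite big_ord_recl big_ord_recr /= subn0 subnn psum0 -addnn natrD.
rewrite /bump /=; ring.
Qed.

(** Second derivatives produce the terms in p_(k+l+2), exchanges those with two power sums.
    Subtracting 2N - 2 times the Euler operator cancels the dependence on N left by [sum_exchange],
    so one operator on power sums serves every N. *)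
Lemma ev_D2 N F : quadratic_free F ->
  ev N (D2 F) = alpha%:MP * \sum_(i < N) 'X_i * ('X_i * (ev N F)^`M(i)^`M(i))
    + \sum_(i < N) \sum_(j < N | j != i) exchange i j F
    - (N.*2%:R - 2%:R) * \sum_(i < N) 'X_i * (ev N F)^`M(i).
Proof.
move=> qF.
have euler : \sum_(i < N) 'X_i * (ev N F)^`M(i) =
    \sum_(k < M) k.+1%:R * ev N F^`M(k) * psum N k.+1.
  under eq_bigr do rewrite mderiv_ev mulr_sumr.
  rewrite exchange_big; apply: eq_bigr => k _ /=; rewrite /psum mulr_sumr.
  by apply: eq_bigr => i _; rewrite exprS; ring.
have euler2 : \sum_(i < N) 'X_i * ('X_i * (ev N F)^`M(i)^`M(i)) =
    \sum_(k < M) \sum_(l < M) (k.+1 * l.+1)%:R * ev N F^`M(k)^`M(l) * psum N (k + l).+2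
    + \sum_(k < M) (k.+1 * k)%:R * ev N F^`M(k) * psum N k.+1.
  transitivity (\sum_(i < N) \sum_(k < M)
     ((\sum_(l < M) (k.+1 * l.+1)%:R * ev N F^`M(k)^`M(l) * 'X_i ^+ (k + l).+2)
      + (k.+1 * k)%:R * ev N F^`M(k) * 'X_i ^+ k.+1)).
    apply: eq_bigr => i _; rewrite mderiv_ev raddf_sum !mulr_sumr.
    apply: eq_bigr => k _ /=; rewrite mderivM mderivM -mpolyC_nat mderivC mul0r add0r.
    rewrite mderiv_ev mderivXn mderivXU eqxx mulr1 mulrDr mulrDr; congr (_ + _).
      rewrite mulr_sumr mulr_suml !mulr_sumr; apply: eq_bigr => l _.
      by rewrite natrM -[(k + l).+2]addn2 !exprD mpolyC_nat; ring.
    case: (nat_of_ord k) => [|e] /=; first by rewrite muln0; ring.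
    by rewrite !natrM !exprS mpolyC_nat; ring.
  rewrite exchange_big -big_split; apply: eq_bigr => k _ /=.
  rewrite big_split; congr (_ + _); last by rewrite /psum mulr_sumr.
  by rewrite exchange_big; apply: eq_bigr => l _ /=; rewrite /psum mulr_sumr.
rewrite euler euler2 sum_exchange /D2 evD evM evC !ev_sum.
have -> : \sum_(i < M) ev N (\sum_(j < M) \sum_(l < M | l == (i + j).+1 :> nat)
     ((alpha * (i.+1 * j.+1)%:R)%:MP * ('X_l * F^`M(i)^`M(j))
      + l.+1%:R * ('X_i * 'X_j * F^`M(l)))) =
   alpha%:MP * (\sum_(k < M) \sum_(l < M) (k.+1 * l.+1)%:R * ev N F^`M(k)^`M(l) * psum N (k +
     l).+2)
   + \sum_(k < M) k.+1%:R * ev N F^`M(k) * (\sum_(a < k) psum N (k - a) * psum N a.+1).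
  transitivity (\sum_(i < M) \sum_(j < M) \sum_(l < M | l == (i + j).+1 :> nat)
     alpha%:MP * ((i.+1 * j.+1)%:R * ev N F^`M(i)^`M(j) * psum N (i + j).+2)
     + \sum_(i < M) \sum_(j < M) \sum_(l < M | l == (i + j).+1 :> nat)
       (l.+1%:R * ev N F^`M(l) * (psum N i.+1 * psum N j.+1))).
    rewrite -big_split; apply: eq_bigr => i _ /=; rewrite ev_sum -big_split.
    apply: eq_bigr => j _ /=; rewrite ev_sum -big_split; apply: eq_bigr => l /eqP <- /=.
    by rewrite evD !evM -!mpolyC_nat !evC !evXU mpolyCM; ring.
  congr (_ + _).
    rewrite mulr_sumr; apply: eq_bigr => i _; rewrite mulr_sumr; apply: eq_bigr => j _.
    have [lt_ij|le_ij] := ltnP (i + j).+1 M; first by rewrite (big_pred1 (Ordinal lt_ij)).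
    (* Here p_(i+j+2) is not among the symbols: [D2] has no such term, and [quadratic_free] makes
       the corresponding second derivative vanish. *)
    by rewrite qF // -mpolyC0 evC mpolyC0 mulr0 mul0r mulr0 big1 // => l _; rewrite mulr0.
  rewrite exchange_big; under eq_bigr do rewrite (exchange_big_dep predT) //=.
  rewrite exchange_big; apply: eq_bigr => l _ /=; rewrite mulr_sumr.
  rewrite (big_ord_widen M (fun a => l.+1%:R * ev N F^`M(l) * (psum N (l - a) * psum N a.+1)));
    last exact: ltnW.
  rewrite [RHS]big_mkcond; apply: eq_bigr => j _ /=.
  case: ltnP => [lt_jl|le_lj]; last by rewrite big1 // => i /eqP; lia.
  have lt_i : (l - j.+1 < M)%N by move: (ltn_ord l); lia.
  rewrite (big_pred1 (Ordinal lt_i)) /= ?subnSK // => i.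
  by rewrite [RHS]/= -[RHS]val_eqE /=; apply/eqP/eqP; lia.
have -> : \sum_(i < M) ev N ((i.+1 * i)%:R * ('X_i * F^`M(i))) =
    \sum_(k < M) (k.+1 * k)%:R * ev N F^`M(k) * psum N k.+1.
  by apply: eq_bigr => k _; rewrite !evM -mpolyC_nat evC evXU mpolyC_nat; ring.
rewrite mulrDr -!addrA; congr (_ + _); rewrite !mulr_sumr -sumrN -!big_split.
apply: eq_bigr => k _ /=; rewrite mpolyCB natrM -!natr1.
ring.
Qed.
End PowerSums.

Lemma card_ord_lt N k : (k <= N)%N -> #|[pred j : 'I_N | (j < k)%N]| = k.
Proof.
by move=> le_kN; rewrite -sum1_card -(big_ord_widen N (fun=> 1%N)) // sum1_card card_ord.
Qed.

Section EigenEquation.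
Variables (K : fieldType) (alpha : K).

(** An exchange term is symmetric in its two variables, so its coefficients can be expanded with
    transfers in either direction. [diag] is the diagonal part when transfers go to the smaller
    index, [diag_rev] when they go to the larger one; the second is needed because complementing
    exponents reverses transfers. *)
Definition diag N (m : 'X_{1..N}) : K :=
  \sum_(i < N) (alpha * ((m i)%:R * ((m i)%:R - 1)) - (i * m i).*2%:R).

Definition diag_rev N (m : 'X_{1..N}) : K :=
  \sum_(i < N) (alpha * ((m i)%:R * ((m i)%:R - 1)) - ((N.-1 - i) * m i).*2%:R).

Definition transfer_sum N (c : 'X_{1..N} -> K) (m : 'X_{1..N}) (i j : 'I_N) : K :=
  \sum_(1 <= k < (m j).+1) ((m i)%:R - (m j)%:R + k.*2%:R) * c (transfer m i j k).

(** Stated at one exponent [m], since for the transformed coefficient functions it is only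
    established at weakly decreasing exponents. *)
Definition eigen_eq N (e : K) (c : 'X_{1..N} -> K) m : Prop :=
  e * c m = diag m * c m + 2%:R * \sum_(i < N) \sum_(j < N | (i < j)%N) transfer_sum c m i j.

Definition eigen_eq_rev N (e : K) (c : 'X_{1..N} -> K) m : Prop :=
  e * c m = diag_rev m * c m
    + 2%:R * \sum_(i < N) \sum_(j < N | (j < i)%N) transfer_sum c m i j.

Variables (M : nat).
Implicit Types (F : {mpoly K[M]}).

Lemma mcoeff_exchange N F (i j : 'I_N) m : i != j ->
  (exchange i j F)@_m = (m i)%:R * (ev N F)@_m + transfer_sum (fun m' => (ev N F)@_m') m i j.
Proof. by move=> nij; apply: mcoeff_divided_difference => //; apply: exchangeP. Qed.

Lemma sum_exchange_sym N F : \sum_(i < N) \sum_(j < N | (j < i)%N) exchange i j F =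
  \sum_(i < N) \sum_(j < N | (i < j)%N) exchange i j F.
Proof.
rewrite (exchange_big_dep predT) /=; last by [].
apply: eq_bigr => i _; apply: eq_bigr => j _.
exact: exchangeC.
Qed.

Lemma sum_exchange_lt N F :
  \sum_(i < N) \sum_(j < N | j != i) exchange i j F =
  (\sum_(i < N) \sum_(j < N | (i < j)%N) exchange i j F) *+ 2.
Proof.
rewrite mulr2n -[X in _ + X]sum_exchange_sym -big_split; apply: eq_bigr => i _ /=.
rewrite [LHS](bigID (fun j : 'I_N => (i < j)%N)) /=.
have -> : \sum_(j < N | (j != i) && (i < j)%N) exchange i j F =
    \sum_(j < N | (i < j)%N) exchange i j F.
  by apply: eq_bigl => j; rewrite -val_eqE /=; case: ltngtP.
have -> // : \sum_(j < N | (j != i) && ~~ (i < j)%N) exchange i j F =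
    \sum_(j < N | (j < i)%N) exchange i j F.
by apply: eq_bigl => j; rewrite -val_eqE /=; case: ltngtP.
Qed.

Lemma sum_exchange_gt N F :
  \sum_(i < N) \sum_(j < N | j != i) exchange i j F =
  (\sum_(i < N) \sum_(j < N | (j < i)%N) exchange i j F) *+ 2.
Proof. by rewrite sum_exchange_lt sum_exchange_sym. Qed.

Lemma mcoeff_ev_D2_exchange N F m : quadratic_free F ->
  (ev N (D2 alpha F))@_m =
  (\sum_(i < N) (alpha * ((m i)%:R * ((m i)%:R - 1)) - (N.*2%:R - 2%:R) * (m i)%:R))
    * (ev N F)@_m + (\sum_(i < N) \sum_(j < N | j != i) exchange i j F)@_m.
Proof.
move=> qF; set g := ev N F.
have e1 : (\sum_(i < N) 'X_i * g^`M(i))@_m = (\sum_(i < N) (m i)%:R) * g@_m.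
  by rewrite raddf_sum mulr_suml; apply: eq_bigr => i _; apply: mcoeff_euler.
have eigval : (\sum_(i < N) 'X_i * ('X_i * g^`M(i)^`M(i)))@_m =
    (\sum_(i < N) (m i)%:R * ((m i)%:R - 1)) * g@_m.
  by rewrite raddf_sum mulr_suml; apply: eq_bigr => i _; apply: mcoeff_euler2.
rewrite ev_D2 // (_ : N.*2%:R - 2%:R = (N.*2%:R - 2%:R)%:MP); last first.
  by rewrite mpolyCB !mpolyC_nat.
rewrite mcoeffB mcoeffD !mcoeffCM -/g e1 eigval sumrB -!mulr_sumr.
by move: (mcoeff m _) => x; ring.
Qed.

Lemma mcoeff_sum_exchange N F m (o : 'I_N -> pred 'I_N) : (forall i, ~~ o i i) ->
  (\sum_(i < N) \sum_(j < N | o i j) exchange i j F)@_m =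
  (\sum_(i < N) (#|o i| * m i)%:R) * (ev N F)@_m
  + \sum_(i < N) \sum_(j < N | o i j) transfer_sum (fun m' => (ev N F)@_m') m i j.
Proof.
move=> o_irr; rewrite raddf_sum mulr_suml -big_split; apply: eq_bigr => i _ /=.
rewrite raddf_sum -sum1_card big_distrl natr_sum mulr_suml -big_split /=.
apply: eq_bigr => j oij; rewrite mul1n mcoeff_exchange //.
by apply: contraTneq oij => ->.
Qed.

(** Variable i receives from N - 1 - i others; twice this, against the Euler coefficient 2N - 2,
    leaves the - 2 i of [diag]. *)
Lemma mcoeff_ev_D2 N F m : quadratic_free F ->
  (ev N (D2 alpha F))@_m = diag m * (ev N F)@_m + 2%:R *
    \sum_(i < N) \sum_(j < N | (i < j)%N) transfer_sum (fun m' => (ev N F)@_m') m i j.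
Proof.
move=> qF; rewrite mcoeff_ev_D2_exchange // sum_exchange_lt mcoeffMn mulr2n.
rewrite mcoeff_sum_exchange => [|i]; last by rewrite ltnn.
set A := \sum_(i < N) (_ - _); set C := \sum_(i < N) _%:R.
suff -> : diag m = A + 2%:R * C by ring.
rewrite /A /C mulr_sumr -big_split; apply: eq_bigr => i _ /=;
  have := cardC [pred j : 'I_N | (j < i.+1)%N].
rewrite card_ord card_ord_lt // => card_eq.
have -> : #|(fun j : 'I_N => (i < j)%N)| = (N - i.+1)%N.
  apply/eqP; rewrite -(eqn_add2l i.+1) subnKC // -[X in _ == X]card_eq eqn_add2l; apply/eqP.
  by apply: eq_card => j; rewrite !inE -ltnNge ltnS.
rewrite -!muln2 !natrM natrB // -natr1; ring.
Qed.

Lemma mcoeff_ev_D2_rev N F m : quadratic_free F ->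
  (ev N (D2 alpha F))@_m = diag_rev m * (ev N F)@_m + 2%:R *
    \sum_(i < N) \sum_(j < N | (j < i)%N) transfer_sum (fun m' => (ev N F)@_m') m i j.
Proof.
move=> qF; rewrite mcoeff_ev_D2_exchange // sum_exchange_gt mcoeffMn mulr2n.
rewrite mcoeff_sum_exchange => [|i]; last by rewrite ltnn.
set A := \sum_(i < N) (_ - _); set C := \sum_(i < N) _%:R.
suff -> : diag_rev m = A + 2%:R * C by ring.
rewrite /A /C mulr_sumr -big_split; apply: eq_bigr => i _ /=.
have -> : #|(fun j : 'I_N => (j < i)%N)| = i by apply: card_ord_lt; apply: ltnW.
rewrite -!muln2 !natrM -subn1 -subnDA add1n natrB // -natr1; ring.
Qed.
End EigenEquation.

(** * Dominance and uniqueness of eigenvectors *)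

Section Majorization.
Local Open Scope nat_scope.
Implicit Types f g : nat -> nat.

Lemma sum_ordS N f : \sum_(i < N.+1) f i = \sum_(i < N) f i + f N.
Proof. exact: big_ord_recr. Qed.

Definition wsum N f := \sum_(i < N) i * f i.

(** Summation by parts: for a fixed total, comparing [wsum] amounts to comparing sums of partial
    sums, with the order reversed. *)
Lemma wsum_partial N f :
  \sum_(k < N.+1) \sum_(i < k) f i + wsum N f = N * \sum_(i < N) f i.
Proof.
elim: N => [|N IHN]; first by rewrite /wsum big_ord_recl !big_ord0.
move: IHN; rewrite /wsum (sum_ordS N.+1 (fun k => \sum_(i < k) f i)).
rewrite (sum_ordS N (fun i => i * f i)) (sum_ordS N f).
by rewrite mulSn mulnDr; lia.
Qed.

Lemma sum_leq_eq N f g : (forall k, k < N -> f k <= g k) ->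
  \sum_(k < N) g k <= \sum_(k < N) f k -> forall k, k < N -> f k = g k.
Proof.
elim: N => // N IHN le_fg; rewrite !sum_ordS => le_sum k.
have le_N : \sum_(k < N) f k <= \sum_(k < N) g k.
  by apply: leq_sum => i _; apply: le_fg; apply: ltnW; rewrite ltnS.
have le_fgN := le_fg N (ltnSn N).
rewrite ltnS leq_eqVlt => /predU1P[->|lt_kN]; first by lia.
by apply: IHN lt_kN => [i lt_i|]; [apply: le_fg; apply: ltnW | lia].
Qed.

Definition majorizes N f g := forall k, k <= N -> \sum_(i < k) g i <= \sum_(i < k) f i.

Lemma majorizes_eq N f g : majorizes N f g ->
  \sum_(i < N) f i = \sum_(i < N) g i -> wsum N g <= wsum N f ->
  forall i, i < N -> f i = g i.
Proof.
move=> maj eq_sum le_w.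
have := @sum_leq_eq N.+1 (fun k => \sum_(i < k) g i) (fun k => \sum_(i < k) f i).
move=> /(_ (fun k lt_k => maj k lt_k)) eqS i lt_iN.
have {}eqS : forall k, k < N.+1 -> \sum_(i < k) g i = \sum_(i < k) f i.
  apply: eqS; have := wsum_partial N f; have := wsum_partial N g; rewrite eq_sum.
  by lia.
have := eqS i.+1 lt_iN; have := eqS i (ltnW lt_iN).
by rewrite !sum_ordS => ->; lia.
Qed.

Lemma majorizes_mul N f g : majorizes N f g -> 
  (forall i, i.+1 < N -> g i.+1 <= g i) ->
  \sum_(i < N) g i * g i <= \sum_(i < N) g i * f i.
Proof.
move=> maj antitone.
(* Abel summation without subtraction: the excess of sum g f over sum g g is at least g_k times the
   excess of the partial sums, an invariant preserved because g decreases. *)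
suff H k : k < N -> g k * \sum_(i < k.+1) f i + \sum_(i < k.+1) g i * g i
    <= \sum_(i < k.+1) g i * f i + g k * \sum_(i < k.+1) g i.
  case: N maj antitone H => [|N] maj antitone H; first by rewrite !big_ord0.
  by have := H N (ltnSn N); have := leq_mul (leqnn (g N)) (maj N.+1 (leqnn _)); lia.
elim: k => [|k IHk] lt_kN; first by rewrite !big_ord1 addnC.
have := IHk (ltnW lt_kN); have := antitone k lt_kN; have := maj k.+1 (ltnW lt_kN).
rewrite !(sum_ordS k.+1) (sum_ordS k.+1 (fun i => g i * g i)) (sum_ordS k.+1 (fun i => g i * f
  i)).
move: (\sum_(i < k.+1) f i) (\sum_(i < k.+1) g i) => F G.
move: (\sum_(i < k.+1) _) (\sum_(i < k.+1) _) => U V; nia.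
Qed.

Lemma majorizes_sq N f g : majorizes N f g -> 
  (forall i, i.+1 < N -> g i.+1 <= g i) ->
  \sum_(i < N) g i * g i <= \sum_(i < N) f i * f i.
Proof.
move=> maj antitone; have := majorizes_mul maj antitone.
have : 2 * (\sum_(i < N) g i * f i) <= \sum_(i < N) f i * f i + \sum_(i < N) g i * g i.
  rewrite big_distrr -big_split; apply: leq_sum => i _ /=.
  by rewrite !mulnn [g i * _]mulnC (nat_Cauchy (f i) (g i)).
by lia.
Qed.

End Majorization.

Definition is_part s := sorted geq s && all (leq 1) s.

Section Partitions.
Local Open Scope nat_scope.
Implicit Types (s : seq nat).

Lemma sumn_take s k : sumn (take k s) = \sum_(i < k) nth 0 s i.
Proof.
elim: s k => [|x s IHs] [|k] //=; rewrite ?big_ord0 //; last first.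
  by rewrite big_ord_recl IHs.
by rewrite big1 // => i _; rewrite nth_nil.
Qed.

Lemma sumn_nth s N : size s <= N -> sumn s = \sum_(i < N) nth 0 s i.
Proof. by move=> le_sN; rewrite -sumn_take take_oversize. Qed.

Lemma part_nth s i j : is_part s -> i <= j -> nth 0 s j <= nth 0 s i.
Proof.
case/andP=> s_sorted _ le_ij; have [lt_j|le_j] := ltnP j (size s); last by rewrite nth_default.
apply: (@sorted_leq_nth _ geq); rewrite ?inE //; last exact: leq_ltn_trans le_ij lt_j.
  by move=> x y z /= ? ?; lia.
by move=> x /=.
Qed.

Lemma part_nth_gt0 s i : is_part s -> (0 < nth 0 s i) = (i < size s).
Proof.
case/andP=> _ /allP s_pos; have [lt_i|le_i] := ltnP i (size s); last by rewrite nth_default.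
by apply: s_pos; apply: mem_nth.
Qed.

Lemma part_eq s t : is_part s -> is_part t -> nth 0 s =1 nth 0 t -> s = t.
Proof.
move=> s_part t_part eq_st; apply: (@eq_from_nth _ 0) => //.
apply/eqP; rewrite eqn_leq; apply/andP; split; rewrite leqNgt.
  by rewrite -(part_nth_gt0 (size t) s_part) eq_st part_nth_gt0 // ltnn.
by rewrite -(part_nth_gt0 (size s) t_part) -eq_st part_nth_gt0 // ltnn.
Qed.

Lemma size_le_sum_part s : is_part s -> size s <= sumn s.
Proof. by case/andP=> _; apply: size_le_sumn. Qed.

Definition pexp N s : 'X_{1..N} := [multinom nth 0 s i | i < N].

Lemma pexpE N s i : pexp N s i = nth 0 s i. Proof. exact: mnmE. Qed.

Lemma mdeg_pexp N s : size s <= N -> mdeg (pexp N s) = sumn s.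
Proof. by move=> le_sN; rewrite mdegE (sumn_nth le_sN); apply: eq_bigr => i _; rewrite pexpE. Qed.

(* Dominance; quantifying over all sets of variables rather than over initial
   segments makes it invariant under permutations of [m]. *)
Definition dom N s (m : 'X_{1..N}) :=
  forall A : {set 'I_N}, \sum_(i in A) m i <= sumn (take #|A| s).

Definition antitone N (m : 'X_{1..N}) := forall i j : 'I_N, i <= j -> m j <= m i.

Lemma sum_ord_lt N (m : 'X_{1..N}) k : k <= N ->
  \sum_(i in [set i : 'I_N | i < k]) m i = \sum_(i < k) nth 0 m i.
Proof.
move=> le_kN; rewrite (big_ord_widen N (nth 0 m)) //.
by apply: eq_big => i; [rewrite inE | rewrite (mnm_nth 0)].
Qed.

Lemma card_set_ord_lt N k : k <= N -> #|[set i : 'I_N | i < k]| = k.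
Proof. by move=> le_kN; rewrite cardsE card_ord_lt. Qed.

Lemma dom_majorizes N s m : @dom N s m -> majorizes N (nth 0 s) (nth 0 m).
Proof.
move=> dom_m k le_kN; have := dom_m [set i : 'I_N | i < k].
by rewrite sum_ord_lt // card_set_ord_lt // sumn_take.
Qed.

Lemma dom_size N s m : is_part s -> @dom N s m -> mdeg m = sumn s -> size s <= N.
Proof.
move=> s_part /(_ setT); rewrite cardsT card_ord => le_m deg_m; rewrite leqNgt;
  apply/negP => lt_N.
have : \sum_(i in [set: 'I_N]) m i = sumn s.
  by rewrite -deg_m mdegE; apply: eq_bigl => i; rewrite inE.
move=> sum_m; move: le_m; rewrite sum_m -{1}(cat_take_drop N s) sumn_cat.
rewrite (drop_nth 0) //= -subn_eq0; have := part_nth_gt0 N s_part; rewrite lt_N; lia.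
Qed.

Lemma mdeg_nth N (m : 'X_{1..N}) : mdeg m = \sum_(i < N) nth 0 m i.
Proof. by rewrite mdegE; apply: eq_bigr => i _; rewrite (mnm_nth 0). Qed.

Lemma dom_sum_eq N s m : is_part s -> @dom N s m -> mdeg m = sumn s ->
  \sum_(i < N) nth 0 s i = \sum_(i < N) nth 0 m i.
Proof.
by move=> s_part dom_m deg_m; rewrite -mdeg_nth deg_m (sumn_nth (dom_size s_part dom_m deg_m)).
Qed.

(** Descending in dominance pushes exponents to later positions. The strict inequality makes [wsum]
    the induction measure of the triangularity arguments. *)
Lemma dom_wsum N s m : is_part s -> @dom N s m -> mdeg m = sumn s ->
  m <> pexp N s -> wsum N (nth 0 s) < wsum N (nth 0 m).
Proof.
move=> s_part dom_m deg_m ne_m; rewrite ltnNge; apply/negP => le_w; apply: ne_m.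
apply/mnmP => i; rewrite pexpE (mnm_nth 0).
by rewrite (majorizes_eq (dom_majorizes dom_m) (dom_sum_eq s_part dom_m deg_m) le_w).
Qed.

Lemma dom_sq N s m : is_part s -> @dom N s m -> antitone m ->
  \sum_(i < N) nth 0 m i * nth 0 m i <= \sum_(i < N) nth 0 s i * nth 0 s i.
Proof.
move=> s_part dom_m dec_m; apply: majorizes_sq (dom_majorizes dom_m) _ => i lt_i.
have := dec_m (Ordinal (ltnW lt_i)) (Ordinal lt_i) (leqnSn i).
by rewrite !(mnm_nth 0).
Qed.

Lemma dom_transfer N s (m : 'X_{1..N}) i j k : i != j -> k <= m j -> m j <= m i ->
  dom s (transfer m i j k) -> dom s m.
Proof.
move=> nij le_k le_ji dom_t A; have trE := transferE _ nij le_k.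
have [iA|niA] := boolP (i \in A); last have [jA|njA] := boolP (j \in A).
- apply: leq_trans (dom_t A); have [jA|njA] := boolP (j \in A).
    rewrite (bigD1 i) // (bigD1 j) /=; last by rewrite jA eq_sym.
    rewrite [X in _ <= X](bigD1 i) // [X in _ <= _ + X](bigD1 j) /=; last by rewrite jA eq_sym.
    rewrite !trE !eqxx eq_sym (negbTE nij) addnA [X in _ <= X]addnA.
    rewrite leq_add //; first by lia.
    by apply: leq_sum => l /andP[/andP[_ /negbTE nli] /negbTE nlj]; rewrite trE nli nlj.
  apply: leq_sum => l lA; rewrite trE; case: eqP => [->|_]; first exact: leq_addr.
  by case: eqP => // lj; rewrite -lj lA in njA.
(* When A contains the donor j but not i, exchange j for i: the cardinality is unchanged, and the
   exponent of i after the transfer is at least that of j before. *)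
- have := dom_t (i |: A :\ j); rewrite cardsU1 !inE negb_and niA orbT.
  have := cardsD1 j A; rewrite jA => -> le_t; apply: leq_trans le_t.
  rewrite (bigD1 j) //= big_setU1 ?inE ?(negbTE niA) ?andbF //= leq_add //.
    by rewrite trE eqxx; lia.
  rewrite [X in _ <= X](eq_bigl (fun l => (l \in A) && (l != j))) => [|l]; last first.
    by rewrite !inE andbC.
  apply: leq_sum => l /andP[lA /negbTE nlj]; rewrite trE nlj.
  by case: eqP => // li; rewrite -li lA in niA.
- apply: leq_trans (dom_t A); apply: leq_sum => l lA; rewrite trE.
  case: eqP => [li|_]; first by rewrite -li lA in niA.
  by case: eqP => // lj; rewrite -lj lA in njA.
Qed.

Lemma sum2E N (F : 'I_N -> nat) i j : i != j ->
  \sum_l F l = F i + F j + \sum_(l | (l != i) && (l != j)) F l.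
Proof. by move=> nij; rewrite (bigD1 i) //= (bigD1 j) /= ?addnA // eq_sym. Qed.

Lemma mdeg_transfer N (m : 'X_{1..N}) i j k : i != j -> k <= m j ->
  mdeg (transfer m i j k) = mdeg m.
Proof.
move=> nij le_k; have trE := transferE _ nij le_k.
rewrite !mdegE !(sum2E _ nij) !trE !eqxx eq_sym (negbTE nij).
congr (_ + _); first by lia.
by apply: eq_bigr => l /andP[/negbTE nli /negbTE nlj]; rewrite trE nli nlj.
Qed.

Definition sqsum N (m : 'X_{1..N}) := \sum_i m i * m i.

(** The gain is 2k (m_i - m_j + k). Since [sqsum] is bounded in a given degree, repeated transfers
    terminate. *)
Lemma sqsum_transfer N (m : 'X_{1..N}) i j k : i != j -> 0 < k -> k <= m j -> m j <= m i ->
  sqsum m < sqsum (transfer m i j k).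
Proof.
move=> nij k_gt0 le_k le_ji; have trE := transferE _ nij le_k.
rewrite /sqsum !(sum2E _ nij) !trE !eqxx [j == i]eq_sym (negbTE nij).
rewrite [X in _ < _ + X](eq_bigr (fun l => m l * m l)); last first.
  by move=> l /andP[/negbTE nli /negbTE nlj]; rewrite trE nli nlj.
by rewrite ltn_add2r; nia.
Qed.

Lemma sqsum_le N (m : 'X_{1..N}) : sqsum m <= mdeg m * mdeg m.
Proof.
rewrite /sqsum {2}mdegE big_distrr; apply: leq_sum => i _ /=.
by rewrite leq_mul2r mdegE (bigD1 i) //= leq_addr orbT.
Qed.

Lemma sort_mnm N (m : 'X_{1..N}) : exists sg : {perm 'I_N}, antitone [multinom m (sg i) | i < N].
Proof.
have /tuple_permP[sg eq_sg] : perm_eq (sort geq m) m by rewrite perm_sort.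
exists sg => i j le_ij; rewrite !mnmE.
have nthE (l : 'I_N) : m (sg l) = nth 0 (sort geq m) l.
  by rewrite eq_sg -tnth_nth tnth_mktuple.
rewrite !nthE; have szE : size (sort geq m) = N by rewrite size_sort size_tuple.
apply: (@sorted_leq_nth _ geq); rewrite ?inE ?szE //.
- by move=> x y z /= ? ?; lia.
- by move=> x /=.
by apply: sort_sorted => x y /=; apply: leq_total.
Qed.

End Partitions.

Section Uniqueness.
Variables (K : fieldType) (alpha : K).
Hypothesis alphaP : jack_parameter alpha.

Lemma natr_neq0 n : (0 < n)%N -> n%:R != 0 :> K.
Proof. by move=> n_gt0; have := @alphaP 0 n n_gt0; rewrite mul0r add0r. Qed.

Lemma jack_parameter_neq0 : alpha != 0.
Proof. by have := @alphaP 1 0 isT; rewrite mul1r addr0. Qed.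

(** Twice the sum of the contents alpha j - i over the boxes (i, j): row i, of length a, contributes
    alpha a (a - 1) - 2 i a. *)
Definition eigval (s : seq nat) : K :=
  \sum_(i < size s) (alpha * ((nth 0%N s i)%:R * ((nth 0%N s i)%:R - 1))
                     - (i * nth 0%N s i).*2%:R).

Lemma diag_pexp N s : (size s <= N)%N -> diag alpha (pexp N s) = eigval s.
Proof.
move=> le_sN; rewrite /eigval (big_ord_widen N (fun i => alpha * ((nth 0%N s i)%:R *
  ((nth 0%N s i)%:R - 1)) - (i * nth 0%N s i).*2%:R)) // [RHS]big_mkcond.
apply: eq_bigr => i _; rewrite pexpE; case: ltnP => // le_i.
by rewrite nth_default // mul0r mulr0 muln0 subr0.
Qed.

Lemma diagE N (m : 'X_{1..N}) : diag alpha m =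
  alpha * ((\sum_(i < N) nth 0%N m i * nth 0%N m i)%:R - (mdeg m)%:R)
  - (wsum N (nth 0%N m)).*2%:R.
Proof.
rewrite /diag /wsum mdegE -mul2n natrM !natr_sum -sumrB !mulr_sumr -sumrB.
apply: eq_bigr => i _; rewrite -(mnm_nth 0%N) -mul2n !natrM; ring.
Qed.

Lemma nth_pexp N s i : (i < N)%N -> nth 0%N (pexp N s) i = nth 0%N s i.
Proof. by move=> lt_i; rewrite -(mnm_nth 0%N _ (Ordinal lt_i)) pexpE. Qed.

(** The difference is alpha times a gap of square sums plus twice a gap of [wsum]. Dominance makes
    the first gap nonnegative and the second positive, so [jack_parameter] applies. *)
Lemma eigval_neq_diag N s (m : 'X_{1..N}) : is_part s -> dom s m -> mdeg m = sumn s ->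
  antitone m -> m <> pexp N s -> eigval s - diag alpha m != 0.
Proof.
move=> s_part dom_m deg_m dec_m ne_m; have le_sN := dom_size s_part dom_m deg_m.
rewrite -(diag_pexp le_sN) !diagE mdeg_pexp // deg_m.
have -> : wsum N (nth 0%N (pexp N s)) = wsum N (nth 0%N s).
  by apply: eq_bigr => i _; rewrite nth_pexp.
have -> : (\sum_(i < N) nth 0 (pexp N s) i * nth 0 (pexp N s) i =
           \sum_(i < N) nth 0 s i * nth 0 s i)%N.
  by apply: eq_bigr => i _; rewrite nth_pexp.
have lt_w := dom_wsum s_part dom_m deg_m ne_m; have le_sq := dom_sq s_part dom_m dec_m.
set a := (\sum_(i < N) _)%N in le_sq *; set b := (\sum_(i < N) _)%N in le_sq *.
have := @alphaP (b - a)%N ((wsum N (nth 0%N m)).*2 - (wsum N (nth 0%N s)).*2)%N.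
have -> : (0 < b - a + ((wsum N (nth 0 m)).*2 - (wsum N (nth 0 s)).*2))%N by lia.
rewrite !natrB ?leq_double ?(ltnW lt_w) // => /(_ isT); congr (_ != 0); ring.
Qed.

(** By symmetry it suffices to treat decreasing exponents. There every transfer increases the square
    sum, so by induction only the diagonal term remains in the equation, and away from the leading
    exponent its coefficient differs from the eigenvalue. *)
Lemma eigen_eq_unique N s (c : 'X_{1..N} -> K) : is_part s ->
  (forall (sg : {perm 'I_N}) (m : 'X_{1..N}), c [multinom m (sg i) | i < N] = c m) ->
  (forall m, c m != 0 -> dom s m /\ mdeg m = sumn s) ->
  (forall m, antitone m -> eigen_eq alpha (eigval s) c m) ->
  c (pexp N s) = 0 -> forall m, c m = 0.
Proof.
move=> s_part c_sym c_supp c_eig c_lead m.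
have [d] := ubnP (sumn s * sumn s - sqsum m); elim: d m => // d IHd m lt_d.
have [sg dec_m] := sort_mnm m; rewrite -(c_sym sg).
set m' := [multinom _ | i < N] in dec_m *.
have sq_m : sqsum m' = sqsum m.
  rewrite /sqsum [RHS](reindex_inj (@perm_inj _ sg)); apply: eq_bigr => i _.
  by rewrite mnmE.
have [c0|cn0] := eqVneq (c m') 0; first by [].
have [dom_m deg_m] := c_supp _ cn0.
have ne_m : m' <> pexp N s by move=> e; rewrite e c_lead eqxx in cn0.
have := c_eig _ dec_m; rewrite /eigen_eq big1 => [|i _]; last first.
  apply: big1 => j lt_ij; rewrite /transfer_sum big_nat; apply: big1 => k /andP[k_gt0 lt_k].
  have nij : i != j by rewrite -val_eqE neq_ltn lt_ij.
  have := sqsum_transfer nij k_gt0 lt_k (dec_m _ _ (ltnW lt_ij)).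
  have := sqsum_le (transfer m' i j k); rewrite mdeg_transfer // deg_m.
  by rewrite sq_m => le_t lt_t; rewrite IHd ?mulr0 //; lia.
rewrite mulr0 addr0 => /eqP; rewrite -subr_eq0 -mulrBl mulf_eq0 (negbTE cn0) orbF.
by rewrite (negbTE (eigval_neq_diag s_part dom_m deg_m dec_m ne_m)).
Qed.

End Uniqueness.

Section EvalSymmetric.
Variables (K : fieldType) (M : nat).

Lemma mcoeff_ev_sym N (F : {mpoly K[M]}) (sg : {perm 'I_N}) (m : 'X_{1..N}) :
  (ev N F)@_[multinom m (sg i) | i < N] = (ev N F)@_m.
Proof.
suff /issymP sym_F : ev N F \is symmetric.
  by rewrite -[in RHS](sym_F sg) mcoeff_sym.
elim/mpoly_alg_ind: F => [c|i|F G ? ?|F G ? ?].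
- by rewrite evC; apply/issymP => t; rewrite -[c]mulr1 mpolyCM msymM -alg_mpolyC msymZ msym1
  mpolyC1.
- rewrite evXU; apply/issymP => t; rewrite /psum raddf_sum [RHS](reindex_inj (@perm_inj _ t)).
  apply: eq_bigr => k _ /=; rewrite rmorphXn /= msymX; congr (_ ^+ _); congr 'X_[_].
  by apply/mnmP => l; rewrite mnmE !mnm1E (canF_eq (permK t)).
- by rewrite evD rpredD.
- by rewrite evM rpredM.
Qed.
End EvalSymmetric.

(** * Gradings and the scalar product *)

Section Support.
Variables (K : fieldType) (M : nat).
Implicit Types (F G : {mpoly K[M]}) (Q : 'X_{1..M} -> Prop).

(** One predicate serves both the grading by degree in the x_i ([whomog]) and the filtration by
    number of parts ([D2_mdeg]). *)
Definition supp_in Q F := forall m, F@_m != 0 -> Q m.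

Lemma supp_in0 Q : supp_in Q 0.
Proof. by move=> m; rewrite mcoeff0 eqxx. Qed.

Lemma supp_inD Q F G : supp_in Q F -> supp_in Q G -> supp_in Q (F + G).
Proof.
move=> QF QG m; rewrite mcoeffD; have [F0|/QF //] := eqVneq F@_m 0.
by rewrite F0 add0r; apply: QG.
Qed.

Lemma supp_in_sum Q (I : Type) (r : seq I) (P : pred I) (f : I -> {mpoly K[M]}) :
  (forall i, P i -> supp_in Q (f i)) -> supp_in Q (\sum_(i <- r | P i) f i).
Proof.
by move=> Qf; elim/big_ind: _ => //; [apply: supp_in0 | move=> ? ?; apply: supp_inD].
Qed.

Lemma supp_inZ Q c F : supp_in Q F -> supp_in Q (c *: F).
Proof.
by move=> QF m; rewrite mcoeffZ mulf_eq0 negb_or => /andP[_]; apply: QF.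
Qed.

Lemma supp_inC Q c F : supp_in Q F -> supp_in Q (c%:MP * F).
Proof. by rewrite mul_mpolyC; apply: supp_inZ. Qed.

Lemma supp_inn Q n F : supp_in Q F -> supp_in Q (n%:R * F).
Proof. by rewrite -mpolyC_nat; apply: supp_inC. Qed.

Lemma supp_inXM Q i F : supp_in (fun m => Q (m + U_(i))%MM) F -> supp_in Q ('X_i * F).
Proof.
move=> QF m; rewrite mcoeffXM; have [_|mi0] := eqVneq (m i) 0%N; first by rewrite eqxx.
by move=> /QF; rewrite submK ?lep1mP.
Qed.

Lemma supp_in_deriv Q i F : supp_in (fun m => forall m', m = (m' + U_(i))%MM -> Q m') F ->
  supp_in Q F^`M(i).
Proof.
move=> QF m; rewrite mcoeff_deriv => ne0; apply: (QF (m + U_(i))%MM) => //.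
by apply: contraNneq ne0 => ->; rewrite mul0rn.
Qed.

Lemma supp_inS Q Q' F : (forall m, Q m -> Q' m) -> supp_in Q F -> supp_in Q' F.
Proof. by move=> QQ' QF m /QF/QQ'. Qed.

Definition whomog k := supp_in (fun m => mnmwgt m = k).

Lemma whomog_deriv k (i : 'I_M) F : whomog k F -> whomog (k - i.+1) F^`M(i).
Proof.
move=> hF; apply: supp_in_deriv; apply: supp_inS hF => m <- m' ->.
by rewrite mnmwgtD mnmwgt1 addnK.
Qed.

Lemma whomogXM k (i : 'I_M) F : whomog k F -> whomog (k + i.+1) ('X_i * F).
Proof.
by move=> hF; apply: supp_inXM; apply: supp_inS hF => m <-; rewrite mnmwgtD mnmwgt1.
Qed.

Lemma whomog_deriv_eq0 k (i : 'I_M) F : whomog k F -> (k <= i)%N -> F^`M(i) = 0.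
Proof.
move=> hF le_ki; apply/mpolyP => m; rewrite mcoeff0 mcoeff_deriv.
have [->|/hF] := eqVneq (F@_(m + U_(i))) 0; first by rewrite mul0rn.
by rewrite mnmwgtD mnmwgt1; lia.
Qed.

(** A nonzero derivative by p_(i+1) and p_(j+1) needs weight at least i + j + 2, which exceeds M
    here. *)
Lemma whomog_quadratic_free k F : whomog k F -> (k <= M)%N -> quadratic_free F.
Proof.
move=> hF le_kM i j le_M; apply: (@whomog_deriv_eq0 (k - i.+1)); first exact: whomog_deriv.
by lia.
Qed.

Variable alpha : K.

Lemma whomog_D2 k F : whomog k F -> whomog k (D2 alpha F).
Proof.
move=> hF; apply: supp_inD.
  apply: supp_in_sum => i _; apply: supp_in_sum => j _; apply: supp_in_sum => l /eqP eq_l.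
  apply: supp_inD.
    apply: supp_inC; apply: supp_inXM; apply: supp_in_deriv; apply: supp_in_deriv.
    apply: supp_inS hF => m <- m' -> m'' ->; rewrite !mnmwgtD !mnmwgt1 eq_l; lia.
  apply: supp_inn; rewrite -mulrA; apply: supp_inXM; apply: supp_inXM; apply: supp_in_deriv.
  apply: supp_inS hF => m <- m' ->; rewrite !mnmwgtD !mnmwgt1 eq_l; lia.
apply: supp_inC; apply: supp_in_sum => i _; apply: supp_inn; apply: supp_inXM.
by apply: supp_in_deriv; apply: supp_inS hF => m <- m' ->.
Qed.

Definition D2quad F : {mpoly K[M]} :=
  \sum_(i < M) \sum_(j < M) \sum_(l < M | l == (i + j).+1 :> nat)
     ((alpha * (i.+1 * j.+1)%:R)%:MP * ('X_l * F^`M(i)^`M(j))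
      + l.+1%:R * ('X_i * 'X_j * F^`M(l))).

Definition D2lin F : {mpoly K[M]} := \sum_(i < M) (i.+1 * i)%:R * ('X_i * F^`M(i)).

Lemma D2E F : D2 alpha F = D2quad F + (alpha - 1)%:MP * D2lin F. Proof. by []. Qed.

Lemma D2D F G : D2 alpha (F + G) = D2 alpha F + D2 alpha G.
Proof.
have eq_quad : D2quad (F + G) = D2quad F + D2quad G.
  rewrite -big_split; apply: eq_bigr => i _ /=; rewrite -big_split; apply: eq_bigr => j _ /=.
  rewrite -big_split; apply: eq_bigr => l _ /=; rewrite !mderivD; ring.
have eq_lin : D2lin (F + G) = D2lin F + D2lin G.
  rewrite -big_split; apply: eq_bigr => i _ /=; rewrite !mderivD; ring.
rewrite !D2E eq_quad eq_lin; ring.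
Qed.

Lemma D2Z c F : D2 alpha (c *: F) = c *: D2 alpha F.
Proof.
have eq_quad : D2quad (c%:MP * F) = c%:MP * D2quad F.
  rewrite mulr_sumr; apply: eq_bigr => i _ /=; rewrite mulr_sumr; apply: eq_bigr => j _ /=.
  rewrite mulr_sumr; apply: eq_bigr => l _ /=; rewrite !mderiv_mulC; ring.
have eq_lin : D2lin (c%:MP * F) = c%:MP * D2lin F.
  rewrite mulr_sumr; apply: eq_bigr => i _ /=; rewrite !mderiv_mulC; ring.
rewrite -!mul_mpolyC !D2E eq_quad eq_lin; ring.
Qed.

Lemma D2_0 : D2 alpha (0 : {mpoly K[M]}) = 0.
Proof. by rewrite -(scale0r (0 : {mpoly K[M]})) D2Z !scale0r. Qed.

Lemma D2_sum (I : Type) (r : seq I) (P : pred I) (f : I -> {mpoly K[M]}) :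
  D2 alpha (\sum_(i <- r | P i) f i) = \sum_(i <- r | P i) D2 alpha (f i).
Proof. exact: (big_morph _ D2D D2_0). Qed.

End Support.

Section Form.
Variables (K : fieldType) (alpha : K) (M : nat).
Implicit Types (F G : {mpoly K[M]}).

(* The squared norm of the monomial [m] in the power sums. *)
Definition pweight (m : 'X_{1..M}) : K :=
  \prod_(i < M) ((alpha * i.+1%:R) ^+ m i * (m i)`!%:R).

Lemma pweightU m i : pweight (m + U_(i)) = pweight m * (alpha * i.+1%:R * (m i).+1%:R).
Proof.
rewrite /pweight (bigD1 i) //= [in RHS](bigD1 i) //= mnmDE mnm1E eqxx addn1 factS exprS.
rewrite natrM; set A := \prod_(_ < _ | _) _; set B := \prod_(_ < _ | _) _.
suff -> : A = B by ring.
by apply: eq_bigr => j /negbTE nji; rewrite mnmDE mnm1E eq_sym nji addn0.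
Qed.

Definition pairing (phi : 'X_{1..M} -> K) G := \sum_(m <- msupp G) G@_m * phi m.

Lemma pairingE phi G k : (msize G <= k)%N ->
  pairing phi G = \sum_(m : 'X_{1..M < k}) G@_m * phi m.
Proof.
move=> le_k; pose I := 'X_{1..M < k} : subFinType _.
rewrite /pairing (big_mksub I) ?msupp_uniq //=; first last.
  by move=> x /msize_mdeg_lt /leq_trans; apply.
by rewrite big_rmcond //= => j /memN_msupp_eq0 ->; rewrite mul0r.
Qed.

Lemma pairingD phi F G : pairing phi (F + G) = pairing phi F + pairing phi G.
Proof.
have le_FG := msizeD_le F G; set k := maxn (msize F) (msize G) in le_FG.
rewrite !(@pairingE _ _ k) ?leq_maxl ?leq_maxr // -big_split.
by apply: eq_bigr => m _; rewrite mcoeffD mulrDl.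
Qed.

Lemma pairingZ phi c G : pairing phi (c *: G) = c * pairing phi G.
Proof.
rewrite !(@pairingE _ _ (msize G)) ?msizeZ_le // mulr_sumr.
by apply: eq_bigr => m _; rewrite mcoeffZ mulrA.
Qed.

Lemma pairing0 phi : pairing phi 0 = 0.
Proof. by rewrite -(scale0r (0 : {mpoly K[M]})) pairingZ mul0r. Qed.

Lemma pairing_sum phi (I : Type) (r : seq I) (P : pred I) (f : I -> {mpoly K[M]}) :
  pairing phi (\sum_(i <- r | P i) f i) = \sum_(i <- r | P i) pairing phi (f i).
Proof. exact: (big_morph _ (pairingD phi) (pairing0 phi)). Qed.

Lemma pairingX phi m : pairing phi 'X_[m] = phi m.
Proof. by rewrite /pairing msuppX big_seq1 mcoeffX eqxx mul1r. Qed.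

(* Under [form], multiplication by [p_k] is adjoint to [k alpha d/dp_k]. *)
Definition form F G := pairing (fun m => F@_m * pweight m) G.

Lemma formC F G : form F G = form G F.
Proof.
set k := maxn (msize F) (msize G).
rewrite /form !(@pairingE _ _ k) ?leq_maxl ?leq_maxr //.
by apply: eq_bigr => m _; ring.
Qed.

Lemma formDr F G H : form F (G + H) = form F G + form F H.
Proof. exact: pairingD. Qed.
Lemma formZr c F G : form F (c *: G) = c * form F G. Proof. exact: pairingZ. Qed.
Lemma formDl F G H : form (F + G) H = form F H + form G H.
Proof. by rewrite formC formDr !(formC H). Qed.
Lemma formZl c F G : form (c *: F) G = c * form F G.
Proof. by rewrite formC formZr formC. Qed.
Lemma form_sumr (I : Type) (r : seq I) (P : pred I) F (f : I -> {mpoly K[M]}) :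
  form F (\sum_(i <- r | P i) f i) = \sum_(i <- r | P i) form F (f i).
Proof. exact: pairing_sum. Qed.
Lemma form_suml (I : Type) (r : seq I) (P : pred I) F (f : I -> {mpoly K[M]}) :
  form (\sum_(i <- r | P i) f i) F = \sum_(i <- r | P i) form (f i) F.
Proof. by rewrite formC form_sumr; apply: eq_bigr => i _; rewrite formC. Qed.
Lemma formCl c F G : form (c%:MP * F) G = c * form F G.
Proof. by rewrite mul_mpolyC formZl. Qed.
Lemma formnl n F G : form (n%:R * F) G = n%:R * form F G.
Proof. by rewrite -mpolyC_nat formCl. Qed.

Lemma formXr F m : form F 'X_[m] = F@_m * pweight m. Proof. exact: pairingX. Qed.

Lemma form_XMl i F G : form ('X_i * F) G = alpha * i.+1%:R * form F G^`M(i).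
Proof.
rewrite [G]mpolyE raddf_sum !form_sumr mulr_sumr; apply: eq_bigr => m _.
rewrite /= mderivZ !formZr mderivX formZr !formXr mcoeffXM.
case: eqP => [->|/eqP mi0]; first by rewrite mul0r mul0r mulr0 !mulr0.
have -> : pweight m = pweight (m - U_(i))%MM * (alpha * i.+1%:R * (m i)%:R).
  have -> : m i = ((m - U_(i))%MM i).+1 by rewrite mnmBE mnm1E eqxx /=; lia.
  by rewrite -pweightU submK ?lep1mP.
ring.
Qed.

(** Moving each power sum across the form gives the same constant for the joining terms p_l d_i d_j
    and the cutting terms p_i p_j d_l: the two are adjoint to each other, and the resulting
    expression is visibly symmetric in [F] and [G]. *)
Lemma form_D2 F G : form (D2 alpha F) G =
  \sum_(i < M) \sum_(j < M) \sum_(l < M | l == (i + j).+1 :> nat)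
    (alpha ^+ 2 * (i.+1 * j.+1 * l.+1)%:R *
      (form F^`M(i)^`M(j) G^`M(l) + form G^`M(i)^`M(j) F^`M(l)))
  + (alpha - 1) * \sum_(i < M) alpha * (i.+1 * i.+1 * i)%:R * form F^`M(i) G^`M(i).
Proof.
rewrite /D2 formDl formCl !form_suml; congr (_ + _ * _); apply: eq_bigr => i _.
  rewrite form_suml; apply: eq_bigr => j _; rewrite form_suml; apply: eq_bigr => l _.
  rewrite formDl formCl formnl form_XMl -(mulrA 'X_i) !form_XMl mderiv_comm (formC F^`M(l)).
  by rewrite (mderiv_comm _ _ G) !natrM; ring.
by rewrite formnl form_XMl !natrM; ring.
Qed.

Lemma form_D2_sym F G : form (D2 alpha F) G = form F (D2 alpha G).
Proof.
rewrite [RHS]formC !form_D2; congr (_ + _ * _); apply: eq_bigr => i _.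
  by apply: eq_bigr => j _; apply: eq_bigr => l _; rewrite [X in _ * X]addrC.
by rewrite formC.
Qed.

End Form.

Section PartitionMonomials.
Variable M : nat.

(** The exponent of p_s in the symbols p_1, ..., p_M, to be distinguished from [pexp], the exponent
    of a monomial in the variables x_i. *)
Definition pmn (s : seq nat) : 'X_{1..M} := [multinom count_mem i.+1 s | i < M].

Definition part_mn (m : 'X_{1..M}) : seq nat :=
  sort geq (flatten [seq nseq (m i) i.+1 | i <- enum 'I_M]).

Lemma part_mn_part m : is_part (part_mn m).
Proof.
rewrite /is_part sort_sorted /=; last by move=> x y /=; apply: leq_total.
rewrite all_sort; apply/allP => x /flattenP[t /mapP[i _ ->]].
by rewrite mem_nseq => /andP[_ /eqP ->].
Qed.

Lemma sumn_part_mn m : sumn (part_mn m) = mnmwgt m.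
Proof.
rewrite /part_mn (perm_sumn (s2 := flatten [seq nseq (m i) i.+1 | i <- enum 'I_M])).
  rewrite sumn_flatten -map_comp sumnE big_map /mnmwgt big_enum /=.
  by apply: eq_bigr => i _; rewrite sumn_nseq mulnC.
by rewrite perm_sort.
Qed.

Lemma part_mnK m : pmn (part_mn m) = m.
Proof.
apply/mnmP => i; rewrite mnmE /part_mn count_sort count_flatten -map_comp sumnE big_map.
rewrite big_enum (bigD1 i) //= count_nseq /= eqxx mul1n big1 ?addn0 // => j nji.
by rewrite count_nseq /= eqSS val_eqE (negbTE nji).
Qed.

Lemma pmn_inj s t : is_part s -> is_part t -> (sumn s <= M)%N -> (sumn t <= M)%N ->
  pmn s = pmn t -> s = t.
Proof.
move=> /andP[s_sorted s_pos] /andP[t_sorted t_pos] le_s le_t eq_st.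
apply: (sorted_eq (leT := geq)) => //.
- by move=> x y z /= ? ?; lia.
- by move=> x y /=; lia.
have mem_le u x : all (leq 1) u -> (sumn u <= M)%N -> x \in u -> (0 < x <= M)%N.
  by move=> /allP u_pos le_u xu; rewrite u_pos //= (leq_trans (mem_le_sumn xu)).
apply/allP => x; rewrite mem_cat => x_st /=.
have /andP[x_gt0 x_le] : (0 < x <= M)%N by case/orP: x_st; apply: mem_le.
case: x x_gt0 x_le {x_st} => // x _ lt_x.
by move/mnmP/(_ (Ordinal lt_x)): eq_st; rewrite !mnmE /= => ->.
Qed.

Lemma mnmwgt_pmn s : is_part s -> (sumn s <= M)%N -> mnmwgt (pmn s) = sumn s.
Proof.
move=> /andP[_]; rewrite /mnmwgt; elim: s => [_ _|x s IHs /= /andP[x_gt0 s_pos] le_s].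
  by rewrite big1 // => i _; rewrite mnmE.
rewrite -(IHs s_pos); last exact: leq_trans (leq_addl _ _) le_s.
have lt_x : (x.-1 < M)%N by lia.
rewrite (bigD1 (Ordinal lt_x)) //= [X in _ = (_ + X)%N](bigD1 (Ordinal lt_x)) //= !mnmE /=.
rewrite prednK // eqxx addnA mulnDl mul1n; congr (_ + _)%N.
apply: eq_bigr => i ne_i; rewrite !mnmE /=; have [x_eq|_] := eqVneq x i.+1; last by rewrite add0n.
by case/eqP: ne_i; apply: val_inj; rewrite /= x_eq.
Qed.

End PartitionMonomials.

Lemma pweight_neq0 (K : fieldType) (alpha : K) (alphaP : jack_parameter alpha) M (m : 'X_{1..M}) :
  pweight alpha m != 0.
Proof.
apply/prodf_neq0 => i _; rewrite mulf_neq0 ?expf_neq0 ?(natr_neq0 alphaP) ?fact_gt0 //.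
by rewrite mulf_neq0 ?(jack_parameter_neq0 alphaP) ?(natr_neq0 alphaP).
Qed.

Lemma whomog0E (K : fieldType) M (F : {mpoly K[M]}) : whomog 0 F -> F = (F@_0)%:MP.
Proof.
move=> hF; apply/mpolyP => m; rewrite mcoeffC; have [->|ne_m] := eqVneq m 0%MM;
  first by rewrite mulr1.
rewrite mulr0; apply/eqP; apply: contraNT ne_m => /hF wt_m.
by rewrite -mdeg_eq0 -leqn0 -wt_m leq_mdeg_mnmwgt.
Qed.

Lemma intpart_part k (be : intpart k) : is_part be.
Proof. by case: be => s /= /and3P[? ? _]; apply/andP. Qed.

Lemma intpart_sumn k (be : intpart k) : sumn be = k.
Proof. by case: be => s /= /and3P[_ _ /eqP]. Qed.

Lemma intpart_inj k (be ga : intpart k) : (be : seq nat) = ga -> be = ga.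
Proof. exact: val_inj. Qed.

Lemma is_partition_part s : is_part s -> is_partition (sumn s) s.
Proof. by case/andP=> ? ?; apply/and3P. Qed.

Lemma intpart_of k s : is_part s -> sumn s = k -> exists be : intpart k, (be : seq nat) = s.
Proof. by move=> s_part <-; exists (IntPart (is_partition_part s_part)). Qed.

Section MonomialExpansion.
Variables (K : fieldType) (M : nat).

Lemma whomog_eq (F G : {mpoly K[M]}) k : (k <= M)%N -> whomog k F -> whomog k G ->
  (forall be : intpart k, F@_(pmn M be) = G@_(pmn M be)) -> F = G.
Proof.
move=> le_kM hF hG eq_FG; apply/mpolyP => m.
have [wt_m|ne_wt] := eqVneq (mnmwgt m) k.
  have [be be_eq] := intpart_of (part_mn_part m) (etrans (sumn_part_mn m) wt_m).
  by have := eq_FG be; rewrite be_eq part_mnK.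
have [->|/hF wt_m] := eqVneq F@_m 0; last by rewrite wt_m eqxx in ne_wt.
by have [->|/hG wt_m] := eqVneq G@_m 0; last by rewrite wt_m eqxx in ne_wt.
Qed.
End MonomialExpansion.

Lemma dom_trans N (s t : seq nat) (m : 'X_{1..N}) : dom s (pexp N t) -> dom t m -> dom s m.
Proof.
move=> dom_t dom_m A; apply: leq_trans (dom_m A) _.
have le_AN : (#|A| <= N)%N by rewrite -[X in (_ <= X)%N]card_ord max_card.
have := dom_t [set i : 'I_N | (i < #|A|)%N]; rewrite card_set_ord_lt // sum_ord_lt //.
by rewrite !sumn_take => /(leq_trans _); apply; apply: leq_sum => i _;
  rewrite nth_pexp // (leq_trans (ltn_ord i)).
Qed.

Lemma pexp_inj N s t : is_part s -> is_part t -> (size s <= N)%N -> (size t <= N)%N ->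
  pexp N s = pexp N t -> s = t.
Proof.
move=> s_part t_part le_s le_t eq_exp; apply: part_eq => // i.
have [lt_i|le_i] := ltnP i N; first by rewrite -(nth_pexp s lt_i) -(nth_pexp t lt_i) eq_exp.
by rewrite !nth_default // ?(leq_trans _ le_i).
Qed.

Lemma dec_pexp N s : is_part s -> antitone (pexp N s).
Proof. by move=> s_part i j le_ij; rewrite !pexpE part_nth. Qed.

Lemma sqsumE N (m : 'X_{1..N}) : sqsum m = (\sum_(i < N) nth 0 m i * nth 0 m i)%N.
Proof. by apply: eq_bigr => i _; rewrite !(mnm_nth 0). Qed.

Lemma dom_perm N s (m : 'X_{1..N}) (sg : {perm 'I_N}) :
  dom s m -> dom s [multinom m (sg i) | i < N].
Proof.
move=> dom_m A; have := dom_m (sg @: A); rewrite card_imset; last exact: perm_inj.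
rewrite big_imset /=; last by move=> ? ? _ _; apply: perm_inj.
by congr (_ <= _)%N; apply: eq_bigr => i _; rewrite mnmE.
Qed.

Lemma dom_sqsum N s (m : 'X_{1..N}) : is_part s -> dom s m ->
  (sqsum m <= sqsum (pexp N s))%N.
Proof.
move=> s_part dom_m; have [sg dec_m] := sort_mnm m.
have -> : sqsum m = sqsum [multinom m (sg i) | i < N].
  by rewrite /sqsum (reindex_inj (@perm_inj _ sg)); apply: eq_bigr => i _; rewrite mnmE.
rewrite !sqsumE; apply: leq_trans (dom_sq s_part (dom_perm sg dom_m) dec_m) _.
by apply: leq_sum => i _; rewrite nth_pexp.
Qed.

Lemma ev0 (K : fieldType) (M N : nat) : ev N (0 : {mpoly K[M]}) = 0.
Proof. by rewrite -mpolyC0 evC mpolyC0. Qed.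

(** * Combinatorics of partitions *)

Section ColumnRemoval.
Local Open Scope nat_scope.
Implicit Types s : seq nat.

Definition colrem s := [seq x.-1 | x <- s & 1 < x].

Lemma nth_colrem s i : is_part s -> nth 0 (colrem s) i = (nth 0 s i).-1.
Proof.
case/andP => s_sorted _; rewrite /colrem; elim: s s_sorted i => [|x s IHs] /=;
  first by move=> _ i; rewrite !nth_nil.
move=> s_path; have s_sorted := path_sorted s_path; case: ltnP => [x_gt1|x_le1] i.
  by case: i => //= i; apply: IHs.
have /allP x_ge : all (geq x) s by apply: order_path_min s_path => a b c /= ? ?; lia.
rewrite (eq_in_filter (a2 := pred0)) => [|y /x_ge /=]; last by lia.
rewrite filter_pred0 nth_nil; case: i => [|i] /=; first by lia.
have [lt_i|le_i] := ltnP i (size s); last by rewrite nth_default.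
by have := x_ge _ (mem_nth 0 lt_i); rewrite /=; lia.
Qed.

Lemma size_colrem s : size (colrem s) <= size s.
Proof. by rewrite size_map size_filter count_size. Qed.

Lemma colrem_part s : is_part s -> is_part (colrem s).
Proof.
move=> s_part; rewrite /is_part; apply/andP; split; last first.
  by apply/allP => x /mapP[y]; rewrite mem_filter => /andP[y_gt1 _] ->; lia.
case/andP: s_part => s_sorted _; rewrite sorted_map;
  apply: sub_sorted (sorted_filter _ _ s_sorted).
  by move=> x y /=; lia.
by move=> x y z /= ? ?; lia.
Qed.

Lemma sumn_colrem s : is_part s -> sumn (colrem s) + size s = sumn s.
Proof.
move=> s_part; rewrite (sumn_nth (size_colrem s)) (sumn_nth (leqnn _)).
have szE : size s = \sum_(i < size s) 1 by rewrite sum1_card card_ord.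
rewrite [X in _ + X = _]szE -big_split; apply: eq_bigr => i _ /=.
by rewrite nth_colrem // addn1 prednK // part_nth_gt0.
Qed.

Definition addcol N s := mkseq (fun i => (nth 0 s i).+1) N.

Lemma size_addcol N s : size (addcol N s) = N. Proof. exact: size_mkseq. Qed.

Lemma nth_addcol N s i : nth 0 (addcol N s) i = if i < N then (nth 0 s i).+1 else 0.
Proof.
by case: ltnP => [lt_i|le_i]; [rewrite nth_mkseq | rewrite nth_default ?size_mkseq].
Qed.

Lemma addcol_part N s : is_part s -> is_part (addcol N s).
Proof.
move=> s_part; apply/andP; split; last by apply/allP => x /mapP[i _ ->].
rewrite /addcol /mkseq sorted_map; apply: (@sub_sorted _ leq); last by exact: iota_sorted.
by move=> i j /= le_ij; rewrite ltnS part_nth.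
Qed.

Lemma addcolK N s : is_part s -> size s <= N -> colrem (addcol N s) = s.
Proof.
move=> s_part le_sN; apply: part_eq => //; first exact/colrem_part/addcol_part.
move=> i; rewrite nth_colrem ?addcol_part // nth_addcol; case: ltnP => //= le_i.
by rewrite nth_default // (leq_trans le_sN).
Qed.

Lemma colremK s : is_part s -> addcol (size s) (colrem s) = s.
Proof.
move=> s_part; apply: part_eq => //; first exact/addcol_part/colrem_part.
move=> i; rewrite nth_addcol nth_colrem //; case: ltnP => [lt_i|le_i].
  by rewrite prednK // part_nth_gt0.
by rewrite nth_default.
Qed.

End ColumnRemoval.

Lemma mcoeff_prodXM (K : fieldType) N (p : {mpoly K[N]}) (m : 'X_{1..N}) :
  ((\prod_(i < N) 'X_i) * p)@_m =
  if [forall i, (0 < m i)%N] then p@_[multinom (m i).-1 | i < N] else 0.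
Proof.
pose u : 'X_{1..N} := [multinom 1%N | i < N].
have -> : \prod_(i < N) 'X_i = 'X_[u] :> {mpoly K[N]}.
  by rewrite mpolyXE_id; apply: eq_bigr => i _; rewrite mnmE expr1.
case: forallP => [m_gt0|m_ngt0].
  rewrite mulrC -(mcoeffMX p u); congr (_@__); apply/mnmP => i.
  by rewrite mnmDE !mnmE add1n prednK.
apply: memN_msupp_eq0; rewrite mulrC; apply/negP.
rewrite (perm_mem (msuppMX _ _)) => /mapP[m' _ m_eq]; apply: m_ngt0 => i.
by rewrite m_eq mnmDE mnmE.
Qed.

Lemma eigen_eqB (K : fieldType) (alpha : K) N e (c c' : 'X_{1..N} -> K) m :
  eigen_eq alpha e c m -> eigen_eq alpha e c' m ->
  eigen_eq alpha e (fun m => c m - c' m) m.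
Proof.
rewrite /eigen_eq => ec ec'; rewrite mulrBr ec ec'.
have -> : \sum_(i < N) \sum_(j < N | (i < j)%N) transfer_sum (fun m => c m - c' m) m i j =
   \sum_(i < N) \sum_(j < N | (i < j)%N) transfer_sum c m i j
   - \sum_(i < N) \sum_(j < N | (i < j)%N) transfer_sum c' m i j.
  rewrite -sumrB; apply: eq_bigr => i _; rewrite -sumrB; apply: eq_bigr => j _.
  by rewrite /transfer_sum -sumrB; apply: eq_bigr => k _; ring.
ring.
Qed.

(** * Setting the last variable to zero *)

Section KillLastVariable.
Variables (K : fieldType) (N : nat).

Definition kill (g : {mpoly K[N.+1]}) : {mpoly K[N]} :=
  g \mPo [tuple (if unlift ord_max i is Some j then 'X_j else 0) | i < N.+1].

Lemma killD f g : kill (f + g) = kill f + kill g. Proof. exact: comp_mpolyD. Qed.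
Lemma killM f g : kill (f * g) = kill f * kill g. Proof. exact: rmorphM. Qed.
Lemma killC c : kill c%:MP = c%:MP. Proof. exact: comp_mpolyC. Qed.
Lemma kill0 : kill 0 = 0. Proof. exact: comp_mpoly0. Qed.
Lemma kill1 : kill 1 = 1. Proof. exact: comp_mpoly1. Qed.
Lemma killXn f n : kill (f ^+ n) = kill f ^+ n. Proof. exact: rmorphXn. Qed.

Lemma killX_tuple (i : 'I_N.+1) :
  kill 'X_i = if unlift ord_max i is Some j then 'X_j else 0.
Proof. by rewrite /kill comp_mpolyXU (nth_map i) ?nth_ord_enum // size_enum_ord. Qed.

Lemma killX_max : kill 'X_ord_max = 0.
Proof. by rewrite killX_tuple unlift_none. Qed.

Lemma killX_widen (i : 'I_N) : kill 'X_(widen_ord (leqnSn N) i) = 'X_i.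
Proof.
have -> : widen_ord (leqnSn N) i = lift ord_max i by apply: val_inj;
  rewrite /= /bump leqNgt ltn_ord.
by rewrite killX_tuple liftK.
Qed.

Lemma kill_sum (I : Type) (r : seq I) (P : pred I) (f : I -> {mpoly K[N.+1]}) :
  kill (\sum_(i <- r | P i) f i) = \sum_(i <- r | P i) kill (f i).
Proof. exact: raddf_sum. Qed.

Lemma kill_ev M (F : {mpoly K[M]}) : kill (ev N.+1 F) = ev N F.
Proof.
elim/mpoly_alg_ind: F => [c|i|F G IHF IHG|F G IHF IHG].
- by rewrite !evC killC.
- rewrite !evXU /psum kill_sum big_ord_recr /= killXn killX_max expr0n addr0.
  by apply: eq_bigr => k _; rewrite killXn killX_widen.
- by rewrite !evD killD IHF IHG.
- by rewrite !evM killM IHF IHG.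
Qed.

(** In the chain rule p_(k+1) comes with the k-th power of the last variable, so only k = 0 survives
    when that variable is set to zero. *)
Lemma ev_deriv1 M (o : 'I_M) (F : {mpoly K[M]}) : o = 0%N :> nat ->
  ev N F^`M(o) = kill (ev N.+1 F)^`M(ord_max).
Proof.
move=> o0; rewrite mderiv_ev kill_sum (bigD1 o) //= big1 ?addr0 => [|k ne_k].
  by rewrite o0 expr0 mulr1 mul1r kill_ev.
have k_gt0 : (0 < k)%N by rewrite lt0n -o0; apply: contraNneq ne_k => /val_inj ->.
by rewrite killM killXn killX_max expr0n gtn_eqF ?mulr0.
Qed.

Lemma kill_deriv_prodXM (g : {mpoly K[N.+1]}) :
  kill ((\prod_(i < N.+1) 'X_i) * g)^`M(ord_max) = (\prod_(i < N) 'X_i) * kill g.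
Proof.
rewrite big_ord_recr /=; set Q := \prod_(i < N) _.
have dQ : Q^`M(ord_max) = 0.
  rewrite /Q; elim/big_rec: _ => [|i R _ dR]; first by rewrite -mpolyC1 mderivC.
  rewrite mderivM dR mulr0 addr0 mderivXU.
  have -> : (widen_ord (leqnSn N) i == ord_max) = false.
    by rewrite -val_eqE /= ltn_eqF.
  by rewrite mul0r.
have dX : ('X_ord_max : {mpoly K[N.+1]})^`M(ord_max) = 1 by rewrite mderivXU eqxx.
have -> : \prod_(i < N) 'X_i = kill Q :> {mpoly K[N]}.
  rewrite /Q; elim/big_rec2: _ => [|i y1 y2 _ ->]; first by rewrite -!mpolyC1 killC.
  by rewrite killM killX_widen.
by rewrite !mderivM dQ dX !(killD, killM) killX_max kill0 kill1; ring.
Qed.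

End KillLastVariable.

(** * Contents, and adding a box *)

Section Contents.
Variables (K : fieldType) (alpha : K).

(* The product of [X + content] over the boxes of [s]. *)
Definition cpoly (s : seq nat) (X : K) : K :=
  \prod_(i < size s) \prod_(j < nth 0%N s i) (X + alpha * j%:R - i%:R).

Lemma cpoly_widen N s X : (size s <= N)%N ->
  cpoly s X = \prod_(i < N) \prod_(j < nth 0%N s i) (X + alpha * j%:R - i%:R).
Proof.
move=> le_sN; rewrite /cpoly.
rewrite (big_ord_widen N (fun i => \prod_(j < nth 0%N s i) (X + alpha * j%:R - i%:R))) //.
rewrite big_mkcond; apply: eq_bigr => i _; case: ltnP => // le_i.
by rewrite nth_default // big_ord0.
Qed.

(** Each surviving box moves one column left and loses alpha from its content, which X + alpha
    restores; the removed column has contents 0, -1, -2, ... *)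
Lemma cpoly_colrem s X : is_part s ->
  cpoly s X = cpoly (colrem s) (X + alpha) * \prod_(i < size s) (X - i%:R).
Proof.
move=> s_part; rewrite (cpoly_widen _ (size_colrem s)) -big_split; apply: eq_bigr => i _ /=.
rewrite nth_colrem //; have := part_nth_gt0 i s_part; rewrite ltn_ord.
case: (nth 0%N s i) => // a _; rewrite big_ord_recl mulr0 addr0 mulrC; congr (_ * _).
by apply: eq_bigr => j _; rewrite /= /bump add1n -natr1; ring.
Qed.

Lemma diag_shift N (m m' : 'X_{1..N}) : (forall i, m i = (m' i).+1) ->
  diag alpha m - diag alpha m' = alpha * (mdeg m').*2%:R - (\sum_(i < N) i).*2%:R.
Proof.
move=> mE; rewrite /diag mdegE -!mul2n !natrM !natr_sum !mulr_sumr -!sumrB.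
by apply: eq_bigr => i _; rewrite mE -!muln2 !natrM -!natr1; ring.
Qed.

Lemma eigval_colrem s : is_part s -> eigval alpha s =
  eigval alpha (colrem s) + alpha * (sumn (colrem s)).*2%:R - (\sum_(i < size s) i).*2%:R.
Proof.
move=> s_part; rewrite -(diag_pexp alpha (leqnn (size s))) -(diag_pexp alpha (size_colrem s)).
have /diag_shift : forall i, pexp (size s) s i = (pexp (size s) (colrem s) i).+1.
  by move=> i; rewrite !pexpE nth_colrem // prednK // part_nth_gt0.
by rewrite mdeg_pexp ?size_colrem // => eq_diag; rewrite -addrA -eq_diag; ring.
Qed.

Lemma cpoly_addcol N s X : is_part s -> (size s <= N)%N ->
  cpoly (addcol N s) X = cpoly s (X + alpha) * \prod_(i < N) (X - i%:R).
Proof.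
by move=> s_part le_sN; rewrite cpoly_colrem ?addcol_part // addcolK // size_addcol.
Qed.

Lemma eigval_addcol N s : is_part s -> (size s <= N)%N -> eigval alpha (addcol N s) =
  eigval alpha s + alpha * (sumn s).*2%:R - (\sum_(i < N) i).*2%:R.
Proof.
by move=> s_part le_sN; rewrite eigval_colrem ?addcol_part // addcolK // size_addcol.
Qed.

(* [b] is obtained from [l] by adding a box of content [(eigval b - eigval l) / 2]. *)
Definition add_box (l b : seq nat) : Prop :=
  forall X, 2%:R * cpoly b X = (2%:R * X + eigval alpha b - eigval alpha l) * cpoly l X.

(** The same column is put in front of both partitions: the new box moves right and its content
    grows by alpha, while the eigenvalue difference grows by 2 alpha because [b] has one box
    more. *)
Lemma add_box_addcol N l b : is_part l -> is_part b -> (size l <= N)%N -> (size b <= N)%N ->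
  sumn b = (sumn l).+1 -> add_box l b -> add_box (addcol N l) (addcol N b).
Proof.
move=> l_part b_part le_l le_b sum_b cov X.
rewrite !cpoly_addcol // !eigval_addcol // mulrA cov sum_b doubleS -!natr1; ring.
Qed.

(** The bound on [colrem b] says that the last row of [b] is a single box, of content - N; dropping
    it leaves [addcol N (colrem b)]. *)
Lemma add_box_new_row N b : is_part b -> size b = N.+1 -> (size (colrem b) <= N)%N ->
  add_box (addcol N (colrem b)) b.
Proof.
move=> b_part size_b le_N X; have cb_part := colrem_part b_part.
rewrite (cpoly_colrem X b_part) (eigval_colrem b_part) size_b big_ord_recr /=.
rewrite cpoly_addcol // eigval_addcol //.
by rewrite [(\sum_(i < N.+1) i)%N]big_ord_recr /= doubleD natrD -[N.*2]muln2 natrM; ring.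
Qed.

End Contents.

(** * Hook products under column removal *)

Section HookProducts.
Variable K : fieldType.
Implicit Types (s : seq nat) (f : nat -> nat -> K).

Lemma count_drop_nth (a : pred nat) s p :
  count a (drop p s) = (\sum_(k < size s) ((p <= k) && a (nth 0 s k)))%N.
Proof.
elim: s p => [|x s IHs] [|p] //=; rewrite ?big_ord0 // big_ord_recl /=.
  by rewrite -(drop0 s) IHs drop0.
by rewrite IHs.
Qed.

Lemma leg_nth N s i j : (size s <= N)%N ->
  leg s i j = (\sum_(k < N) ((i < k) && (j < nth 0 s k)))%N.
Proof.
move=> le_sN; rewrite /leg count_drop_nth (big_ord_widen N (fun k => ((i < k) && (j < nth 0 s
  k))%N : nat)) //.
rewrite big_mkcond; apply: eq_bigr => k _; case: ltnP => // le_k.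
by rewrite [nth _ _ k]nth_default // andbF.
Qed.

Definition hook_prod f s : K :=
  \prod_(i < size s) \prod_(j < nth 0%N s i) f (arm s i j) (leg s i j).

Lemma hook_prod_widen N f s : (size s <= N)%N ->
  hook_prod f s = \prod_(i < N) \prod_(j < nth 0%N s i) f (arm s i j) (leg s i j).
Proof.
move=> le_sN; rewrite /hook_prod.
rewrite (big_ord_widen N (fun i => \prod_(j < nth 0%N s i) f (arm s i j) (leg s i j))) //.
rewrite big_mkcond; apply: eq_bigr => i _; case: ltnP => // le_i.
by rewrite nth_default // big_ord0.
Qed.

(** Boxes outside the first column keep arm and leg; the box (i, 0) has arm s_i - 1, and its leg
    counts all rows below. *)
Lemma hook_prod_colrem f s : is_part s -> hook_prod f s =
  hook_prod f (colrem s) * \prod_(i < size s) f (nth 0%N s i).-1 (size s - i.+1)%N.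
Proof.
move=> s_part; rewrite (hook_prod_widen _ (size_colrem s)) -big_split; apply: eq_bigr => i _ /=.
have leg0 : leg s i 0 = (size s - i.+1)%N.
  rewrite /leg -[RHS]size_drop; apply/eqP; rewrite -all_count; apply/allP => x /mem_drop.
  by case/andP: s_part => _ /allP; apply.
have legS j : leg s i j.+1 = leg (colrem s) i j.
  rewrite (leg_nth _ _ (leqnn (size s))) (leg_nth _ _ (size_colrem s)); apply: eq_bigr => k _.
  by rewrite nth_colrem //; case: (nth 0%N s k).
rewrite {1}/arm nth_colrem //; have := part_nth_gt0 i s_part; rewrite ltn_ord.
have armS j : arm (colrem s) i j = ((nth 0%N s i).-1 - j.+1)%N by rewrite /arm nth_colrem.
rewrite /arm in armS *; case: (nth 0%N s i) armS => // a armS _.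
rewrite big_ord_recl mulrC /= leg0 subSS subn0; congr (_ * _).
by apply: eq_bigr => j _; rewrite /bump /= add1n legS subSS armS.
Qed.

Lemma hookE alpha s : hook alpha s = hook_prod (fun a l => alpha * a%:R + l%:R + 1) s.
Proof. by []. Qed.

Lemma hook'E alpha s : hook' alpha s = hook_prod (fun a l => alpha * (1 + a%:R) + l%:R) s.
Proof. by []. Qed.

End HookProducts.

Section Hooks.
Variables (K : fieldType) (alpha : K).
Hypothesis alphaP : jack_parameter alpha.

Lemma hook_neq0 s : hook alpha s != 0.
Proof.
apply/prodf_neq0 => i _; apply/prodf_neq0 => j _.
have := @alphaP (arm s i j) (leg s i j).+1; rewrite addnS => /(_ isT).
by rewrite -natr1 mulrC addrA.
Qed.

Lemma hook'_neq0 s : hook' alpha s != 0.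
Proof.
apply/prodf_neq0 => i _; apply/prodf_neq0 => j _.
have := @alphaP (arm s i j).+1 (leg s i j); rewrite addSn => /(_ isT).
by rewrite -natr1 mulrC [_ + 1]addrC.
Qed.

End Hooks.

(** * The commutator of d/dp_1 with the operator *)

Section LoweringOperator.
Variables (K : fieldType) (alpha : K) (M : nat).
Implicit Types F : {mpoly K[M]}.

Definition lower F : {mpoly K[M]} :=
  \sum_(j < M) \sum_(l < M | l == j.+1 :> nat) l.+1%:R * ('X_j * F^`M(l)).

Variable o : 'I_M.
Hypothesis o0 : o = 0%N :> nat.

(** An explicit p_1 occurs in [D2] only as one of the two factors of a cutting term, once on each
    side, whence 2 [lower]. The joined p_l has l >= 2, and the first order term in p_1 has
    coefficient 0. *)
Lemma mderiv_D2 F : (D2 alpha F)^`M(o) = D2 alpha F^`M(o) + 2%:R * lower F.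
Proof.
have lowerE1 : \sum_(i < M) \sum_(j < M) \sum_(l < M | l == (i + j).+1 :> nat)
    l.+1%:R * ((i == o)%:R * 'X_j * F^`M(l)) = lower F.
  rewrite (bigD1 o) //= [X in _ + X]big1 ?addr0 => [|i /negbTE ne_i]; last first.
    apply: big1 => j _; apply: big1 => l _; rewrite ne_i /=; ring.
  rewrite o0; apply: eq_bigr => j _; apply: eq_bigr => l _; rewrite eqxx /=; ring.
have lowerE2 : \sum_(i < M) \sum_(j < M) \sum_(l < M | l == (i + j).+1 :> nat)
    l.+1%:R * ('X_i * (j == o)%:R * F^`M(l)) = lower F.
  rewrite exchange_big (bigD1 o) //= [X in _ + X]big1 ?addr0 => [|j /negbTE ne_j]; last first.
    apply: big1 => i _; apply: big1 => l _; rewrite ne_j /=; ring.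
  apply: eq_bigr => j _; rewrite o0 addn0; apply: eq_bigr => l _; rewrite eqxx /=; ring.
have dquad : (D2quad alpha F)^`M(o) = D2quad alpha F^`M(o) + (lower F + lower F).
  rewrite -{1}lowerE1 -lowerE2 /D2quad raddf_sum -!big_split; apply: eq_bigr => i _.
  rewrite raddf_sum -!big_split; apply: eq_bigr => j _.
  rewrite raddf_sum -!big_split; apply: eq_bigr => l /eqP eq_l /=.
  rewrite !mderivD !mderiv_mulC -!mpolyC_nat !mderiv_mulC !mderivM !mderivXU.
  have -> : (l == o) = false by rewrite -val_eqE /= o0 eq_l.
  rewrite (mderiv_comm j o) (mderiv_comm i o F) (mderiv_comm l o) !mpolyC_nat /=; ring.
have dlin : (D2lin F)^`M(o) = D2lin F^`M(o).
  rewrite /D2lin raddf_sum; apply: eq_bigr => i _ /=.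
  rewrite -[(_ * _)%:R]mpolyC_nat mderiv_mulC mderivM mderivXU mpolyC_nat.
  have [i_eq|_] := eqVneq i o; last by rewrite (mderiv_comm i o) /=; ring.
  by rewrite i_eq o0 muln0; ring.
rewrite !D2E mderivD mderiv_mulC dquad dlin; ring.
Qed.

Lemma euler_hom k F : whomog k F -> \sum_(l < M) l.+1%:R * ('X_l * F^`M(l)) = k%:R * F.
Proof.
move=> hF; apply/mpolyP => m; rewrite raddf_sum /= -[k%:R]mpolyC_nat mcoeffCM.
transitivity (\sum_(l < M) (m l * l.+1)%:R * F@_m).
  by apply: eq_bigr => l _; rewrite -mpolyC_nat mcoeffCM mcoeff_euler mulrA natrM [_%:R *
    _%:R]mulrC.
rewrite -mulr_suml -natr_sum; have [->|/hF <-] := eqVneq F@_m 0; first by rewrite !mulr0.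
by [].
Qed.

Definition evalc (X : K) F : K := F.@[fun=> X].

Lemma evalc_sum X (I : Type) (r : seq I) (Q : pred I) (f : I -> {mpoly K[M]}) :
  evalc X (\sum_(i <- r | Q i) f i) = \sum_(i <- r | Q i) evalc X (f i).
Proof. exact: raddf_sum. Qed.

(** Once all power sums equal X, k p_(k-1) d/dp_k and k p_k d/dp_k have the same value. So [lower]
    is the Euler operator without its p_1 term, and X d/dp_1 supplies that term. *)
Lemma evalc_lower k X F : whomog k F -> X * evalc X F^`M(o) + evalc X (lower F) = k%:R * evalc X
  F.
Proof.
move=> hF; have <- : evalc X (\sum_(l < M) l.+1%:R * ('X_l * F^`M(l))) = k%:R * evalc X F.
  by rewrite (euler_hom hF) /evalc -mpolyC_nat mevalM mevalC.
have -> : evalc X (lower F) = \sum_(j < M) \sum_(l < M | l == j.+1 :> nat)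
    evalc X (l.+1%:R * ('X_j * F^`M(l))).
  by rewrite /lower evalc_sum; apply: eq_bigr => j _; rewrite evalc_sum.
have o_term : evalc X (o.+1%:R * ('X_o * F^`M(o))) = X * evalc X F^`M(o).
  by rewrite /evalc !mevalM mevalXU o0 meval1 mul1r.
rewrite [RHS]evalc_sum [RHS](bigD1 o) //= o_term.
congr (_ + _); rewrite (exchange_big_dep (fun l : 'I_M => l != o)) /=; last first.
  by move=> j l _ /eqP l_eq; rewrite -val_eqE /= o0 l_eq.
apply: eq_bigr => l ne_l.
have l_gt0 : (0 < l)%N by rewrite lt0n -o0; apply: contraNneq ne_l => /val_inj ->.
have lt_l : (l.-1 < M)%N by apply: leq_ltn_trans (ltn_ord l); apply: leq_pred.
rewrite (big_pred1 (Ordinal lt_l)) => [|j]; last first.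
  by rewrite [RHS]/= -[RHS]val_eqE /= -[in LHS](prednK l_gt0) eqSS eq_sym.
by rewrite /evalc !mevalM !mevalXU.
Qed.

Lemma evalc_ev N F : evalc N%:R F = (ev N F).@[fun=> 1].
Proof.
rewrite evE comp_mpoly_meval /evalc; apply: meval_eq => i; rewrite tnth_mktuple.
rewrite /psum raddf_sum /= (eq_bigr (fun=> 1)) ?sumr_const ?card_ord // => k _.
by rewrite rmorphXn /= mevalXU expr1n.
Qed.

End LoweringOperator.

(** * Complements in a rectangle *)

Section Complement.
Local Open Scope nat_scope.
Implicit Types (s t : seq nat) (A N : nat).

Lemma nth_filter_pos t i : sorted geq t -> nth 0 [seq x <- t | 0 < x] i = nth 0 t i.
Proof.
elim: t i => [|x t IHt] i //= t_path; have t_sorted := path_sorted t_path.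
case: ltnP => [x_gt0|x_le0]; first by case: i => //= i; apply: IHt.
have /allP x_ge : all (geq x) t by apply: order_path_min t_path => a b c /= ? ?; lia.
rewrite (eq_in_filter (a2 := pred0)) => [|y /x_ge /=]; last by lia.
rewrite filter_pred0 nth_nil; case: i => [|i] /=; first by lia.
have [lt_i|le_i] := ltnP i (size t); last by rewrite nth_default.
by have := x_ge _ (mem_nth 0 lt_i); rewrite /=; lia.
Qed.

Definition compl A N s := [seq x <- mkseq (fun r => A - nth 0 s (N - r.+1)) N | 0 < x].

Lemma compl_sorted A N s : is_part s -> sorted geq (mkseq (fun r => A - nth 0 s (N - r.+1)) N).
Proof.
move=> s_part; rewrite /mkseq sorted_map; apply: (@sub_sorted _ leq); last exact: iota_sorted.
move=> i j /= le_ij; apply: leq_sub2l.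
by apply: part_nth => //; lia.
Qed.

Lemma compl_part A N s : is_part s -> is_part (compl A N s).
Proof.
move=> s_part; apply/andP; split; last by apply: filter_all.
apply: sorted_filter (compl_sorted A N s_part).
by move=> x y z /= ? ?; lia.
Qed.

Lemma size_compl A N s : size (compl A N s) <= N.
Proof. by rewrite size_filter (leq_trans (count_size _ _)) // size_mkseq. Qed.

Lemma nth_compl A N s r : is_part s ->
  nth 0 (compl A N s) r = if r < N then A - nth 0 s (N - r.+1) else 0.
Proof.
move=> s_part; rewrite nth_filter_pos ?compl_sorted //.
by case: ltnP => [lt_r|le_r]; [rewrite nth_mkseq | rewrite nth_default ?size_mkseq].
Qed.

Lemma complK A N s : is_part s -> size s <= N -> nth 0 s 0 <= A ->
  compl A N (compl A N s) = s.
Proof.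
move=> s_part le_sN le_A; have c_part := compl_part A N s_part.
apply: part_eq => //; first exact: compl_part.
move=> r; rewrite !nth_compl //; case: ltnP => [lt_r|le_r]; last first.
  by rewrite nth_default // (leq_trans le_sN).
have -> : N - r.+1 < N by lia.
have -> : N - (N - r.+1).+1 = r by lia.
by have := part_nth s_part (leq0n r); lia.
Qed.

Lemma nth0_compl A N s : is_part s -> nth 0 (compl A N s) 0 <= A.
Proof. by move=> s_part; rewrite nth_compl //; case: ifP => // _; apply: leq_subr. Qed.

Lemma sum_nth_rev s N b : b <= N ->
  \sum_(r < b) nth 0 s (N - r.+1) + \sum_(i < N - b) nth 0 s i = \sum_(i < N) nth 0 s i.
Proof.
elim: b => [|b IHb] le_bN; first by rewrite big_ord0 subn0.
rewrite -(IHb (ltnW le_bN)) (sum_ordS b (fun r => nth 0 s (N - r.+1))).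
have -> : N - b = (N - b.+1).+1 by lia.
by rewrite (sum_ordS (N - b.+1) (nth 0 s)); lia.
Qed.

Lemma sumn_take_compl A N s b : is_part s -> nth 0 s 0 <= A -> b <= N ->
  sumn (take b (compl A N s)) + \sum_(r < b) nth 0 s (N - r.+1) = b * A.
Proof.
move=> s_part le_A le_bN; rewrite sumn_take -big_split /=.
rewrite (eq_bigr (fun=> A)) => [|r _]; first by rewrite sum_nat_const card_ord.
rewrite nth_compl // (leq_trans (ltn_ord r) le_bN) subnK //.
exact: leq_trans (part_nth s_part (leq0n _)) le_A.
Qed.

Lemma sumn_compl A N s : is_part s -> size s <= N -> nth 0 s 0 <= A ->
  sumn (compl A N s) + sumn s = N * A.
Proof.
move=> s_part le_sN le_A; rewrite -(sumn_take_compl s_part le_A (leqnn N)).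
rewrite take_oversize ?size_compl // (sumn_nth le_sN) -(sum_nth_rev s (leqnn N)).
by rewrite subnn big_ord0 addn0.
Qed.

Lemma dom_le N s (m : 'X_{1..N}) i : dom s m -> m i <= nth 0 s 0.
Proof.
move=> /(_ [set i]); rewrite big_set1 cards1 sumn_take big_ord_recl big_ord0 addn0.
by [].
Qed.

(** Since all N rows are nonempty, A + 1 - s_i equals A - (s_i - 1). *)
Lemma compl_colrem A N s : is_part s -> size s = N -> compl A.+1 N s = compl A N (colrem s).
Proof.
move=> s_part size_s; have cs_part := colrem_part s_part.
apply: part_eq; rewrite ?compl_part // => r; rewrite !nth_compl // nth_colrem //.
case: ltnP => // lt_r; have := part_nth_gt0 (N - r.+1) s_part; rewrite size_s; lia.
Qed.

End Complement.

Section ReversedEigen.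
Variables (K : fieldType) (alpha : K).

Lemma diag_rev_pexp N s : (size s <= N)%N ->
  diag_rev alpha [multinom nth 0%N s (N - (i : 'I_N).+1) | i < N] = eigval alpha s.
Proof.
move=> le_sN; rewrite -(diag_pexp alpha le_sN) /diag /diag_rev (reindex_inj rev_ord_inj).
apply: eq_bigr => i _ /=; rewrite mnmE pexpE /=.
have -> : (N - (N - i.+1).+1 = i)%N by move: (ltn_ord i); lia.
by have -> : (N.-1 - (N - i.+1) = i)%N by move: (ltn_ord i); lia.
Qed.

(** The squares cancel, so the difference depends on [a] only through its degree: it is the same for
    all monomials of a homogeneous function and can be computed at the leading one. *)
Lemma diag_compl N A (a a' : 'X_{1..N}) : (forall i, a i + a' i = A)%N ->
  diag alpha a - diag_rev alpha a' =
  alpha * ((A%:R - 1) * (mdeg a).*2%:R - N%:R * (A%:R * (A%:R - 1)))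
  + ((\sum_(i < N) (N.-1 - i)) * A).*2%:R - (N.-1 * mdeg a).*2%:R.
Proof.
move=> eq_A; rewrite /diag /diag_rev mdegE -!mul2n !natrM !natr_sum.
have -> : N%:R * (A%:R * (A%:R - 1)) = \sum_(i < N) A%:R * (A%:R - 1) :> K.
  by rewrite sumr_const card_ord mulr_natl.
rewrite !mulr_sumr !mulr_suml -!sumrB !mulr_sumr -big_split -sumrB; apply: eq_bigr => i _ /=.
have AE : A%:R = (a i)%:R + (a' i)%:R :> K by rewrite -natrD eq_A.
have NE : N.-1%:R = (N.-1 - i)%:R + i%:R :> K.
  by rewrite -natrD subnK //; move: (ltn_ord i); lia.
by rewrite -!mul2n !natrM NE AE; ring.
Qed.

End ReversedEigen.

(** * The expansion of prod_i (1 - x_i)^A *)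

Section GeneratingFunction.
Variables (K : fieldType) (alpha : K).
Hypothesis alphaP : jack_parameter alpha.
Variables (M : nat) (X : K).

Definition gcoef k (m : 'X_{1..M}) : K :=
  if mnmwgt m == k then X ^+ mdeg m / pweight alpha m else 0.

(* The degree [k] part of [exp (sum_i X p_i / (i alpha))]. *)
Definition genf k : {mpoly K[M]} := \sum_(m : 'X_{1..M < k.+1}) gcoef k m *: 'X_[m].

Lemma mcoeff_genf k m : (genf k)@_m = gcoef k m.
Proof.
have [lt_m|le_m] := ltnP (mdeg m) k.+1; first by rewrite /genf (mcoeff_mpoly (gcoef k)).
rewrite /genf raddf_sum /= big1 => [|m' _].
  by rewrite /gcoef; case: eqP => // wt_m; have := leq_mdeg_mnmwgt m; lia.
rewrite mcoeffZ mcoeffX; case: eqP => [m'_eq|_]; last by rewrite mulr0.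
by have := bmdeg m'; rewrite m'_eq; lia.
Qed.

Lemma whomog_genf k : whomog k (genf k).
Proof. by move=> m; rewrite mcoeff_genf /gcoef; have [//|_] := eqVneq (mnmwgt m) k;
  rewrite eqxx. Qed.

(** The norms in [gcoef] cancel those of the form: [genf] is the reproducing kernel of the
    evaluation p_i = X. *)
Lemma form_genf k F : whomog k F -> form alpha F (genf k) = evalc X F.
Proof.
move=> hF; rewrite formC /form /evalc mevalE; apply: eq_big_seq => m.
rewrite mcoeff_msupp => /hF wt_m; rewrite mcoeff_genf /gcoef wt_m eqxx mulfVK; last first.
  exact: pweight_neq0.
by rewrite mdegE expr_sum.
Qed.

Lemma mderiv_genf k (i : 'I_M) : (genf k)^`M(i) =
  if (i < k)%N then (X / (alpha * i.+1%:R)) *: genf (k - i.+1) else 0.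
Proof.
apply/mpolyP => m; rewrite mcoeff_deriv mcoeff_genf /gcoef mnmwgtD mnmwgt1.
have wt0 := pweight_neq0 alphaP m; have a0 := jack_parameter_neq0 alphaP.
have nat0 n : 1 + n%:R != 0 :> K by rewrite addrC natr1 (natr_neq0 alphaP).
case: ltnP => [lt_ik|le_ki]; last first.
  by rewrite mcoeff0; case: eqP => [e|_]; [lia | rewrite mul0rn].
rewrite mcoeffZ mcoeff_genf /gcoef -(eqn_add2r i.+1 (mnmwgt m)) subnK //.
case: eqP => _; last by rewrite mul0rn mulr0.
rewrite -mulr_natl mdegD mdeg1 addn1 exprS pweightU.
by field; rewrite wt0 a0 !nat0.
Qed.

Variable N : nat.

Let q : K := X / alpha.

(** The graded form of (1 - x_i) dE/dx_i = q E, which characterises the power - q of 1 - x_i. *)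
Lemma ev_genf_rec k (i : 'I_N) : (k < M)%N ->
  (ev N (genf k.+1))^`M(i) = 'X_i * (ev N (genf k))^`M(i) + q%:MP * ev N (genf k).
Proof.
have derivE k' : (k' <= M)%N -> (ev N (genf k'))^`M(i) =
    q%:MP * \sum_(l < k') ev N (genf (k' - l.+1)) * 'X_i ^+ l.
  move=> le_k'; rewrite mderiv_ev mulr_sumr.
  rewrite (big_ord_widen M (fun l => q%:MP * (ev N (genf (k' - l.+1)) * 'X_i ^+ l))) //.
  rewrite [RHS]big_mkcond; apply: eq_bigr => l _; rewrite mderiv_genf.
  case: ltnP => _; last by rewrite ev0 mulr0 mul0r.
  rewrite evZ -mul_mpolyC -mpolyC_nat mulrA -mpolyCM mulrA; congr (_%:MP * _ * _).
  have nat0 : 1 + l%:R != 0 :> K by rewrite addrC natr1 (natr_neq0 alphaP).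
  by rewrite /q; have a0 := jack_parameter_neq0 alphaP; field; rewrite a0 nat0.
move=> lt_kM; rewrite (derivE _ lt_kM) (derivE _ (ltnW lt_kM)) big_ord_recl /= subn1 expr0 mulr1
  /=.
rewrite mulrDr addrC; congr (_ + _); rewrite [RHS]mulrCA; congr (_ * _); rewrite mulr_sumr.
by apply: eq_bigr => l _; rewrite /bump /= add1n subSS exprS; ring.
Qed.

Definition genf_coef (m : 'X_{1..N}) : K := (ev N (genf (mdeg m)))@_m.

Lemma genf_coef_rec (m : 'X_{1..N}) i : (mdeg m < M)%N ->
  (m i).+1%:R * genf_coef (m + U_(i)) = (q + (m i)%:R) * genf_coef m.
Proof.
move=> lt_mM; have := congr1 (mcoeff m) (ev_genf_rec i lt_mM).
rewrite mcoeff_deriv mcoeffD mcoeff_euler mcoeffCM -[_ *+ (m i).+1]mulr_natl /genf_coef mdegD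
  mdeg1 addn1.
by move=> ->; ring.
Qed.

Lemma genf_coef0 : genf_coef 0%MM = 1.
Proof.
rewrite /genf_coef mdeg0 (whomog0E (whomog_genf (k := 0))) evC mcoeffC eqxx mulr1 mcoeff_genf.
by rewrite /gcoef mnmwgt0 eqxx mdeg0 expr0 /pweight big1 ?divr1 // => i _;
  rewrite mnm0E expr0 mulr1.
Qed.

(* For [X = - alpha A] the generating function is [prod_i (1 - x_i)^A]. *)
Lemma genf_coef_bin A (m : 'X_{1..N}) : X = - (alpha * A%:R) -> (mdeg m <= M)%N ->
  genf_coef m = \prod_(i < N) ((-1) ^+ m i * 'C(A, m i)%:R).
Proof.
move=> X_eq; have [d] := ubnP (mdeg m); elim: d m => // d IHd m lt_d le_mM.
have [m0|ne_m0] := eqVneq m 0%MM.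
  by rewrite m0 genf_coef0 big1 // => i _; rewrite mnm0E bin0 expr0 mulr1.
have [i mi_gt0] : exists i, (0 < m i)%N.
  apply/existsP; apply: contraNT ne_m0; rewrite negb_exists => /forallP m0.
  by apply/eqP/mnmP => i; apply/eqP; rewrite mnm0E -leqn0 leqNgt.
have m_eq : m = (m - U_(i) + U_(i))%MM by rewrite submK // lep1mP -lt0n.
set m' := (m - U_(i))%MM in m_eq; have deg_m : mdeg m = (mdeg m').+1.
  by rewrite {1}m_eq mdegD mdeg1 addn1.
have mi_eq : m i = (m' i).+1 by rewrite m_eq mnmDE mnm1E eqxx addn1.
have := @genf_coef_rec m' i; rewrite -m_eq => /(_ (leq_trans (eq_leq (esym deg_m)) le_mM)).
rewrite (IHd m'); [|lia..]; have mi0 := natr_neq0 alphaP (ltn0Sn (m' i)).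
move=> rec; apply: (mulfI mi0); rewrite rec (bigD1 i) //= [in RHS](bigD1 i) //=.
have -> : \prod_(j < N | j != i) ((-1) ^+ m j * 'C(A, m j)%:R) =
    \prod_(j < N | j != i) ((-1) ^+ m' j * 'C(A, m' j)%:R) :> K.
  by apply: eq_bigr => j /negbTE ne_j; rewrite m_eq mnmDE mnm1E eq_sym ne_j addn0.
rewrite mi_eq exprS !mulrA; congr (_ * _).
have bin_eq : (m' i).+1%:R * 'C(A, (m' i).+1)%:R = (A%:R - (m' i)%:R) * 'C(A, m' i)%:R :> K.
  rewrite -natrM mul_bin_left natrM; have [le_A|lt_A] := leqP (m' i) A; first by rewrite natrB.
  by rewrite bin_small // !mulr0.
have -> : q = - A%:R by rewrite /q X_eq; have a0 := jack_parameter_neq0 alphaP; field.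
transitivity (- (-1) ^+ m' i * ((m' i).+1%:R * 'C(A, (m' i).+1)%:R) : K); last by ring.
by rewrite bin_eq; ring.
Qed.

Lemma genf_coef_rev A (m m' : 'X_{1..N}) : X = - (alpha * A%:R) -> (N * A <= M)%N ->
  (forall i, m i + m' i = A)%N -> genf_coef m = (-1) ^+ (N * A) * genf_coef m'.
Proof.
move=> X_eq le_M eq_A.
have le_deg (a : 'X_{1..N}) : (forall i, a i <= A)%N -> (mdeg a <= M)%N.
  move=> le_a; apply: leq_trans le_M; rewrite mdegE -[N in (N * _)%N]card_ord -sum_nat_const.
  exact: leq_sum.
rewrite !(genf_coef_bin X_eq) ?le_deg // => [|i|i]; try by rewrite -(eq_A i) ?leq_addr ?leq_addl.
rewrite mulnC exprM -[N in _ ^+ N]card_ord -prodr_const -big_split; apply: eq_bigr => i _ /=.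
have -> : (-1) ^+ m i = (-1) ^+ A * (-1) ^+ m' i :> K.
  by rewrite -exprD -(eq_A i) -addnA addnn exprD -mul2n exprM sqrrN !expr1n mulr1.
have -> : 'C(A, m i) = 'C(A, m' i).
  by rewrite -(bin_sub (n := A) (m := m' i)) -?(eq_A i) ?leq_addl // addnK.
by rewrite mulrA.
Qed.

Lemma genf_coef_big A (m : 'X_{1..N}) i : X = - (alpha * A%:R) -> (mdeg m <= M)%N ->
  (A < m i)%N -> genf_coef m = 0.
Proof.
move=> X_eq le_M lt_A; rewrite (genf_coef_bin X_eq) // (bigD1 i) //= bin_small //.
by rewrite mulr0 mul0r.
Qed.

End GeneratingFunction.

Section CpolyShift.
Variables (K : fieldType) (alpha : K).

(** Telescoping along each row: shifting by alpha drops the factor of the first box and adds that of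
    the box just past the end. *)
Lemma cpoly_shift N s Y : (size s <= N)%N ->
  cpoly alpha s Y * \prod_(i < N) (Y + alpha * (nth 0%N s i)%:R - i%:R) =
  cpoly alpha s (Y + alpha) * \prod_(i < N) (Y - i%:R).
Proof.
move=> le_sN; rewrite !(cpoly_widen _ _ le_sN) -!big_split; apply: eq_bigr => i _ /=.
elim: (nth 0%N s i) => [|a IHa]; first by rewrite !big_ord0 mulr0 addr0.
rewrite !big_ord_recr /= mulrAC [RHS]mulrAC -IHa -natr1; ring.
Qed.

Lemma cpoly_rect_eq0 A s : (A < nth 0%N s 0)%N -> cpoly alpha s (- (alpha * A%:R)) = 0.
Proof.
move=> lt_A; have s_gt0 : (0 < size s)%N by case: s lt_A.
rewrite /cpoly (bigD1 (Ordinal s_gt0)) //= (bigD1 (Ordinal lt_A)) //=.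
by rewrite addNr subr0 !mul0r.
Qed.

End CpolyShift.

Lemma sumn_le_rect s : is_part s -> (sumn s <= size s * nth 0 s 0)%N.
Proof.
move=> s_part; rewrite (sumn_nth (leqnn _)) -[X in (_ <= X * _)%N]card_ord -sum_nat_const.
by apply: leq_sum => i _; apply: part_nth.
Qed.

(** * Jack functions in power sum coordinates *)

(* The Jack functions, normalised to be monic, enter only through the four
   hypotheses below. *)

Section Family.
Variables (K : fieldType) (alpha : K).
Hypothesis alphaP : jack_parameter alpha.
Variables (M : nat) (P : seq nat -> {mpoly K[M]}).
Hypothesis P_supp : forall s N (m : 'X_{1..N}), is_part s -> (sumn s <= M)%N ->
  (ev N (P s))@_m != 0 -> dom s m /\ mdeg m = sumn s.
Hypothesis P_lead : forall s N, is_part s -> (sumn s <= M)%N -> (size s <= N)%N ->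
  (ev N (P s))@_(pexp N s) = 1.
Hypothesis P_hom : forall s, is_part s -> (sumn s <= M)%N -> whomog (sumn s) (P s).
Hypothesis P_orth : forall s t, is_part s -> is_part t -> (sumn s <= M)%N ->
  sumn s = sumn t -> s <> t -> form alpha (P s) (P t) = 0.

(** At the leading exponent of [be], the other P that contribute belong to strictly dominating
    partitions, of smaller [wsum] and again with at most N parts, so induction applies. Longer
    partitions vanish in N variables, and nothing is claimed for them. *)
Lemma P_free_ev N k (c : intpart k -> K) : (k <= M)%N ->
  \sum_be c be *: ev N (P be) = 0 -> forall be : intpart k, (size be <= N)%N -> c be = 0.
Proof.
move=> le_kM sum0 be; have [d] := ubnP (wsum N (nth 0 be)); elim: d be => // d IHd be lt_d le_be.
have be_part := intpart_part be; have be_sum := intpart_sumn be.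
have := congr1 (mcoeff (pexp N be)) sum0; rewrite raddf_sum mcoeff0 (bigD1 be) //= big1.
  by rewrite addr0 mcoeffZ P_lead ?be_sum // mulr1.
move=> ga ne_ga; rewrite mcoeffZ; apply/eqP; rewrite mulf_eq0; apply/norP => -[c_ne0 P_ne0].
have ga_part := intpart_part ga; have ga_sum := intpart_sumn ga.
have [|dom_ga deg_ga] := P_supp ga_part _ P_ne0; first by rewrite ga_sum.
have le_ga := dom_size ga_part dom_ga deg_ga.
have ne_exp : pexp N be <> pexp N ga.
  by move=> /pexp_inj e; case/eqP: ne_ga; apply: intpart_inj; rewrite e.
have := dom_wsum ga_part dom_ga deg_ga ne_exp.
rewrite [X in (_ < X)%N](_ : _ = wsum N (nth 0 be)%N) => [lt_w|]; last first.
  by apply: eq_bigr => i _; rewrite nth_pexp.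
by rewrite IHd ?eqxx // in c_ne0; apply: leq_trans lt_w _.
Qed.

Lemma P_free k (c : intpart k -> K) : (k <= M)%N ->
  \sum_be c be *: P be = 0 -> forall be, c be = 0.
Proof.
move=> le_kM sum0 be; apply: (@P_free_ev k k c) => //; last first.
  by rewrite -[X in (_ <= X)%N](intpart_sumn be) size_le_sum_part // intpart_part.
transitivity (ev k (\sum_be c be *: P be)); last by rewrite sum0 ev0.
by rewrite ev_sum; apply: eq_bigr => ga _; rewrite evZ.
Qed.

Lemma whomog_sum_P k (c : intpart k -> K) : (k <= M)%N -> whomog k (\sum_be c be *: P be).
Proof.
move=> le_kM; apply: supp_in_sum => be _; apply: supp_inZ.
by have := P_hom (intpart_part be); rewrite intpart_sumn; apply.
Qed.

(** Partitions of k index both the family and the power sum coordinates, so the transition matrix is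
    square and independence makes it invertible. *)
Lemma P_span k F : (k <= M)%N -> whomog k F -> exists c : intpart k -> K, F = \sum_be c be *: P
  be.
Proof.
move=> le_kM hF; pose n := #|{: intpart k}|.
pose A : 'M[K]_n := \matrix_(i < n, j < n) (P (enum_val i : intpart k))@_(pmn M (enum_val j :
  intpart k)).
have sumE (c : 'rV[K]_n) : \sum_be c 0 (enum_rank be) *: P (be : intpart k) =
    \sum_(i < n) c 0 i *: P (enum_val i : intpart k).
  rewrite (reindex_onto enum_val enum_rank) /=; last by move=> i _; rewrite enum_rankK.
  by apply: eq_big => [i|i _]; rewrite enum_valK ?eqxx.
have coefE (c : 'rV[K]_n) (j : 'I_n) :
    (\sum_be c 0 (enum_rank be) *: P (be : intpart k))@_(pmn M (enum_val j : intpart k)) =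
    (c *m A) 0 j.
  rewrite sumE raddf_sum mxE; apply: eq_bigr => i _ /=; by rewrite mcoeffZ mxE.
have A_free : row_free A.
  apply: inj_row_free => v vA0; apply/rowP => i; rewrite mxE.
  rewrite -(enum_valK i); apply: (@P_free k (fun be => v 0 (enum_rank be)) le_kM).
  apply: (whomog_eq le_kM); first exact: whomog_sum_P.
    exact: supp_in0.
  by move=> be; rewrite mcoeff0 -(enum_rankK be) coefE vA0 mxE.
have A_unit : A \in unitmx by rewrite -row_free_unit.
pose f : 'rV[K]_n := \row_(j < n) F@_(pmn M (enum_val j : intpart k)).
exists (fun be => (f *m invmx A) 0 (enum_rank be)).
apply: (whomog_eq le_kM) => //; first exact: whomog_sum_P.
by move=> be; rewrite -(enum_rankK be) coefE mulmxKV // mxE.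
Qed.

Definition sqnorm s := form alpha (P s) (P s).

Lemma form_P_sum k (c : intpart k -> K) (be : intpart k) : (k <= M)%N ->
  form alpha (P be) (\sum_ga c ga *: P ga) = c be * sqnorm be.
Proof.
move=> le_kM; rewrite form_sumr (bigD1 be) //= big1 ?addr0 ?formZr // => ga ne_ga.
rewrite formZr P_orth ?mulr0 ?intpart_part ?intpart_sumn // => eq_be.
by case/eqP: ne_ga; apply: intpart_inj.
Qed.

Lemma sqnorm_neq0 s : is_part s -> (sumn s <= M)%N -> sqnorm s != 0.
Proof.
move=> s_part le_sM; apply/eqP => norm0.
have [be be_eq] := intpart_of s_part (erefl (sumn s)).
have P0 : P s = 0.
  apply: (whomog_eq le_sM); first exact: P_hom.
    exact: supp_in0.
  move=> ga; rewrite mcoeff0.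
  have hX : whomog (sumn s) ('X_[pmn M ga] : {mpoly K[M]}).
    move=> m; rewrite mcoeffX; have [<- _|_] := eqVneq (pmn M ga) m; last by rewrite eqxx.
    by rewrite mnmwgt_pmn ?intpart_part ?intpart_sumn.
  have [c X_eq] := P_span le_sM hX.
  have := form_P_sum c be le_sM; rewrite be_eq norm0 mulr0 -X_eq formXr => /eqP.
  by rewrite mulf_eq0 (negbTE (pweight_neq0 alphaP _)) orbF => /eqP.
have := P_lead s_part le_sM (leqnn (size s)).
by rewrite P0 ev0 mcoeff0 => /eqP; rewrite eq_sym oner_eq0.
Qed.

Lemma P_expand k F : (k <= M)%N -> whomog k F ->
  F = \sum_(be : intpart k) (form alpha (P be) F / sqnorm be) *: P be.
Proof.
move=> le_kM hF; have [c F_eq] := P_span le_kM hF; rewrite {1}F_eq; apply: eq_bigr => be _.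
by rewrite F_eq form_P_sum // mulfK // sqnorm_neq0 ?intpart_part ?intpart_sumn.
Qed.

Lemma ev_D2_P_supp s N (m : 'X_{1..N}) : is_part s -> (sumn s <= M)%N -> antitone m ->
  (ev N (D2 alpha (P s)))@_m != 0 -> dom s m.
Proof.
move=> s_part le_sM dec_m; rewrite mcoeff_ev_D2; last exact: whomog_quadratic_free (P_hom _ _) _.
have [dom_m _|ndom_m] := boolP [forall A : {set 'I_N}, (\sum_(i in A) m i <= sumn (take #|A|
  s))%N].
  by move=> A; apply: (forallP dom_m).
have ndom : ~ dom s m by move=> dom_m; case/negP: ndom_m; apply/forallP.
have [->|ne0] := eqVneq (ev N (P s))@_m 0; last by case: ndom; case: (P_supp s_part le_sM ne0).
rewrite mulr0 add0r big1 ?mulr0 ?eqxx // => i _; apply: big1 => j lt_ij.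
rewrite /transfer_sum big_nat; apply: big1 => k /andP[k_gt0 lt_k].
have [->|ne0] := eqVneq (ev N (P s))@_(transfer m i j k) 0; first by rewrite mulr0.
case: ndom; have [dom_t _] := P_supp s_part le_sM ne0.
apply: dom_transfer dom_t; [by rewrite -val_eqE neq_ltn lt_ij | by [] | exact: dec_m (ltnW
  lt_ij)].
Qed.

Lemma dom_anti N s t : is_part s -> is_part t -> sumn s = sumn t ->
  (size s <= N)%N -> (size t <= N)%N -> dom s (pexp N t) -> dom t (pexp N s) -> s = t.
Proof.
move=> s_part t_part eq_st le_s le_t dom_t dom_s.
have wE u : wsum N (nth 0%N (pexp N u)) = wsum N (nth 0%N u).
  by apply: eq_bigr => i _; rewrite nth_pexp.
have [/pexp_inj ->|ne_exp] := eqVneq (pexp N t) (pexp N s); [by []..|].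
have := dom_wsum s_part dom_t; rewrite mdeg_pexp // eq_st => /(_ erefl (elimN eqP ne_exp)).
rewrite eq_sym in ne_exp.
have := dom_wsum t_part dom_s; rewrite mdeg_pexp // eq_st => /(_ erefl (elimN eqP ne_exp)).
by rewrite !wE; lia.
Qed.

Lemma D2_P_triangular k (be : intpart k) (d : intpart k -> K) : (k <= M)%N ->
  D2 alpha (P be) = \sum_ga d ga *: P ga ->
  forall ga, d ga != 0 -> dom be (pexp k ga).
Proof.
move=> le_kM D2_eq ga; have [x] := ubnP (wsum k (nth 0 ga)); elim: x ga => // x IHx ga lt_x d_ne0.
have be_part := intpart_part be; have be_sum := intpart_sumn be.
have ga_part := intpart_part ga; have ga_sum := intpart_sumn ga.
have szE (nu : intpart k) : (size nu <= k)%N.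
  by rewrite -[X in (_ <= X)%N](intpart_sumn nu) size_le_sum_part // intpart_part.
have [dom_ga|ndom] := boolP [forall A : {set 'I_k}, (\sum_(i in A) pexp k ga i <= sumn (take #|A|
  be))%N].
  by move=> A; apply: (forallP dom_ga).
have := congr1 (fun F => (ev k F)@_(pexp k ga)) D2_eq; rewrite ev_sum raddf_sum (bigD1 ga) //=.
rewrite evZ mcoeffZ P_lead ?ga_sum // mulr1 big1 ?addr0 => [d_eq|nu ne_nu].
  by apply: (@ev_D2_P_supp be k); rewrite ?be_sum ?d_eq //; apply: dec_pexp.
rewrite evZ mcoeffZ; apply/eqP; rewrite mulf_eq0; apply/norP => -[dnu_ne0 P_ne0].
have nu_part := intpart_part nu; have nu_sum := intpart_sumn nu.
have [|dom_nu deg_nu] := P_supp nu_part _ P_ne0; first by rewrite nu_sum.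
have ne_exp : pexp k ga <> pexp k nu.
  by move=> /pexp_inj e; case/eqP: ne_nu; apply: intpart_inj; rewrite e.
have := dom_wsum nu_part dom_nu deg_nu ne_exp.
rewrite [X in (_ < X)%N](_ : _ = wsum k (nth 0 ga)%N) => [lt_w|]; last first.
  by apply: eq_bigr => i _; rewrite nth_pexp.
case/negP: ndom; apply/forallP; apply: dom_trans dom_nu.
by apply: IHx => //; apply: leq_trans lt_w _.
Qed.

(** By self-adjointness and nonzero norms, if P_ga occurs in D2 P_be then P_be occurs in D2 P_ga;
    triangularity makes the two partitions dominate each other, hence equal. *)
Lemma D2_P s : is_part s -> (sumn s <= M)%N -> D2 alpha (P s) = eigval alpha s *: P s.
Proof.
move=> s_part le_sM; have [be be_eq] := intpart_of s_part (erefl (sumn s)).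
have homP (nu : intpart (sumn s)) : whomog (sumn s) (P nu).
  by have := P_hom (intpart_part nu); rewrite intpart_sumn; apply.
have szE (nu : intpart (sumn s)) : (size nu <= sumn s)%N.
  by rewrite -[X in (_ <= X)%N](intpart_sumn nu) size_le_sum_part // intpart_part.
have [d D2_eq] := P_span le_sM (@whomog_D2 _ _ alpha _ _ (homP be)).
have d0 ga : ga != be -> d ga = 0.
  move=> ne_ga; apply/eqP; apply: contraNT ne_ga => d_ne0.
  have [d' D2_eq'] := P_span le_sM (@whomog_D2 _ _ alpha _ _ (homP ga)).
  have := form_D2_sym alpha (P ga) (P be).
  rewrite D2_eq' D2_eq form_P_sum // formC form_P_sum // => eq_d.
  have d'_ne0 : d' be != 0.
    apply/eqP => d'0; move/eqP: eq_d; rewrite d'0 mul0r eq_sym mulf_eq0 (negbTE d_ne0) /=.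
    by rewrite (negbTE (sqnorm_neq0 _ _)) ?intpart_part ?intpart_sumn.
  apply/eqP; apply: intpart_inj; apply: (@dom_anti (sumn s));
    rewrite ?intpart_part ?intpart_sumn //.
    exact: (D2_P_triangular le_sM D2_eq').
  exact: (D2_P_triangular le_sM D2_eq).
have {}D2_eq : D2 alpha (P s) = d be *: P s.
  rewrite -be_eq D2_eq (bigD1 be) //= big1 ?addr0 // => ga ne_ga.
  by rewrite d0 // scale0r.
rewrite D2_eq; congr (_ *: _); set N := size s.
have := congr1 (fun F => (ev N F)@_(pexp N s)) D2_eq.
rewrite evZ mcoeffZ P_lead // mulr1 => <-.
rewrite mcoeff_ev_D2; last exact: whomog_quadratic_free (P_hom _ _) _.
(* A transfer raises the square sum above that of the leading exponent, which is maximal on the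
   support, so only the diagonal term is left. *)
rewrite P_lead // mulr1 diag_pexp // big1 ?mulr0 ?addr0 // => i _; apply: big1 => j lt_ij.
rewrite /transfer_sum big_nat; apply: big1 => k /andP[k_gt0 lt_k].
have [->|ne0] := eqVneq (ev N (P s))@_(transfer (pexp N s) i j k) 0; first by rewrite mulr0.
have [dom_t _] := P_supp s_part le_sM ne0.
have nij : i != j by rewrite -val_eqE neq_ltn lt_ij.
have := sqsum_transfer nij k_gt0 lt_k (dec_pexp s_part (ltnW lt_ij)).
by rewrite ltnNge dom_sqsum.
Qed.

Lemma P_eigen_eq s N (m : 'X_{1..N}) : is_part s -> (sumn s <= M)%N ->
  eigen_eq alpha (eigval alpha s) (fun m => (ev N (P s))@_m) m.
Proof.
move=> s_part le_sM; rewrite /eigen_eq -mcoeff_ev_D2;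
  last exact: whomog_quadratic_free (P_hom _ _) _.
by rewrite D2_P // evZ mcoeffZ.
Qed.

Lemma P_eigen_eq_rev s N (m : 'X_{1..N}) : is_part s -> (sumn s <= M)%N ->
  eigen_eq_rev alpha (eigval alpha s) (fun m => (ev N (P s))@_m) m.
Proof.
move=> s_part le_sM; rewrite /eigen_eq_rev -mcoeff_ev_D2_rev;
  last exact: whomog_quadratic_free (P_hom _ _) _.
by rewrite D2_P // evZ mcoeffZ.
Qed.

Let colrem_le s : is_part s -> (sumn s <= M)%N -> (sumn (colrem s) <= M)%N.
Proof. by move=> s_part; rewrite -sumn_colrem //; lia. Qed.

Let shifted N (g : {mpoly K[N]}) (m : 'X_{1..N}) : K :=
  if [forall i, (0 < m i)%N] then g@_[multinom (m i).-1 | i < N] else 0.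

Lemma shifted_eigen s (m : 'X_{1..size s}) : is_part s -> (sumn s <= M)%N -> antitone m ->
  eigen_eq alpha (eigval alpha s) (shifted (ev (size s) (P (colrem s)))) m.
Proof.
move=> s_part le_sM dec_m; set N := size s in m dec_m *; set g := ev N _.
have cs_part := colrem_part s_part; have le_cs := colrem_le s_part le_sM.
rewrite /eigen_eq {1 2}/shifted; case: forallP => [m_gt0|m_ngt0]; last first.
  (* Some exponent is zero, and no transfer fills it: k >= 1 units come from x_j, and m_i >= m_j
     because [m] decreases, so the receiver was already positive. *)
  rewrite !mulr0 add0r big1 ?mulr0 // => i _; apply: big1 => j lt_ij.
  rewrite /transfer_sum big_nat; apply: big1 => k /andP[k_gt0 lt_k].
  rewrite /shifted; case: forallP => [t_gt0|]; last by rewrite mulr0.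
  have nij : i != j by rewrite -val_eqE neq_ltn lt_ij.
  case: m_ngt0 => l; have := t_gt0 l; rewrite transferE //.
  have := dec_m i j (ltnW lt_ij); case: eqP => [->|_]; first by lia.
  by case: eqP => [->|_]; lia.
set m' := [multinom _ | i < N].
have eq_sum : \sum_(i < N) \sum_(j < N | (i < j)%N) transfer_sum (shifted g) m i j =
    \sum_(i < N) \sum_(j < N | (i < j)%N) transfer_sum (fun m1 => g@_m1) m' i j.
  apply: eq_bigr => i _; apply: eq_bigr => j lt_ij; rewrite /transfer_sum.
  have nij : i != j by rewrite -val_eqE neq_ltn lt_ij.
  have mjE : m j = (m' j).+1 by rewrite mnmE prednK.
  have miE : m i = (m' i).+1 by rewrite mnmE prednK.
  (* The last transfer empties x_j and contributes nothing; the remaining range is the one belonging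
     to [m']. *)
  rewrite [in LHS]mjE big_nat_recr //= {2}/shifted.
  have -> : [forall l, (0 < transfer m i j (m' j).+1 l)%N] = false.
    by apply/negP => /forallP/(_ j); rewrite transferE ?mjE // eqxx eq_sym (negbTE nij) subnn.
  rewrite mulr0 addr0; apply: eq_big_nat => k /andP[k_gt0 lt_k].
  rewrite miE -!natr1; congr (_ * _); first by ring.
  rewrite /shifted; case: forallP => [_|[]]; last first.
    move=> l; rewrite transferE //; last by rewrite mjE; lia.
    by have := m_gt0 l; case: eqP => [->|_]; [|case: eqP => [->|_]]; lia.
  congr (_@__); apply/mnmP => l; rewrite mnmE !transferE // ?mjE; try lia.
  have := m_gt0 l; rewrite miE; case: eqP => [->|_]; first by lia.
  case: eqP => [->|_]; first by lia.
  by rewrite mnmE.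
rewrite eq_sum; have := P_eigen_eq m' cs_part le_cs.
rewrite /eigen_eq -/g => eig.
have [g0|g_ne0] := eqVneq (g@_m') 0.
  by move: eig; rewrite g0 !mulr0.
have [_ deg_m'] := P_supp cs_part le_cs g_ne0.
(* Both differences are instances of [diag_shift], which sees only the degree; the left one is taken
   at the leading exponents. *)
have eq_e : eigval alpha s - eigval alpha (colrem s) = diag alpha m - diag alpha m'.
  rewrite (@diag_shift _ alpha N m m') => [|i]; last by rewrite mnmE prednK.
  by rewrite (eigval_colrem alpha s_part) deg_m'; ring.
have -> : eigval alpha s = eigval alpha (colrem s) + (diag alpha m - diag alpha m') by rewrite
  -eq_e; ring.
by rewrite mulrDl eig; ring.
Qed.

(* Both sides are eigenvectors of [D2] in [size s] variables with the same
   leading term. *)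
Lemma P_colrem s : is_part s -> (sumn s <= M)%N ->
  ev (size s) (P s) = (\prod_(i < size s) 'X_i) * ev (size s) (P (colrem s)).
Proof.
move=> s_part le_sM; set N := size s; set g := ev N (P (colrem s)).
have cs_part := colrem_part s_part; have le_cs := colrem_le s_part le_sM.
apply/mpolyP => m; apply/eqP; rewrite eq_sym -subr_eq0; apply/eqP.
have g_sym : (\prod_(i < N) 'X_i) * g \is symmetric.
  rewrite -mesymnnE rpredM ?mesym_sym //; apply/issymP => sg; apply/mpolyP => m1.
  by rewrite mcoeff_sym; apply: mcoeff_ev_sym.
move: m; apply: (@eigen_eq_unique _ alpha alphaP N s) => //.
- move=> sg m; rewrite mcoeff_ev_sym; congr (_ - _).
  by rewrite -[in RHS](issymP _ g_sym sg) mcoeff_sym.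
- move=> m; have [->|/(P_supp s_part le_sM) //] := eqVneq (ev N (P s))@_m 0.
  rewrite subr0 mcoeff_prodXM; case: forallP => [m_gt0 /(P_supp cs_part le_cs)|];
    last by rewrite eqxx.
  case=> dom_m deg_m; split; last first.
    have szE : size s = (\sum_(i < N) 1)%N by rewrite sum1_card card_ord.
    rewrite -sumn_colrem // -deg_m !mdegE [X in _ = (_ + X)%N]szE -big_split.
    by apply: eq_bigr => i _; rewrite mnmE /= addn1 prednK.
  move=> A; have le_A : (#|A| <= N)%N by rewrite -[X in (_ <= X)%N]card_ord max_card.
  have := dom_m A; rewrite !sumn_take => le_sum.
  rewrite (eq_bigr (fun i => [multinom (m i).-1 | i < N] i + 1)%N) => [|i _]; last first.
    by rewrite mnmE addn1 prednK.
  rewrite [X in (_ <= X)%N](eq_bigr (fun i : 'I_#|A| => nth 0 (colrem s) i + 1)%N) => [|i _];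
    last first.
    by rewrite nth_colrem // addn1 prednK // part_nth_gt0 // (leq_trans (ltn_ord i)).
  by rewrite !big_split /= !sum1_card card_ord leq_add2r.
- move=> m dec_m; apply: eigen_eqB; last exact: (P_eigen_eq).
  have := shifted_eigen s_part le_sM dec_m; rewrite /eigen_eq /shifted -mcoeff_prodXM => ->.
  congr (_ + _ * _); apply: eq_bigr => i _; apply: eq_bigr => j _; apply: eq_bigr => k _.
  by rewrite mcoeff_prodXM.
- rewrite P_lead // mcoeff_prodXM; case: forallP => [_|[]]; last first.
    by move=> i; rewrite pexpE part_nth_gt0.
  have -> : [multinom (pexp N s i).-1 | i < N] = pexp N (colrem s).
    by apply/mnmP => i; rewrite mnmE !pexpE nth_colrem.
  by rewrite P_lead ?subrr // size_colrem.
Qed.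

Lemma ev_P_eq0 N s : is_part s -> (sumn s <= M)%N -> (N < size s)%N -> ev N (P s) = 0.
Proof.
move=> s_part le_sM lt_N; apply/mpolyP => m; rewrite mcoeff0; apply/eqP;
  apply: contraTT lt_N => ne0.
have [dom_m deg_m] := P_supp s_part le_sM ne0.
by rewrite -leqNgt; apply: dom_size dom_m deg_m.
Qed.

Lemma ev_P_addcol N s : is_part s -> (size s <= N)%N -> (sumn s + N <= M)%N ->
  ev N (P (addcol N s)) = (\prod_(i < N) 'X_i) * ev N (P s).
Proof.
move=> s_part le_sN le_M; have t_part := addcol_part N s_part.
have := P_colrem t_part; rewrite addcolK // size_addcol; apply.
by rewrite -sumn_colrem // addcolK // size_addcol.
Qed.

Variable o : 'I_M.
Hypothesis o0 : o = 0%N :> nat.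

Let whomog_P k (be : intpart k) : (k <= M)%N -> whomog k (P be).
Proof. by have := P_hom (intpart_part be); rewrite intpart_sumn. Qed.

Let whomog_dP k (be : intpart k.+1) : (k < M)%N -> whomog k (P be)^`M(o).
Proof. by move=> lt_kM; have := whomog_deriv (i := o) (@whomog_P _ be lt_kM);
  rewrite o0 subn1. Qed.

Let whomog_XP k (be : intpart k) : (k < M)%N -> whomog k.+1 ('X_o * P be).
Proof. by move=> lt_kM; have := whomogXM (i := o) (@whomog_P _ be (ltnW lt_kM));
  rewrite o0 addn1. Qed.

(** Up to norms, one number for two expansions: of d/dp_1 [P b] ([deriv_P]) and, by adjointness, of
    p_1 [P l] ([X_P]). The second allows a proof by column removal. *)
Definition pieri l b := form alpha (P l) (P b)^`M(o).

Lemma deriv_P k (be : intpart k.+1) : (k < M)%N ->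
  (P be)^`M(o) = \sum_(la : intpart k) (pieri la be / sqnorm la) *: P la.
Proof. by move=> lt_kM; apply: P_expand (ltnW lt_kM) (@whomog_dP _ be lt_kM). Qed.

Lemma X_P k (la : intpart k) : (k < M)%N ->
  'X_o * P la = \sum_(be : intpart k.+1) (alpha * pieri la be / sqnorm be) *: P be.
Proof.
move=> lt_kM; rewrite [LHS](P_expand lt_kM (@whomog_XP _ la lt_kM)); apply: eq_bigr => be _.
by rewrite formC form_XMl o0 mulr1.
Qed.

(* In [size be - 1] variables, [d/dp_1] of [P be] is the coefficient of the
   first power of the deleted variable, and [P_colrem] makes it a single Jack
   polynomial. *)
Lemma pieri_new_row k (la : intpart k) (be : intpart k.+1) : (k < M)%N ->
  (size la < size be)%N -> pieri la be != 0 -> add_box alpha la be.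
Proof.
move=> lt_kM lt_size ne0; have be_part := intpart_part be; have be_sum := intpart_sumn be.
have la_part := intpart_part la; have la_sum := intpart_sumn la.
have [N size_be] : {N | size be = N.+1} by exists (size be).-1; lia.
have cb_part := colrem_part be_part; have cb_sum := sumn_colrem be_part.
have ev_be : ev N (P be)^`M(o) = (\prod_(i < N) 'X_i) * ev N (P (colrem be)).
  have := P_colrem be_part; rewrite be_sum size_be => /(_ lt_kM) strip_be.
  by rewrite ev_deriv1 // strip_be kill_deriv_prodXM kill_ev.
have pieri0 : pieri la be / sqnorm la = 0 -> pieri la be = 0.
  by move/eqP; rewrite mulf_eq0 invr_eq0 (negbTE (sqnorm_neq0 _ _)) ?la_sum 1?ltnW // orbF =>
    /eqP.
have := deriv_P be lt_kM => /(congr1 (ev N)); rewrite ev_be ev_sum.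
have [le_N|lt_N] := leqP (size (colrem be)) N; last first.
  rewrite ev_P_eq0 //; last by lia.
  rewrite mulr0 => /esym sum0; case/eqP: ne0; apply: pieri0.
  apply: (@P_free_ev N k (fun la => pieri la be / sqnorm la) (ltnW lt_kM)).
    by rewrite -[RHS]sum0; apply: eq_bigr => ga _; rewrite evZ.
  by rewrite -ltnS -size_be.
have t_part := addcol_part N cb_part.
have t_sum : sumn (addcol N (colrem be)) = k.
  by rewrite -sumn_colrem // addcolK // size_addcol; lia.
have [ta ta_eq] := intpart_of t_part t_sum.
rewrite -ev_P_addcol //; last by lia.
move=> /esym sum_eq; have [<-|ne_ta] := eqVneq ta la.
  by rewrite ta_eq; apply: add_box_new_row.
case/eqP: ne0; apply: pieri0.
have := @P_free_ev N k (fun la => pieri la be / sqnorm la - (la == ta)%:R) (ltnW lt_kM).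
move=> /(_ _ la); rewrite eq_sym (negbTE ne_ta) subr0; apply; last by rewrite -ltnS -size_be.
  transitivity (ev N (P (addcol N (colrem be))) - ev N (P (addcol N (colrem be))));
    last by rewrite subrr.
  rewrite -{1}sum_eq -[X in _ = _ - X](_ : \sum_ga (ga == ta)%:R *: ev N (P ga) = _).
    rewrite -sumrB; apply: eq_bigr => ga _; rewrite evZ scalerBl; by [].
  rewrite (bigD1 ta) //= eqxx scale1r ta_eq big1 ?addr0 // => ga /negbTE ->.
  by rewrite scale0r.
Qed.

(* When [be] is not longer than [la], the product [p_1 P_la] is read off in
   [size la] variables, where a column can be removed from both partitions. *)
Lemma pieri_add_box k (la : intpart k) (be : intpart k.+1) : (k < M)%N ->
  pieri la be != 0 -> add_box alpha la be.
Proof.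
have [x] := ubnP k; elim: x k la be => // x IHx k la be lt_kx lt_kM ne0.
have [lt_size|le_size] := ltnP (size la) (size be); first exact: pieri_new_row.
have be_part := intpart_part be; have be_sum := intpart_sumn be.
have la_part := intpart_part la; have la_sum := intpart_sumn la.
set N := size la in le_size *.
have N_gt0 : (0 < N)%N.
  rewrite lt0n; apply: contraTneq le_size => ->; rewrite -ltnNge lt0n.
  by apply/eqP => /size0nil e; rewrite e in be_sum.
have cl_part := colrem_part la_part; have cl_sum := sumn_colrem la_part.
set k' := sumn (colrem la) in cl_sum *; have [cl cl_eq] := intpart_of cl_part (erefl k').
have lt_k'M : (k' < M)%N by rewrite /N in N_gt0; lia.
pose c' (b' : intpart k'.+1) := alpha * pieri cl b' / sqnorm b'.
have ev_XP : \sum_(b : intpart k.+1) (alpha * pieri la b / sqnorm b) *: ev N (P b) =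
    \sum_(b' : intpart k'.+1 | (size b' <= N)%N) c' b' *: ev N (P (addcol N b')).
  transitivity (ev N ('X_o * P la)).
    by rewrite X_P // ev_sum; apply: eq_bigr => b _; rewrite evZ.
  rewrite evM P_colrem ?la_sum 1?ltnW // -/N mulrCA -evM -cl_eq X_P // ev_sum mulr_sumr.
  rewrite (bigID (fun b' : intpart k'.+1 => (size b' <= N)%N)) /= [X in _ + X]big1 ?addr0.
    apply: eq_bigr => b' le_b'; rewrite evZ ev_P_addcol ?intpart_part ?intpart_sumn //.
      by rewrite scalerAr.
    by rewrite /N; lia.
  move=> b'; rewrite -ltnNge => lt_b'; rewrite evZ ev_P_eq0 ?intpart_part ?intpart_sumn //.
  by rewrite scaler0 mulr0.
have := @P_free_ev N k.+1 (fun b => alpha * pieri la b / sqnorm b -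
  \sum_(b' : intpart k'.+1 | (size b' <= N)%N && (addcol N b' == b :> seq nat)) c' b') lt_kM.
move=> /(_ _ be le_size) c_eq0.
have {c_eq0}/eqP : alpha * pieri la be / sqnorm be -
    \sum_(b' : intpart k'.+1 | (size b' <= N)%N && (addcol N b' == be :> seq nat)) c' b' = 0.
  apply: c_eq0.
  under eq_bigr do rewrite scalerBl.
  rewrite sumrB ev_XP; apply/eqP; rewrite subr_eq0; apply/eqP.
  under [RHS]eq_bigr do rewrite scaler_suml.
  rewrite (exchange_big_dep (fun b' : intpart k'.+1 => (size b' <= N)%N)) /=; last first.
    by move=> b b' _ /andP[].
  apply: eq_bigr => b' le_b'.
  have t_part := addcol_part N (intpart_part b').
  have t_sum : sumn (addcol N b') = k.+1.
    by rewrite -sumn_colrem // addcolK ?intpart_part // size_addcol intpart_sumn /N; lia.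
  have [ta ta_eq] := intpart_of t_part t_sum.
  rewrite (big_pred1 ta) ?ta_eq // => b /=; rewrite le_b' /= -ta_eq eq_sym.
  by apply/eqP/eqP => [/intpart_inj|->].
rewrite subr_eq0 => /eqP c_eq.
have c_ne0 : alpha * pieri la be / sqnorm be != 0.
  by rewrite !mulf_neq0 ?invr_neq0 ?(jack_parameter_neq0 alphaP) // sqnorm_neq0 ?be_sum.
have [b' /andP[le_b' /eqP b'_eq] c'_ne0] : exists2 b' : intpart k'.+1,
    (size b' <= N)%N && (addcol N b' == be :> seq nat) & c' b' != 0.
  apply/exists_inP; rewrite -negb_forall_in; apply: contra c_ne0 => /forall_inP c'0.
  by rewrite c_eq big1 // => b' /c'0/eqP.
rewrite -b'_eq -(colremK la_part) -/N -cl_eq.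
apply: add_box_addcol; rewrite ?intpart_part ?intpart_sumn ?cl_eq ?size_colrem //.
rewrite -cl_eq; apply: IHx lt_k'M _; first by rewrite /N in N_gt0; lia.
by apply: contra c'_ne0 => /eqP e; rewrite /c' e mulr0 mul0r.
Qed.

Definition p1coef s : K := (P s)@_(U_(o) *+ sumn s).

Lemma deriv_P_D2 k (be : intpart k.+1) : (k < M)%N -> 2%:R * lower (P be) =
  \sum_(la : intpart k) (pieri la be / sqnorm la
                         * (eigval alpha be - eigval alpha la)) *: P la.
Proof.
move=> lt_kM; have dP := deriv_P be lt_kM.
have := mderiv_D2 alpha o0 (P be).
rewrite (D2_P) ?intpart_part ?intpart_sumn //.
rewrite mderivZ => /esym/(canRL (addKr _)) ->.
rewrite dP D2_sum scaler_sumr -sumrN -big_split; apply: eq_bigr => la _ /=.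
rewrite D2Z (D2_P) ?intpart_part ?intpart_sumn 1?ltnW //.
by rewrite !scalerA -scaleNr -scalerDl; congr (_ *: _); ring.
Qed.

(* With all power sums set to [X], [X d/dp_1 + lower] becomes the degree, while
   [2 lower] is the commutator of [d/dp_1] and [D2]. *)
Lemma eval_P s X : is_part s -> (sumn s <= M)%N -> evalc X (P s) = p1coef s * cpoly alpha s X.
Proof.
move=> s_part; have [be <-] := intpart_of s_part (erefl (sumn s)).
move: (sumn s) be => k {s s_part}; elim: k => [|k IHk] be le_M.
  have be0 : (be : seq nat) = [::].
    by apply: size0nil; apply/eqP; rewrite -leqn0 -[X in (_ <= X)%N](intpart_sumn be)
      size_le_sum_part // intpart_part.
  rewrite be0 /p1coef /cpoly big_ord0 mulr1 /=.
  have hP : whomog 0 (P [::]) by apply: (P_hom (s := [::])).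
  by rewrite {1}(whomog0E hP) /evalc mevalC.
have lt_kM : (k < M)%N by rewrite -[X in (X <= _)%N](intpart_sumn be).
set phi := fun la => pieri la be / sqnorm la.
have dP : (P be)^`M(o) = \sum_(la : intpart k) phi la *: P la.
  exact: (deriv_P).
have hP : whomog k.+1 (P be) by have := P_hom (intpart_part be); rewrite intpart_sumn; apply.
have tau_be : k.+1%:R * p1coef be = \sum_(la : intpart k) phi la * p1coef la.
  have : ((P be)^`M(o))@_(U_(o) *+ k) = \sum_(la : intpart k) phi la * p1coef la.
    rewrite dP raddf_sum; apply: eq_bigr => la _ /=.
    by rewrite mcoeffZ /p1coef intpart_sumn.
  rewrite mcoeff_deriv mulmnE mnm1E eqxx mul1n mulr_natl /p1coef intpart_sumn => <-.
  by rewrite mulmS addmC.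
have := evalc_lower o0 X hP; rewrite dP => eq_spec.
have eq_lower := congr1 (evalc X) (deriv_P_D2 be lt_kM).
rewrite /evalc -mpolyC_nat mevalM mevalC -/(evalc X _) in eq_lower.
(* For each [la] that occurs, [add_box] turns the content product of [la] into that of [be], which
   factors out; what remains is [tau_be]. *)
have sum_eq : 2%:R * (k.+1%:R * evalc X (P be)) = 2%:R * (k.+1%:R * (p1coef be * cpoly alpha be
  X)).
  rewrite -eq_spec mulrDr -/(evalc X _) eq_lower (mulrA k.+1%:R) tau_be.
  rewrite !evalc_sum !mulr_sumr mulr_suml mulr_sumr -big_split; apply: eq_bigr => la _ /=.
  rewrite /evalc !mevalZ -/(evalc X (P la)) IHk ?intpart_sumn 1?ltnW //.
  have [p0|p_ne0] := eqVneq (pieri la be) 0.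
    by rewrite /phi p0; ring.
  have := pieri_add_box lt_kM p_ne0 X => cov.
  transitivity (phi la * p1coef la * ((2%:R * X + eigval alpha be - eigval alpha la) * cpoly
    alpha la X)).
    by rewrite /phi; ring.
  by rewrite -cov; ring.
by move: sum_eq => /(mulfI (natr_neq0 alphaP (ltn0Sn 1)))/(mulfI (natr_neq0 alphaP (ltn0Sn k))).
Qed.

(** Here [colrem s] is seen as [s] without the last box of each row, so contents do not shift. At X
    = [size s] that last box gives the [hook] factor of the first box in its row. *)
Lemma cpoly_colrem_size s : is_part s -> cpoly alpha s (size s)%:R =
  cpoly alpha (colrem s) (size s)%:R *
  \prod_(i < size s) (alpha * ((nth 0%N s i).-1)%:R + (size s - i.+1)%:R + 1).
Proof.
move=> s_part; rewrite (cpoly_widen _ _ (size_colrem s)) -big_split; apply: eq_bigr => i _ /=.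
rewrite nth_colrem //; have := part_nth_gt0 i s_part; rewrite ltn_ord.
case: (nth 0%N s i) => // a _; rewrite big_ord_recr /=; congr (_ * _).
by rewrite natrB // -natr1; ring.
Qed.

Lemma cpoly_size_neq0 s N : (size s <= N)%N -> cpoly alpha s N%:R != 0.
Proof.
move=> le_sN; apply/prodf_neq0 => i _; apply/prodf_neq0 => j _.
have lt_iN : (i < N)%N := leq_trans (ltn_ord i) le_sN.
have := @alphaP j (N - i)%N; rewrite addn_gt0 subn_gt0 lt_iN orbT => /(_ isT).
by rewrite natrB 1?ltnW //; congr (_ != 0); ring.
Qed.

(* Evaluate [P_colrem] at [x_i = 1]. *)
Lemma p1coef_hook s : is_part s -> (sumn s <= M)%N -> p1coef s = (hook alpha s)^-1.
Proof.
have [d] := ubnP (sumn s); elim: d s => // d IHd s lt_d s_part le_M.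
have [s0|s_gt0] := posnP (size s).
  rewrite (size0nil s0) hookE /hook_prod big_ord0 invr1 /p1coef /=.
  have hP : whomog 0 (P [::]) by apply: (P_hom (s := [::])).
  have := @P_lead [::] 0 isT isT isT; rewrite {1}(whomog0E hP) evC mcoeffC.
  by have -> : pexp 0 [::] == 0%MM; [apply/eqP/mnmP => -[] | rewrite mulr1].
have cs_part := colrem_part s_part; have cs_sum := sumn_colrem s_part.
have le_cs : (sumn (colrem s) <= M)%N by lia.
have := P_colrem s_part le_M.
move=> /(congr1 (fun g => g.@[fun=> 1])); rewrite mevalM -!evalc_ev !eval_P //.
rewrite rmorph_prod /= big1 ?mul1r => [|i _]; last by rewrite mevalXU.
rewrite cpoly_colrem_size // mulrCA [RHS]mulrC.
move/(mulfI (cpoly_size_neq0 (size_colrem s))) => tau_eq.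
rewrite hookE hook_prod_colrem // -hookE invfM -IHd //; last by lia.
rewrite -tau_eq mulfK //; apply/prodf_neq0 => i _.
have := @alphaP (nth 0%N s i).-1 (size s - i.+1).+1%N; rewrite addnS => /(_ isT).
by rewrite -natr1 mulrC addrA.
Qed.

(** The coefficients of (x_1 ... x_N)^A g(1/x); the guard discards exponents where A - m_i would
    truncate. *)
Definition reversed N A (g : {mpoly K[N]}) (m : 'X_{1..N}) : K :=
  if [forall i, (m i <= A)%N] then g@_[multinom A - m i | i < N]%N else 0.

Section Fixed.
Variables (A N : nat) (s : seq nat).
Hypotheses (s_part : is_part s) (le_sN : (size s <= N)%N) (le_sA : (nth 0%N s 0 <= A)%N).
Hypothesis le_NA : (N * A <= M)%N.

Let ka := compl A N s.
Let g := ev N (P s).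
Let ka_part : is_part ka. Proof. exact: compl_part. Qed.
Let sum_ka : (sumn ka + sumn s = N * A)%N. Proof. exact: sumn_compl. Qed.
Let le_s : (sumn s <= M)%N. Proof. by move: sum_ka; lia. Qed.
Let le_ka : (sumn ka <= M)%N. Proof. by move: sum_ka; lia. Qed.

Let g_big (m : 'X_{1..N}) i : (A < m i)%N -> g@_m = 0.
Proof.
move=> lt_A; apply/eqP; apply: contraTT lt_A => /(P_supp s_part le_s)[dom_m _].
by rewrite -leqNgt (leq_trans (dom_le i dom_m)).
Qed.

Let reversed_supp (m : 'X_{1..N}) : reversed A g m != 0 -> dom ka m /\ mdeg m = sumn ka.
Proof.
rewrite /reversed; case: forallP => [le_mA|_]; last by rewrite eqxx.
set m' := [multinom _ | i < N] => /(P_supp s_part le_s)[dom_m' deg_m'].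
have addE i : (m i + m' i = A)%N by rewrite mnmE subnKC.
have sumE (B : {set 'I_N}) : (\sum_(i in B) m i + \sum_(i in B) m' i = #|B| * A)%N.
  by rewrite -big_split /= (eq_bigr (fun=> A)) ?sum_nat_const // => i _; apply: addE.
have totE : (\sum_(i < N) m i + \sum_(i < N) m' i = N * A)%N.
  by rewrite -big_split /= (eq_bigr (fun=> A)) ?sum_nat_const ?card_ord // => i _; apply: addE.
split; last by move: totE; rewrite -!mdegE deg_m' -sum_ka; lia.
move=> B; have le_B : (#|B| <= N)%N by rewrite -[X in (_ <= X)%N]card_ord max_card.
have := dom_m' (~: B); have card_BC : (#|~: B| = N - #|B|)%N.
  by have := cardsC B; rewrite card_ord; lia.
rewrite card_BC sumn_take => le_BC.
have splitE : (\sum_(i in B) m' i + \sum_(i in ~: B) m' i = \sum_(i < N) m' i)%N.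
  by rewrite [RHS](bigID (mem B)) /=; congr (_ + _)%N; apply: eq_bigl => i; rewrite inE.
have := sumE B; have := sum_nth_rev s le_B; have := sumn_take_compl s_part le_sA le_B.
by rewrite -/ka -(sumn_nth le_sN) -deg_m' mdegE -splitE; lia.
Qed.

(** A transfer from j to i becomes one from i to j after m -> A - m. The two ranges for k differ;
    outside their intersection one side vanishes by the guard in [reversed], the other because [g]
    has no exponent above A. *)
Let transfer_reversed (m : 'X_{1..N}) (i j : 'I_N) : i != j -> (forall l, (m l <= A)%N) ->
  transfer_sum (reversed A g) m i j =
  transfer_sum (fun m1 => g@_m1) [multinom A - m i | i < N]%N j i.
Proof.
move=> nij le_mA; set m' := [multinom _ | i < N].
have nji : j != i by rewrite eq_sym.
have m'E l : m' l = (A - m l)%N by rewrite mnmE.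
have lhsE : transfer_sum (reversed A g) m i j = \sum_(1 <= k < A.+1 | ((k <= m j) && (k <= m'
  i))%N)
    ((m i)%:R - (m j)%:R + k.*2%:R) * g@_(transfer m' j i k).
  rewrite /transfer_sum (@big_nat_widen _ _ _ 1 (m j).+1 A.+1) ?ltnS //.
  rewrite [LHS](bigID (fun k => k <= m' i)%N) /= [X in _ + X]big1 ?addr0.
    apply: eq_bigr => k /andP[]; rewrite ltnS => le_kj le_ki; congr (_ * _).
    rewrite /reversed; case: forallP => [_|[]]; last first.
      move=> l; rewrite transferE //; have [_|_] := eqVneq l i.
        by move: le_ki; rewrite m'E; have := le_mA i; lia.
      by have [_|_] := eqVneq l j; [have := le_mA j; lia | apply: le_mA].
    congr (_@__); apply/mnmP => l; rewrite mnmE !transferE // !m'E.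
    move: le_ki; rewrite m'E; have := le_mA i; have := le_mA j.
    have [->|nli] := eqVneq l i; first by rewrite (negbTE nij); lia.
    by have [_|_] := eqVneq l j; lia.
  move=> k /andP[]; rewrite ltnS => le_kj; rewrite -ltnNge m'E => lt_ik.
  rewrite /reversed; case: forallP => [/(_ i)|_]; last by rewrite mulr0.
  by rewrite transferE // eqxx; have := le_mA i; lia.
have rhsE : transfer_sum (fun m1 => g@_m1) m' j i = \sum_(1 <= k < A.+1 | ((k <= m j) && (k <= m'
  i))%N)
    ((m i)%:R - (m j)%:R + k.*2%:R) * g@_(transfer m' j i k).
  rewrite /transfer_sum (@big_nat_widen _ _ _ 1 (m' i).+1 A.+1) ?ltnS ?m'E ?leq_subr //.
  rewrite [LHS](bigID (fun k => k <= m j)%N) /= [X in _ + X]big1 ?addr0.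
    apply: eq_big => [k|k _]; first by rewrite ltnS andbC.
    by rewrite !natrB //; congr (_ * _); ring.
  move=> k /andP[]; rewrite ltnS => le_ki; rewrite -ltnNge => lt_jk.
  rewrite (@g_big _ j) ?mulr0 // transferE ?m'E // eqxx; have := le_mA j; lia.
by rewrite lhsE rhsE.
Qed.

Let reversed_eigen (m : 'X_{1..N}) : antitone m -> eigen_eq alpha (eigval alpha ka) (reversed A
  g) m.
Proof.
move=> dec_m; rewrite /eigen_eq; have [le_mA|nle_mA] := boolP [forall i, (m i <= A)%N];
  last first.
  have rev0 (m1 : 'X_{1..N}) l : (A < m1 l)%N -> reversed A g m1 = 0.
    by move=> lt_A; rewrite /reversed; case: forallP => // /(_ l); rewrite leqNgt lt_A.
  have [l] := forallPn nle_mA; rewrite -ltnNge => lt_A.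
  rewrite (rev0 m l lt_A) !mulr0 add0r big1 ?mulr0 // => i _; apply: big1 => j lt_ij.
  rewrite /transfer_sum big_nat; apply: big1 => k /andP[k_gt0 lt_k].
  have nij : i != j by rewrite -val_eqE neq_ltn lt_ij.
  (* An exponent above A persists under transfer: if it is the donor, the receiver was at least as
     large and grows. *)
  have [lj|nlj] := eqVneq l j.
    rewrite (rev0 _ i) ?mulr0 // transferE // eqxx.
    by have := dec_m i j (ltnW lt_ij); rewrite lj in lt_A; lia.
  rewrite (rev0 _ l) ?mulr0 // transferE // (negbTE nlj).
  by have [<-|_] := eqVneq l i; lia.
have {}le_mA := forallP le_mA; set m' := [multinom A - m i | i < N]%N.
have -> : reversed A g m = g@_m'.
  by rewrite /reversed; case: forallP.
have addE i : (m i + m' i = A)%N by rewrite mnmE subnKC.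
have -> : \sum_(i < N) \sum_(j < N | (i < j)%N) transfer_sum (reversed A g) m i j =
    \sum_(i < N) \sum_(j < N | (j < i)%N) transfer_sum (fun m1 => g@_m1) m' i j.
  rewrite [RHS](exchange_big_dep predT) //=; apply: eq_bigr => i _; apply: eq_bigr => j lt_ij.
  by apply: transfer_reversed => //; rewrite -val_eqE neq_ltn lt_ij.
have := P_eigen_eq_rev m' s_part le_s.
rewrite /eigen_eq_rev -/g => eig.
have [g0|g_ne0] := eqVneq (g@_m') 0; first by move: eig; rewrite g0 !mulr0.
have [_ deg_m'] := P_supp s_part le_s g_ne0.
have rev_m : reversed A g m != 0 by rewrite /reversed; case: forallP.
have [_ deg_m] := reversed_supp rev_m.
(* By [diag_compl] the right side may be computed at the leading exponent of [ka], whose complement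
   is the leading exponent of [s] reversed. *)
have eq_e : eigval alpha ka - eigval alpha s = diag alpha m - diag_rev alpha m'.
  rewrite (diag_compl _ addE) deg_m -(diag_pexp alpha (size_compl A N s)) -(diag_rev_pexp alpha
    le_sN).
  rewrite (@diag_compl _ _ _ A) ?mdeg_pexp ?size_compl // => i.
  rewrite pexpE nth_compl // ltn_ord mnmE subnK //.
  exact: leq_trans (part_nth s_part (leq0n _)) le_sA.
have -> : eigval alpha ka = eigval alpha s + (diag alpha m - diag_rev alpha m') by rewrite -eq_e;
  ring.
by rewrite mulrDl eig; ring.
Qed.

(* Reversing the exponents [m -> A - m] conjugates the eigenvalue equation into
   itself. *)
Lemma P_compl (m : 'X_{1..N}) : (ev N (P ka))@_m = reversed A g m.
Proof.
apply/eqP; rewrite eq_sym -subr_eq0; apply/eqP; move: m.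
apply: (@eigen_eq_unique _ alpha alphaP N ka) => //.
- move=> sg m; rewrite mcoeff_ev_sym; congr (_ - _); rewrite /reversed.
  have -> : [forall i, ([multinom m (sg i) | i < N] i <= A)%N] = [forall i, (m i <= A)%N].
    apply/forallP/forallP => le_mA i; last by rewrite mnmE.
    by have := le_mA (sg^-1%g i); rewrite mnmE permKV.
  case: forallP => // _; rewrite -[in RHS](mcoeff_ev_sym (P s) sg); congr (_@__).
  by apply/mnmP => i; rewrite !mnmE.
- move=> m; have [->|/(P_supp ka_part le_ka) //] := eqVneq (ev N (P ka))@_m 0.
  by rewrite subr0; apply: reversed_supp.
- move=> m dec_m; apply: eigen_eqB; first exact: reversed_eigen.
  exact: (P_eigen_eq).
- rewrite P_lead ?size_compl // /reversed; case: forallP => [_|[]]; last first.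
    by move=> i; rewrite pexpE (leq_trans (part_nth ka_part (leq0n i))) ?nth0_compl.
  pose sg := perm (@rev_ord_inj N).
  rewrite -(mcoeff_ev_sym (P s) sg).
  have -> : [multinom [multinom A - pexp N ka i | i < N]%N (sg i) | i < N] = pexp N s.
    apply/mnmP => i; rewrite !mnmE permE /= nth_compl //.
    have -> : (N - i.+1 < N)%N by move: (ltn_ord i); lia.
    have -> : (N - (N - i.+1).+1 = i)%N by move: (ltn_ord i); lia.
    by rewrite subKn // (leq_trans (part_nth s_part (leq0n _))).
  by rewrite P_lead ?subrr.
Qed.

End Fixed.

Definition bcoef s : K := p1coef s / sqnorm s.

(** By [genf_expand], the coefficient of [P s] in prod_i (1 - x_i)^A. *)
Definition bval A s : K := bcoef s * cpoly alpha s (- (alpha * A%:R)).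

Lemma genf_expand k X : (k <= M)%N ->
  genf alpha M X k = \sum_(la : intpart k) (bcoef la * cpoly alpha la X) *: P la.
Proof.
move=> le_kM; rewrite [LHS](P_expand le_kM); last exact: whomog_genf.
apply: eq_bigr => la _; rewrite form_genf //; last first.
  by have := P_hom (intpart_part la); rewrite intpart_sumn; apply.
rewrite (eval_P) ?intpart_part ?intpart_sumn //.
by rewrite /bcoef mulrAC.
Qed.

Lemma sum_bval N A k (m : 'X_{1..N}) : (k <= M)%N ->
  \sum_(la : intpart k) bval A la * (ev N (P la))@_m =
  if mdeg m == k then genf_coef alpha M (- (alpha * A%:R)) m else 0.
Proof.
move=> le_kM; case: eqP => [deg_m|ne_deg]; last first.
  apply: big1 => la _; have [->|ne0] := eqVneq (ev N (P la))@_m 0; first by rewrite mulr0.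
  case: ne_deg; rewrite -(intpart_sumn la).
  by have [|_ ->] := P_supp (intpart_part la) _ ne0; rewrite ?intpart_sumn.
rewrite /genf_coef deg_m genf_expand // ev_sum raddf_sum; apply: eq_bigr => la _ /=.
by rewrite evZ mcoeffZ.
Qed.

(* The coefficients of [prod_i (1 - x_i)^A] are symmetric under [m -> A - m]. *)
Lemma bval_compl A N s : is_part s -> (size s <= N)%N -> (nth 0%N s 0 <= A)%N -> (N * A <= M)%N ->
  bval A (compl A N s) = (-1) ^+ (N * A) * bval A s.
Proof.
move=> s_part le_sN le_sA le_NA; set k := sumn s.
have [be be_eq] := intpart_of s_part (erefl k).
have c_sum := sumn_compl s_part le_sN le_sA.
set k' := sumn (compl A N s) in c_sum; rewrite -/k in c_sum.
have [ka ka_eq] := intpart_of (compl_part A N s_part) (erefl k').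
have le_k : (k <= M)%N by lia.
have le_k' : (k' <= M)%N by lia.
pose rect (t : seq nat) := (size t <= N)%N && (nth 0%N t 0 <= A)%N.
pose c (nu : intpart k') := bval A nu - (-1) ^+ (N * A) *
  \sum_(la : intpart k | rect la && (compl A N la == nu :> seq nat)) bval A la.
have := @P_free_ev N k' c le_k'.
move=> /(_ _ ka); rewrite ka_eq size_compl /c ka_eq => c_eq0.
have /eqP : bval A (compl A N s) - (-1) ^+ (N * A) *
    \sum_(la : intpart k | rect la && (compl A N la == compl A N s)) bval A la = 0.
  apply: c_eq0 => //; apply/mpolyP => m; rewrite mcoeff0 raddf_sum /=.
  under eq_bigr do rewrite mcoeffZ mulrBl.
  rewrite sumrB sum_bval //.
  have -> : \sum_(nu : intpart k') (-1) ^+ (N * A) *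
      (\sum_(la : intpart k | rect la && (compl A N la == nu :> seq nat)) bval A la) * (ev N (P
        nu))@_m =
      (-1) ^+ (N * A) * \sum_(la : intpart k | rect la) bval A la * (ev N (P (compl A N la)))@_m.
    under eq_bigr do rewrite -mulrA mulr_suml.
    rewrite -mulr_sumr; congr (_ * _).
    rewrite (exchange_big_dep (fun la : intpart k => rect la)) /=; last by move=> ? ? _ /andP[].
    apply: eq_bigr => la rect_la; have [le_la le_laA] := andP rect_la.
    have la_part := intpart_part la.
    have t_sum : sumn (compl A N la) = k'.
      by have := sumn_compl la_part le_la le_laA; rewrite intpart_sumn; lia.
    have [ta ta_eq] := intpart_of (compl_part A N la_part) t_sum.
    rewrite (big_pred1 ta) ?ta_eq // => nu /=; rewrite rect_la /= -ta_eq eq_sym.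
    by apply/eqP/eqP => [/intpart_inj|->].
  have -> : \sum_(la : intpart k | rect la) bval A la * (ev N (P (compl A N la)))@_m =
      \sum_(la : intpart k) bval A la * reversed A (ev N (P la)) m.
    rewrite [RHS](bigID (fun la : intpart k => rect la)) /= [X in _ + X]big1 ?addr0.
      apply: eq_bigr => la /andP[le_la le_laA].
      by rewrite (P_compl) ?intpart_part.
    (* Outside the rectangle nothing contributes: with too many rows P vanishes in N variables, and
       too long a first row contains a box of content alpha A, which kills the content product. *)
    move=> la; rewrite negb_and -!ltnNge => /orP[lt_N|lt_A].
      rewrite ev_P_eq0 ?intpart_part ?intpart_sumn // /reversed mcoeff0.
      by case: ifP; rewrite mulr0.
    by rewrite /bval cpoly_rect_eq0 // mulr0 mul0r.
  rewrite /reversed; case: forallP => [le_mA|nle_mA]; last first.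
    rewrite [X in _ - _ * X]big1 ?mulr0 ?subr0 => [|la _]; last by rewrite mulr0.
    have [m_deg|//] := eqVneq (mdeg m) k'.
    have [l] := forallPn (introN forallP nle_mA); rewrite -ltnNge => lt_A.
    by rewrite (genf_coef_big alphaP (erefl _) _ lt_A) // m_deg.
  set m' := [multinom _ | i < N]; rewrite sum_bval //.
  have addE i : (m i + m' i = A)%N by rewrite mnmE subnKC.
  have totE : (mdeg m + mdeg m' = N * A)%N.
    by rewrite !mdegE -big_split /= (eq_bigr (fun=> A)) ?sum_nat_const ?card_ord // => i _;
      apply: addE.
  have -> : (mdeg m' == k) = (mdeg m == k') by apply/eqP/eqP; lia.
  case: ifP => _; last by rewrite mulr0 subrr.
  by rewrite (genf_coef_rev alphaP (erefl _) le_NA addE) subrr.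
rewrite subr_eq0 => /eqP ->; congr (_ * _).
rewrite (big_pred1 be) ?be_eq // => la /=; apply/idP/eqP => [/andP[/andP[le_la le_laA] /eqP
  eq_c]|->].
  by apply: intpart_inj; rewrite be_eq -(complK s_part le_sN le_sA) -eq_c complK ?intpart_part.
by rewrite be_eq /rect le_sN le_sA /= eqxx.
Qed.

Let jack_lin_neq0 i j : (0 < i + j)%N -> - (alpha * i%:R) - j%:R != 0.
Proof.
by move=> /alphaP; rewrite -oppr_eq0; congr (_ != 0); ring.
Qed.

(* [s] in a rectangle with [A + 1] columns and [colrem s] in one with [A]
   columns have the same complement. *)
Lemma bcoef_hook' s : is_part s -> (size s * nth 0%N s 0 <= M)%N ->
  bcoef s = (hook' alpha s)^-1.
Proof.
have [d] := ubnP (sumn s); elim: d s => // d IHd s lt_d s_part le_M.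
have le_sM : (sumn s <= M)%N := leq_trans (sumn_le_rect s_part) le_M.
have [s0|s_gt0] := posnP (size s).
  rewrite (size0nil s0) hook'E /hook_prod big_ord0 invr1 /bcoef.
  rewrite (p1coef_hook) // hookE /hook_prod big_ord0 invr1 mul1r.
  have hP : whomog 0 (P [::]) by apply: (P_hom (s := [::])).
  have := @P_lead [::] 0 isT isT isT; rewrite (whomog0E hP) evC mcoeffC.
  have -> : pexp 0 [::] == 0%MM by apply/eqP/mnmP => -[].
  rewrite mulr1 => P0; rewrite /sqnorm (whomog0E hP) P0 mpolyC1 -mpolyX0 formXr mcoeffX eqxx
    mul1r.
  by rewrite /pweight big1 ?invr1 // => i _; rewrite mnm0E expr0 mulr1.
set N := size s in s_gt0 le_M *; have cs_part := colrem_part s_part.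
have cs_sum := sumn_colrem s_part; have cs_size := size_colrem s.
have first_gt0 : (0 < nth 0%N s 0)%N by rewrite part_nth_gt0.
case A1_eq : (nth 0%N s 0) first_gt0 le_M => [//|A] _ le_M.
have le_A : (nth 0%N s 0 <= A.+1)%N by rewrite A1_eq.
have le_csA : (nth 0%N (colrem s) 0 <= A)%N by rewrite nth_colrem // A1_eq.
have le_NA : (N * A <= M)%N by apply: leq_trans le_M; rewrite leq_mul2l leqnSn orbT.
have := bval_compl s_part (leqnn N) le_A le_M.
have := bval_compl cs_part cs_size le_csA le_NA.
rewrite compl_colrem //; set ka := compl A N (colrem s).
set Y : K := - (alpha * A.+1%:R); set Q := \prod_(i < N) (Y - i%:R).
set R := \prod_(i < N) (alpha * (1 + (nth 0%N s i).-1%:R) + (N - i.+1)%:R).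
have YA : - (alpha * A%:R) = Y + alpha by rewrite /Y -natr1; ring.
rewrite /bval YA -/Y => eq_cs eq_s.
have Q_neq0 : Q != 0 by apply/prodf_neq0 => i _; apply: jack_lin_neq0.
have c_neq0 : cpoly alpha (colrem s) (Y + alpha) != 0.
  rewrite -YA; apply/prodf_neq0 => i _; apply/prodf_neq0 => j _.
  have lt_jA : (j < A)%N.
    apply: leq_trans (ltn_ord j) _; apply: leq_trans le_csA.
    exact: part_nth.
  have := @jack_lin_neq0 (A - j) i; rewrite addn_gt0 subn_gt0 lt_jA => /(_ isT).
  by rewrite natrB 1?ltnW //; congr (_ != 0); ring.
have shift_ka := cpoly_shift alpha Y (size_compl A N (colrem s)); rewrite -/ka -/Q in shift_ka.
(* Row i of [ka] has A + 1 - s_(N-1-i) boxes, so its factor is minus the [hook'] factor of the first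
   box in row N-1-i of [s]; hence the sign and the reversal. *)
have prod_ka : \prod_(i < N) (Y + alpha * (nth 0%N ka i)%:R - i%:R) = (-1) ^+ N * R.
  rewrite /R (reindex_inj rev_ord_inj) -[N in _ ^+ N]card_ord -prodr_const -big_split.
  apply: eq_bigr => i _ /=; rewrite /ka -compl_colrem // nth_compl //.
  have -> : (N - i.+1 < N)%N by move: (ltn_ord i); lia.
  have -> : (N - (N - i.+1).+1 = i)%N by move: (ltn_ord i); lia.
  have le_i : (nth 0 s i <= A.+1)%N := leq_trans (part_nth s_part (leq0n i)) le_A.
  rewrite natrB // /Y; have := part_nth_gt0 i s_part; rewrite ltn_ord.
  by case: (nth 0%N s i) => // a _ /=; rewrite -!natr1; ring.
have sgnE : (-1) ^+ (N * A.+1) = (-1) ^+ (N * A) * (-1) ^+ N :> K by rewrite mulnS addnC exprD.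
rewrite (cpoly_colrem _ _ s_part) -/N -/Q sgnE in eq_s.
have sgn2 n : (-1) ^+ n * (-1) ^+ n = 1 :> K by rewrite -expr2 -exprM mulnC exprM sqrrN !expr1n.
(* Both complement relations involve [ka], at Y and at Y + alpha; [cpoly_shift] links the two
   values. *)
have b_rec : bcoef s * R = bcoef (colrem s).
  apply: (mulIf (mulf_neq0 c_neq0 Q_neq0)).
  have lhsE : bcoef s * (cpoly alpha (colrem s) (Y + alpha) * Q) =
      (-1) ^+ (N * A) * (-1) ^+ N * (bcoef ka * cpoly alpha ka Y).
    rewrite eq_s; set x := bcoef s * _.
    transitivity (((-1) ^+ (N * A) * (-1) ^+ (N * A)) * ((-1) ^+ N * (-1) ^+ N) * x);
      last by ring.
    by rewrite !sgn2 !mul1r.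
  have rhsE : bcoef (colrem s) * cpoly alpha (colrem s) (Y + alpha) =
      (-1) ^+ (N * A) * (bcoef ka * cpoly alpha ka (Y + alpha)).
    by rewrite eq_cs mulrA sgn2 mul1r.
  rewrite prod_ka in shift_ka.
  transitivity (bcoef s * (cpoly alpha (colrem s) (Y + alpha) * Q) * R); first by ring.
  rewrite lhsE mulrA rhsE.
  transitivity ((-1) ^+ (N * A) * bcoef ka * (cpoly alpha ka Y * ((-1) ^+ N * R))); first by ring.
  by rewrite shift_ka; ring.
rewrite hook'E hook_prod_colrem // -hook'E invfM -IHd //; last 2 first.
- by rewrite /N in s_gt0; lia.
- by apply: leq_trans le_NA; apply: leq_mul.
rewrite -b_rec -/N -/R mulfK //.
apply/prodf_neq0 => i _.
have := @alphaP (nth 0%N s i) (N - i.+1)%N; rewrite addn_gt0 part_nth_gt0 // ltn_ord => /(_ isT).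
have := part_nth_gt0 i s_part; rewrite ltn_ord; case: (nth 0%N s i) => // a _ /=.
by rewrite -natr1 mulrC [_ + 1]addrC.
Qed.

End Family.

(** * From the defining conditions to the sum *)

Section NonzeroExponents.
Local Open Scope nat_scope.
Variable N : nat.
Implicit Types (m : 'X_{1..N}) (s : seq nat).

Definition nz m := [seq e <- [seq m i | i : 'I_N] | e != 0].

Lemma size_nz m : size (nz m) <= N.
Proof. by rewrite size_filter (leq_trans (count_size _ _)) // size_image card_ord. Qed.

Lemma codom_mnm m : [seq m i | i : 'I_N] = m :> seq nat.
Proof.
apply: (@eq_from_nth _ 0); first by rewrite size_image card_ord size_tuple.
move=> i; rewrite size_image card_ord => lt_i.
rewrite -(mnm_nth 0 m (Ordinal lt_i)) (nth_map (Ordinal lt_i)) ?size_enum_ord //.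
by congr (m _); apply: val_inj; rewrite /= nth_enum_ord.
Qed.

Lemma nzE m : nz m = [seq e <- m | 0 < e].
Proof. by rewrite /nz codom_mnm; apply: eq_filter => e; rewrite lt0n. Qed.

Lemma dec_sorted m : antitone m -> sorted geq m.
Proof.
move=> dec_m; apply/(sortedP 0) => i; rewrite size_tuple => lt_i.
have := dec_m (Ordinal (ltnW lt_i)) (Ordinal lt_i) (leqnSn i).
by rewrite !(mnm_nth 0).
Qed.

Lemma nz_part m : antitone m -> is_part (nz m).
Proof.
move=> dec_m; rewrite nzE; apply/andP; split; last exact: filter_all.
by apply: sorted_filter (dec_sorted dec_m) => x y z /= ? ?; lia.
Qed.

Lemma pexp_nz m : antitone m -> pexp N (nz m) = m.
Proof.
move=> dec_m; apply/mnmP => i; rewrite pexpE nzE nth_filter_pos ?dec_sorted //.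
by rewrite (mnm_nth 0).
Qed.

Lemma nz_pexp s : is_part s -> size s <= N -> nz (pexp N s) = s.
Proof.
move=> s_part le_sN; have dec_s := @dec_pexp N s s_part.
by apply: (@pexp_inj N); rewrite ?nz_part ?size_nz ?pexp_nz.
Qed.

Lemma nz_perm m (sg : {perm 'I_N}) : perm_eq (nz [multinom m (sg i) | i < N]) (nz m).
Proof.
by rewrite !nzE; apply: perm_filter; apply/tuple_permP; exists sg.
Qed.

Lemma part_perm_eq s t : is_part s -> is_part t -> perm_eq s t -> s = t.
Proof.
move=> /andP[s_sorted _] /andP[t_sorted _]; apply: (sorted_eq (leT := geq)) => //.
  by move=> x y z /= ? ?; lia.
by move=> x y /=; lia.
Qed.

Lemma nz_sort m s : is_part s -> perm_eq (nz m) s ->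
  exists sg : {perm 'I_N}, [multinom m (sg i) | i < N] = pexp N s.
Proof.
move=> s_part eq_ms; have [sg dec_m] := sort_mnm m; exists sg.
rewrite -(pexp_nz dec_m); congr (pexp _ _); apply: part_perm_eq => //; first exact: nz_part.
exact: perm_trans (nz_perm m sg) eq_ms.
Qed.

(** Remove the largest index of [A]: it is at least #|A| - 1, so its value is at most the last term
    of the prefix. *)
Lemma sum_le_prefix (f : nat -> nat) (A : {set 'I_N}) : {homo f : i j / i <= j >-> j <= i} ->
  \sum_(i in A) f i <= \sum_(i < #|A|) f i.
Proof.
move=> f_dec; have [c] := ubnP #|A|; elim: c A => // c IHc A lt_c.
have [->|[i0 i0A]] := set_0Vmem A; first by rewrite big_set0.
case: (@arg_maxnP _ i0 (mem A) (@nat_of_ord N) i0A) => a a_in a_max; have aA : a \in A := a_in.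
have cardA : #|A| = (#|A :\ a|).+1 by rewrite (cardsD1 a A) aA.
have le_A : #|A| <= a.+1.
  rewrite -(card_set_ord_lt (ltn_ord a)); apply: subset_leq_card; apply/subsetP => i iA.
  by rewrite inE ltnS; apply: a_max.
rewrite (big_setD1 a) //= cardA sum_ordS addnC leq_add ?IHc //; first by rewrite cardA in lt_c.
by apply: f_dec; rewrite cardA in le_A.
Qed.

Lemma dom_refl s : is_part s -> dom s (pexp N s).
Proof.
move=> s_part A; rewrite sumn_take.
rewrite (eq_bigr (fun i : 'I_N => nth 0 s i)) => [|i _]; last by rewrite pexpE.
by apply: sum_le_prefix => i j; apply: part_nth.
Qed.

Lemma dom_nz m s : is_part s -> perm_eq (nz m) s -> dom s m /\ mdeg m = sumn s.
Proof.
move=> s_part eq_ms; have [sg m_eq] := nz_sort s_part eq_ms.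
have le_sN : size s <= N by rewrite -(perm_size eq_ms) size_nz.
have m_sg : m = [multinom (pexp N s) (sg^-1%g i) | i < N].
  by apply/mnmP => i; rewrite mnmE -m_eq mnmE permKV.
split; first by rewrite m_sg; apply: dom_perm; apply: dom_refl.
rewrite -(mdeg_pexp le_sN) -m_eq !mdegE [LHS](reindex_inj (@perm_inj _ sg)).
by apply: eq_bigr => i _; rewrite mnmE.
Qed.

End NonzeroExponents.

Lemma dom_dominated k (mu la : intpart k) N (m : 'X_{1..N}) :
  dominated mu la -> dom mu m -> dom la m.
Proof.
move=> /forallP le_ml dom_m A; apply: leq_trans (dom_m A) _.
have [lt_A|le_A] := ltnP #|A| k.+1; first exact: le_ml (Ordinal lt_A).
have szE (nu : intpart k) : (size nu <= #|A|)%N.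
  apply: leq_trans (size_le_sum_part (intpart_part nu)) _.
  by rewrite intpart_sumn ltnW.
by rewrite !take_oversize // !intpart_sumn.
Qed.

Lemma mcoeff_monomial_sym (K : fieldType) N s (m : 'X_{1..N}) : is_part s ->
  (monomial_sym K s N)@_m = (perm_eq (nz m) s)%:R.
Proof.
move=> s_part; rewrite /monomial_sym raddf_sum /=.
have [eq_ms|ne_ms] := boolP (perm_eq (nz m) s).
  have lt_m : (mdeg m < (sumn s).+1)%N by have [_ ->] := dom_nz s_part eq_ms.
  rewrite (bigD1 (BMultinom lt_m)) //= mcoeffX eqxx big1 ?addr0 // => m' /andP[_ ne_m'].
  by rewrite mcoeffX; case: eqP => // m'_eq; case/eqP: ne_m'; apply: val_inj.
by apply: big1 => m' eq_ms; rewrite mcoeffX; case: eqP => // m'_eq; move: ne_ms;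
  rewrite -m'_eq eq_ms.
Qed.

Section PartitionMonomialProducts.
Variables (K : fieldType) (alpha : K) (M : nat).

Lemma pmn_cons x s (lt_x : (x < M)%N) : pmn M (x.+1 :: s) = (U_(Ordinal lt_x) + pmn M s)%MM.
Proof. by apply/mnmP => i; rewrite mnmDE !mnmE /= eqSS -val_eqE. Qed.

Lemma part_parts_le s : is_part s -> (sumn s <= M)%N -> all (fun x => 0 < x <= M)%N s.
Proof.
move=> /andP[_ /allP s_pos] le_sM; apply/allP => x xs.
by rewrite s_pos //= (leq_trans (mem_le_sumn xs)).
Qed.

Lemma ev_pmn N s : is_part s -> (sumn s <= M)%N ->
  ev N ('X_[pmn M s] : {mpoly K[M]}) = power_sym K s N.
Proof.
move=> s_part le_sM; have := part_parts_le s_part le_sM; rewrite /power_sym.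
elim: s {s_part le_sM} => [_|[|x] s IHs] //=.
  rewrite big_nil; have -> : pmn M [::] = 0%MM by apply/mnmP => i; rewrite !mnmE.
  by rewrite mpolyX0 -mpolyC1 evC.
case/andP=> lt_x /IHs IH; rewrite big_cons (pmn_cons _ lt_x) mpolyXD evM IH evXU.
by [].
Qed.

Lemma mdeg_pmn s : is_part s -> (sumn s <= M)%N -> mdeg (pmn M s) = size s.
Proof.
move=> s_part le_sM; have := part_parts_le s_part le_sM.
elim: s {s_part le_sM} => [_|[|x] s IHs] //=.
  by rewrite mdegE big1 // => i _; rewrite mnmE.
by case/andP=> lt_x /IHs IH; rewrite (pmn_cons _ lt_x) mdegD mdeg1 IH.
Qed.

Lemma pweight_pmn s : is_part s -> (sumn s <= M)%N ->
  pweight alpha (pmn M s) = alpha ^+ size s * (zpart s)%:R.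
Proof.
move=> s_part le_sM; rewrite -(mdeg_pmn s_part le_sM) mdegE expr_sum /zpart natr_prod.
have perm_s : perm_eq (undup s) [seq (i : 'I_M).+1 | i <- enum 'I_M & (i : 'I_M).+1 \in s].
  apply: uniq_perm; first exact: undup_uniq.
    rewrite map_inj_uniq => [|i j [/val_inj]//].
    by apply: filter_uniq; apply: enum_uniq.
  move=> x; rewrite mem_undup; apply/idP/mapP => [xs|[i]]; last first.
    by rewrite mem_filter => /andP[i_s _] ->.
  have /allP/(_ x xs)/andP[x_gt0 x_le] := part_parts_le s_part le_sM.
  have lt_x : (x.-1 < M)%N by lia.
  exists (Ordinal lt_x); last by rewrite /= prednK.
  by rewrite mem_filter mem_enum /= prednK // xs.
rewrite (perm_big _ perm_s) big_map big_filter big_enum_cond /=.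
rewrite [X in _ * X]big_mkcond -big_split.
apply: eq_bigr => i _ /=; rewrite !mnmE; case: ifP => [_|/negbT/count_memPn ->].
  by rewrite exprMn natrM natrX mulrA.
by rewrite !expr0 mul1r fact0.
Qed.

Lemma mcoeff_pmn_sum k (c : intpart k -> K) (be : intpart k) : (k <= M)%N ->
  (\sum_mu c mu *: 'X_[pmn M mu])@_(pmn M be) = c be.
Proof.
move=> le_kM; rewrite raddf_sum (bigD1 be) //= mcoeffZ mcoeffX eqxx mulr1 big1 ?addr0 //.
move=> mu ne_mu; rewrite mcoeffZ mcoeffX; case: eqP => [e|]; last by rewrite mulr0.
case/eqP: ne_mu; apply: intpart_inj.
by apply: (pmn_inj (M := M)); rewrite ?intpart_part ?intpart_sumn.
Qed.

Lemma whomog_pmn_sum k (c : intpart k -> K) : (k <= M)%N -> whomog k (\sum_mu c mu *: 'X_[pmn M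
  mu]).
Proof.
move=> le_kM; apply: supp_in_sum => mu _; apply: supp_inZ => m; rewrite mcoeffX.
have [<- _|_] := eqVneq (pmn M mu) m; last by rewrite eqxx.
by rewrite mnmwgt_pmn ?intpart_part ?intpart_sumn.
Qed.

End PartitionMonomialProducts.

Section LengthFiltration.
Variables (K : fieldType) (alpha : K) (M n : nat).
Implicit Types F : {mpoly K[M]}.

(** Degree in the symbols p_k counts parts. Only the joining terms merge two parts; all others keep
    or raise the count. *)
Lemma D2_mdeg r F : supp_in (fun m => n <= mdeg m + r)%N F ->
  supp_in (fun m => n <= mdeg m + r.+1)%N (D2 alpha F).
Proof.
move=> hF; apply: supp_inD.
  apply: supp_in_sum => i _; apply: supp_in_sum => j _; apply: supp_in_sum => l _.
  apply: supp_inD.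
    apply: supp_inC; apply: supp_inXM; apply: supp_in_deriv; apply: supp_in_deriv.
    by apply: supp_inS hF => m le_m m' m_eq m'' m'_eq; move: le_m;
      rewrite m_eq m'_eq !mdegD !mdeg1; lia.
  apply: supp_inn; rewrite -mulrA; apply: supp_inXM; apply: supp_inXM; apply: supp_in_deriv.
  by apply: supp_inS hF => m le_m m' m_eq; move: le_m; rewrite m_eq !mdegD !mdeg1; lia.
apply: supp_inC; apply: supp_in_sum => i _; apply: supp_inn; apply: supp_inXM.
by apply: supp_in_deriv; apply: supp_inS hF => m le_m m' m_eq; move: le_m;
  rewrite m_eq !mdegD !mdeg1; lia.
Qed.

Lemma iter_D2_mdeg r F : supp_in (fun m => n <= mdeg m)%N F ->
  supp_in (fun m => n <= mdeg m + r)%N (iter r (@D2 K alpha M) F).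
Proof.
move=> hF; elim: r => [|r IHr] /=; last exact: D2_mdeg.
by apply: supp_inS hF => m; rewrite addn0.
Qed.

(** Only p_1 p_1 d/dp_2, with coefficient 2, can produce a pure power of p_1: the other terms
    contain some p_l with l >= 2, except the first order term in p_1, whose coefficient is 0. *)
Lemma mcoeff_D2_p1 (o i1 : 'I_M) k F : o = 0%N :> nat -> i1 = 1%N :> nat ->
  (D2 alpha F)@_(U_(o) *+ k.+2) = 2%:R * F@_(U_(o) *+ k + U_(i1)).
Proof.
move=> o0 i1_1; set m := (U_(o) *+ k.+2)%MM.
have mE l : m l = if l == o then k.+2 else 0%N.
  by rewrite mulmnE mnm1E eq_sym; case: eqP; rewrite ?mul1n.
have XM0 l G : l != o -> ('X_l * G)@_m = 0 :> K by move=> ne_l; rewrite mcoeffXM mE (negbTE ne_l).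
have lin0 : (D2lin F)@_m = 0.
  rewrite (raddf_sum (mcoeff m)); apply: big1 => i _ /=; rewrite -mpolyC_nat mcoeffCM.
  have [->|ne_i] := eqVneq i o; first by rewrite o0 muln0 mul0r.
  by rewrite XM0 ?mulr0.
have quadE : (D2quad alpha F)@_m = \sum_(i < M) \sum_(j < M) \sum_(l < M | l == (i + j).+1 :> nat)
    l.+1%:R * ('X_i * ('X_j * F^`M(l)))@_m.
  rewrite (raddf_sum (mcoeff m)); apply: eq_bigr => i _ /=.
  rewrite (raddf_sum (mcoeff m)); apply: eq_bigr => j _ /=.
  rewrite (raddf_sum (mcoeff m)); apply: eq_bigr => l /eqP l_eq /=.
  rewrite mcoeffD mcoeffCM XM0 ?mulr0 ?add0r; last by rewrite -val_eqE /= o0 l_eq.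
  by rewrite -mpolyC_nat mcoeffCM mulrA.
rewrite D2E mcoeffD mcoeffCM lin0 mulr0 addr0 quadE.
rewrite (bigD1 o) //= [X in _ + X]big1 ?addr0 => [|i ne_i]; last first.
  by apply: big1 => j _; apply: big1 => l _; rewrite XM0 ?mulr0.
rewrite (bigD1 o) //= [X in _ + X]big1 ?addr0 => [|j ne_j]; last first.
  by apply: big1 => l _; rewrite mulrCA XM0 ?mulr0.
rewrite (big_pred1 i1) => [|l]; last by rewrite [RHS]/= -[RHS]val_eqE /= o0 i1_1.
rewrite i1_1 !mcoeffXM mnmBE mE mnm1E eqxx /=.
rewrite mcoeff_deriv.
have -> : (m - U_(o) - U_(o))%MM = (U_(o) *+ k)%MM.
  by apply/mnmP => l; rewrite !mnmBE !mulmnE mnm1E; case: eqP; rewrite /=; lia.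
by rewrite mulmnE mnm1E -val_eqE /= o0 i1_1.
Qed.

End LengthFiltration.

Section JackFamily.
Variables (K : fieldType) (alpha : K).
Hypothesis alphaP : jack_parameter alpha.
Variable J : forall n : nat, intpart n -> symfun K.
Hypothesis HJ : is_jack alpha J.
Variable theta : forall n : nat, intpart n -> intpart n -> K.
Hypothesis Htheta : is_jack_character J theta.
Variable M : nat.

(** Indexed by plain sequences, as in the abstract family, so that the degree can vary without
    transport along equalities; 0 is a dummy value. *)
Definition jackP (s : seq nat) : {mpoly K[M]} :=
  if insub s is Some la then
    (hook alpha s)^-1 *: \sum_(mu : intpart (sumn s)) theta la mu *: 'X_[pmn M mu]
  else 0.

Lemma jackPE k (la : intpart k) : jackP la =
  (hook alpha la)^-1 *: \sum_(mu : intpart k) theta la mu *: 'X_[pmn M mu].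
Proof.
have e := intpart_sumn la; case: la e => s s_part /= e; case: k / e s_part => s_part.
by rewrite /jackP (valK (IntPart s_part)).
Qed.

Lemma ev_jackP N k (la : intpart k) : (k <= M)%N ->
  ev N (jackP la) = (hook alpha la)^-1 *: J la N.
Proof.
move=> le_kM; rewrite jackPE evZ ev_sum (Htheta la N); congr (_ *: _); apply: eq_bigr => mu _.
by rewrite evZ ev_pmn ?intpart_part ?intpart_sumn.
Qed.

Lemma mcoeff_ev_jackP N k (la : intpart k) : (k <= M)%N ->
  exists u : intpart k -> K, forall m : 'X_{1..N},
  (ev N (jackP la))@_m = (perm_eq (nz m) la)%:R
    + \sum_(mu | dominated mu la && (mu != la)) u mu * (perm_eq (nz m) mu)%:R.
Proof.
move=> le_kM; have [_ /(_ k la)[u J_eq]] := HJ; exists (fun mu => (hook alpha la)^-1 * u mu) => m.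
rewrite ev_jackP // J_eq mcoeffZ mcoeffD mcoeffZ mcoeff_monomial_sym ?intpart_part // mulrDr
  mulKf.
  rewrite raddf_sum mulr_sumr; congr (_ + _); apply: eq_bigr => mu _ /=.
  by rewrite mcoeffZ mcoeff_monomial_sym ?intpart_part // mulrA.
exact: hook_neq0.
Qed.

Lemma jackP_supp s N (m : 'X_{1..N}) : is_part s -> (sumn s <= M)%N ->
  (ev N (jackP s))@_m != 0 -> dom s m /\ mdeg m = sumn s.
Proof.
move=> s_part le_sM; have [la la_eq] := intpart_of s_part (erefl (sumn s)).
have [u] := @mcoeff_ev_jackP N _ la le_sM; rewrite la_eq => /(_ m) ->.
have [eq_s|_] := boolP (perm_eq (nz m) s); first by move=> _; apply: dom_nz.
rewrite add0r => sum_ne0.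
have [mu /andP[dom_mu _] eq_mu] : exists2 mu : intpart (sumn s),
    dominated mu la && (mu != la) & perm_eq (nz m) mu.
  apply/exists_inP; apply: contraNT sum_ne0; rewrite negb_exists_in => /forall_inP no_mu.
  by rewrite big1 // => mu /no_mu/negbTE ->; rewrite mulr0.
have [dom_m deg_m] := dom_nz (intpart_part mu) eq_mu.
by split; [rewrite -la_eq; apply: dom_dominated dom_m | rewrite deg_m intpart_sumn].
Qed.

Lemma jackP_lead s N : is_part s -> (sumn s <= M)%N -> (size s <= N)%N ->
  (ev N (jackP s))@_(pexp N s) = 1.
Proof.
move=> s_part le_sM le_sN; have [la la_eq] := intpart_of s_part (erefl (sumn s)).
have [u] := @mcoeff_ev_jackP N _ la le_sM; rewrite la_eq => ->.
rewrite nz_pexp // perm_refl big1 ?addr0 // => mu /andP[_ ne_mu].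
have [eq_mu|] := boolP (perm_eq s mu); last by rewrite mulr0.
case/eqP: ne_mu; apply: intpart_inj; rewrite la_eq.
by apply/esym/part_perm_eq; rewrite ?intpart_part.
Qed.

Lemma jackP_hom s : is_part s -> (sumn s <= M)%N -> whomog (sumn s) (jackP s).
Proof.
move=> s_part le_sM; have [la la_eq] := intpart_of s_part (erefl (sumn s)).
by rewrite -{2}la_eq jackPE; apply: supp_inZ; apply: whomog_pmn_sum.
Qed.

Lemma jackP_orth s t : is_part s -> is_part t -> (sumn s <= M)%N ->
  sumn s = sumn t -> s <> t -> form alpha (jackP s) (jackP t) = 0.
Proof.
move=> s_part t_part le_sM eq_st ne_st.
have [la la_eq] := intpart_of s_part (erefl (sumn s)).
have [mu mu_eq] := intpart_of t_part (esym eq_st).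
have ne_lamu : la != mu by apply/eqP => e; case: ne_st; rewrite -la_eq e.
have [/(_ _ la mu ne_lamu) orth _] := HJ.
rewrite -{1}la_eq -mu_eq !jackPE formZl formZr.
rewrite form_sumr (eq_bigr (fun nu : intpart (sumn s) => theta la nu * theta mu nu *
    (alpha ^+ size nu * (zpart nu)%:R))) => [|nu _].
  by rewrite (orth _ _ (Htheta la) (Htheta mu)) !mulr0.
rewrite formZr formXr mcoeff_pmn_sum // pweight_pmn ?intpart_part ?intpart_sumn //.
by ring.
Qed.

Lemma thetaE k (la mu : intpart k) : (k <= M)%N ->
  theta la mu = hook alpha la * (jackP la)@_(pmn M mu).
Proof.
by move=> le_kM; rewrite jackPE mcoeffZ mcoeff_pmn_sum // mulVKf // hook_neq0.
Qed.

Variables o i1 : 'I_M.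
Hypotheses (o0 : o = 0%N :> nat) (i1_1 : i1 = 1%N :> nat).

Lemma pmn_rho k : pmn M (rho k.+2) = (U_(o) *+ k + U_(i1))%MM.
Proof.
have rho_part : is_partition k.+2 (2 :: nseq k 1)%N.
  apply/and3P; split; last by rewrite /= sumn_nseq mul1n.
    have path_ones j x : (0 < x)%N -> path geq x (nseq j 1%N) by elim: j x => //= j IHj x ->;
      apply: IHj.
    exact: path_ones.
  by rewrite /= all_nseq orbT.
rewrite /rho insubdK; last by rewrite -topredE /= subSS subSS subn0.
apply/mnmP => i; rewrite mnmE mnmDE mulmnE !mnm1E /= !subSS subn0 count_nseq /=.
rewrite -!val_eqE /= o0 i1_1 addnC; congr (_ + _)%N.
Qed.

Lemma theta_rho k (la : intpart k.+2) : (k.+2 <= M)%N ->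
  2%:R * theta la (rho k.+2) = eigval alpha la.
Proof.
move=> le_kM; rewrite thetaE // pmn_rho mulrCA -(mcoeff_D2_p1 alpha _ _ o0 i1_1).
rewrite (D2_P alphaP jackP_supp jackP_lead jackP_hom jackP_orth) ?intpart_part ?intpart_sumn //.
rewrite mcoeffZ; have := p1coef_hook alphaP jackP_supp jackP_lead jackP_hom jackP_orth o0
  (intpart_part la).
rewrite /p1coef intpart_sumn => -> //.
by rewrite mulrCA mulfV ?mulr1 ?hook_neq0.
Qed.

Lemma iter_D2_jackP r k (la : intpart k) : (k <= M)%N ->
  iter r (@D2 K alpha M) (jackP la) = eigval alpha la ^+ r *: jackP la.
Proof.
move=> le_kM; elim: r => [|r IHr] /=; first by rewrite expr0 scale1r.
rewrite IHr D2Z (D2_P alphaP jackP_supp jackP_lead jackP_hom jackP_orth) ?intpart_part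
  ?intpart_sumn //.
by rewrite scalerA exprSr.
Qed.

Lemma iter_D2_sum (I : Type) (q : seq I) (c : I -> K) (f : I -> {mpoly K[M]}) r :
  iter r (@D2 K alpha M) (\sum_(i <- q) c i *: f i) = \sum_(i <- q) c i *: iter r (@D2 K alpha M)
    (f i).
Proof.
elim: r => [|r IHr] //=; rewrite IHr D2_sum; apply: eq_bigr => i _.
by rewrite D2Z.
Qed.

(* [n^2] power sums leave room for the complements used in [bcoef_hook']. *)
Lemma jack_sum_eq0 k (la : intpart k.+2) r : (k.+2 * k.+2 <= M)%N ->
  (r < k.+2 - size la)%N -> jack_sum alpha theta r la = 0.
Proof.
move=> le_kkM lt_r; set n := k.+2 in la le_kkM lt_r *.
have le_nM : (n <= M)%N by apply: leq_trans le_kkM; rewrite leq_pmulr.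
have two_ne0 : 2%:R != 0 :> K by apply: (natr_neq0 alphaP).
pose F : {mpoly K[M]} := \sum_(be : intpart n) (hook' alpha be)^-1 *: jackP be.
(* [D2] has eigenvalue 2 theta_rho, hence the factor 2^-r. *)
have sumE : jack_sum alpha theta r la = (2%:R ^- r) * (iter r (@D2 K alpha M) F)@_(pmn M la).
  rewrite /F iter_D2_sum raddf_sum mulr_sumr; apply: eq_bigr => be _ /=.
  rewrite iter_D2_jackP // !mcoeffZ -theta_rho // exprMn (thetaE be la) // invfM.
  have h0 := hook_neq0 alphaP be; have h'0 := hook'_neq0 alphaP be.
  have e0 : 2%:R ^+ r != 0 :> K by apply: expf_neq0.
  by field; rewrite h0 h'0 e0.
have wgt_p1 j : mnmwgt (U_(o) *+ j)%MM = j.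
  by elim: j => [|j IHj]; rewrite ?mulm0n ?mnmwgt0 // mulmS mnmwgtD mnmwgt1 IHj o0.
pose p1n : {mpoly K[M]} := 'X_[U_(o) *+ n].
have p1n_hom : whomog n p1n.
  move=> m; rewrite mcoeffX; have [<- _|_] := eqVneq (U_(o) *+ n)%MM m; last by rewrite eqxx.
  exact: wgt_p1.
have F_eq : F = (pweight alpha (U_(o) *+ n)%MM)^-1 *: p1n.
  rewrite [p1n](P_expand alphaP jackP_supp jackP_lead jackP_hom jackP_orth le_nM p1n_hom).
  rewrite scaler_sumr; apply: eq_bigr => be _; rewrite scalerA; congr (_ *: _).
  rewrite -(bcoef_hook' alphaP jackP_supp jackP_lead jackP_hom jackP_orth o0) ?intpart_part //.
    rewrite /bcoef /p1coef intpart_sumn formXr.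
    by rewrite [_ * pweight _ _]mulrC -mulrA mulKf // pweight_neq0.
  apply: leq_trans le_kkM; apply: leq_mul.
    by rewrite -[X in (_ <= X)%N](intpart_sumn be) size_le_sum_part // intpart_part.
  rewrite -[X in (_ <= X)%N](intpart_sumn be).
  by case: (parts be) => //= x s; apply: leq_addr.
rewrite sumE; apply/eqP; rewrite mulf_eq0; apply/orP; right.
have F_supp : supp_in (fun m => n <= mdeg m)%N F.
  rewrite F_eq; apply: supp_inZ => m; rewrite mcoeffX.
  have [<- _|_] := eqVneq (U_(o) *+ n)%MM m; last by rewrite eqxx.
  by rewrite mdegMn mdeg1 mul1n.
apply/negPn/negP => /(iter_D2_mdeg (alpha := alpha) (r := r) F_supp).
rewrite mdeg_pmn ?intpart_part ?intpart_sumn //.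
by move: lt_r; lia.
Qed.

End JackFamily.

Theorem theorem1 (K : fieldType) (alpha : K) (Halpha : jack_parameter alpha)
    (J : forall n : nat, intpart n -> symfun K) (HJ : is_jack alpha J)
    (theta : forall n : nat, intpart n -> intpart n -> K)
    (Htheta : is_jack_character J theta)
    (n : nat) (Hn : (1 <= n)%N) (la : intpart n) (r : nat)
    (Hr : (r < sumn la - size la)%N) :
  jack_sum alpha theta r la = 0.
Proof.
have la_sum := intpart_sumn la; case: n Hn la Hr la_sum => [|[|k]] // _ la;
  rewrite intpart_sumn => Hr _.
  (* For n = 1 the partition is nonempty, so the bound reads r < 0. *)
  case: (parts la) (intpart_sumn la) Hr => [|x s] //= _; lia.
by apply: (@jack_sum_eq0 _ _ Halpha J HJ theta Htheta (k.+2 * k.+2)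
  (Ordinal (isT : 0 < k.+2 * k.+2)%N) (Ordinal (isT : 1 < k.+2 * k.+2)%N)).
Qed.
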